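(* Suppose that a symbol $\psi\in\mathfrak{G}_{\geq1}$ induces a compact composition operator $C_\psi$ on $\mathcal{H}^2$. Then $$\lim_{\operatorname{Re}w\to0^+}\int_{\mathbb{T}^\infty}\frac{\mathcal{N}_{\psi_\chi}(w)}{\operatorname{Re}w}\,dm_\infty(\chi)=0 .$$
   Context: For $\theta\in\mathbb{R}$, $\mathbb{C}_\theta=\{z\in\mathbb{C}:\operatorname{Re}z>\theta\}$. The limit is over $w\in\mathbb{C}_0$ with $\operatorname{Re}w\to0^+$ (with no restriction on $\operatorname{Im}w$). $\mathcal{H}^2$ is the Hilbert space of ordinary Dirichlet series $f(s)=\sum_{n\ge1}a_nn^{-s}$ with $\|f\|^2=\sum_{n\ge1}|a_n|^2<\infty$; its elements are holomorphic in $\mathbb{C}_{1/2}$. The class $\mathfrak{G}_{\ge1}$ consists of all functions $\psi(s)=c_0s+\varphi(s)$ where $c_0\ge1$ is an integer and $\varphi(s)=\sum_{n\ge1}c_nn^{-s}$ is an ordinary Dirichlet series, converging uniformly in $\mathbb{C}_\varepsilon$ for every $\varepsilon>0$, such that either $\varphi(\mathbb{C}_0)\subset\mathbb{C}_0$ or $\varphi\equiv i\tau$ for some $\tau\in\mathbb{R}$. For $\psi\in\mathfrak{G}_{\ge1}$, $C_\psi f=f\circ\psi$ is a bounded operator on $\mathcal{H}^2$. $\mathbb{T}^\infty$ is the countably infinite product of unit circles with normalized Haar measure $m_\infty$ (the product of normalized Lebesgue measures). A point $\chi=(\chi_1,\chi_2,\dots)\in\mathbb{T}^\infty$ is identified with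 the completely multiplicative function $\chi:\mathbb{N}\to\mathbb{T}$ with $\chi(p_j)=\chi_j$, where $p_j$ is the $j$-th prime. Set $\varphi_\chi(s)=\sum_{n\ge1}c_n\chi(n)n^{-s}$ and $\psi_\chi(s)=c_0s+\varphi_\chi(s)$ for $s\in\mathbb{C}_0$. The counting function is $$\mathcal{N}_{\psi_\chi}(w)=\sum_{s\in\psi_\chi^{-1}(\{w\}),\ \operatorname{Re}s>0}\operatorname{Re}s,\qquad w\in\mathbb{C}_0,$$ with preimages counted with multiplicity. *)

(* Defs.v *)
From HB Require Import structures.
From mathcomp Require Import all_boot all_order all_algebra.
From mathcomp Require Import complex.
From mathcomp Require Import all_classical all_reals all_analysis.
From mathcomp Require Import ring.

Set Implicit Arguments.
Unset Strict Implicit.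
Unset Printing Implicit Defensive.

Import Order.TTheory GRing.Theory Num.Theory.
Import numFieldNormedType.Exports.

Local Open Scope classical_set_scope.
Local Open Scope ring_scope.
Local Open Scope complex_scope.

(* otherwise shadowed by the homonyms of ssrnum *)
Local Notation Re := complex.Re.
Local Notation Im := complex.Im.

(* [R[i]] gets the topology of its modulus (it is a normed space over itself),
   exactly as [numFieldNormedType.Exports] does for abstract number fields. *)
HB.instance Definition _ (R : realType) := NormedModule.copy R[i] (R[i])^o.

Section dirichlet_series.
Variable R : realType.
Implicit Types (s z : R[i]) (a : nat -> R[i]).

Definition half_plane (theta : R) : set R[i] := [set s | theta < Re s].

Definition cexp z : R[i] :=
  (expR (Re z))%:C * (cos (Im z) +i* sin (Im z)).

(* n^{-s}, for n >= 1 *)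
Definition npow_opp (n : nat) s : R[i] := cexp (- s * (ln (n%:R : R))%:C).

(* A Dirichlet series sum_(n >= 1) a_n n^{-s} is represented by the sequence
   whose value at k is the coefficient a_(k+1) of (k+1)^{-s}. *)
Definition dirichlet_terms a s : nat -> R[i] :=
  fun k => a k * npow_opp k.+1 s.

Definition dirichlet_partial a (N : nat) : R[i] -> R[i] :=
  fun s => series (dirichlet_terms a s) N.

(* total function; meaningful where the series converges *)
Definition dirichlet a s : R[i] := limn (dirichlet_partial a ^~ s).

End dirichlet_series.

Section hardy_space.
Variable R : realType.
Implicit Types a b : nat -> R[i].

Definition sumsq a : \bar R :=
  (\sum_(0 <= k <oo) (Normc.normc (a k) ^+ 2)%:E)%E.

Definition H2_pred : {pred nat -> R[i]} := [pred a | `[< (sumsq a < +oo)%E >]].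

Let sumsq_ge0 a : (0 <= sumsq a)%E.
Proof. by apply: nneseries_ge0 => k _ _; rewrite lee_fin sqr_ge0. Qed.

Let sumsqZ (l : R[i]) a :
  sumsq (l *: a) = ((Normc.normc l ^+ 2)%:E * sumsq a)%E.
Proof.
rewrite /sumsq -nneseriesZl; last by move=> k _; rewrite lee_fin sqr_ge0.
by apply: eq_eseriesr => k _; rewrite -EFinM -exprMn -Normc.normcM.
Qed.

Let sumsqD a b (t : R) : 0 < t ->
  (sumsq (a + b)%R <=
     (1 + t)%:E * sumsq a + (1 + t^-1)%:E * sumsq b)%E.
Proof.
move=> t0; have ti0 : 0 < t^-1 by rewrite invr_gt0.
rewrite /sumsq -!nneseriesZl; [|by move=> *; rewrite lee_fin sqr_ge0..].
rewrite -nneseriesD; [|by move=> k _ _; rewrite -EFinM lee_fin mulr_ge0 ?sqr_ge0 ?addr_ge0 ?ltW..].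
apply: lee_nneseries => [k _ _|k _]; first by rewrite lee_fin sqr_ge0.
rewrite -!EFinM -EFinD lee_fin.
have ab : Normc.normc ((a + b) k) <= Normc.normc (a k) + Normc.normc (b k).
  exact: (@le_normcD R (a k) (b k)).
have n0 (z : R[i]) : 0 <= Normc.normc z by case: z => x y; exact: sqrtr_ge0.
apply: (@le_trans _ _ ((Normc.normc (a k) + Normc.normc (b k)) ^+ 2)).
  by rewrite lerXn2r ?nnegrE ?addr_ge0 ?n0.
set x := Normc.normc (a k); set y := Normc.normc (b k).
rewrite -subr_ge0.
suff -> : (1 + t) * x ^+ 2 + (1 + t^-1) * y ^+ 2 - (x + y) ^+ 2 =
          t * (x - t^-1 * y) ^+ 2 by rewrite mulr_ge0 ?sqr_ge0 ?ltW.
by field; rewrite gt_eqF.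
Qed.

Lemma H2_submod_closed : submod_closed H2_pred.
Proof.
split=> [|l a b].
  rewrite inE /sumsq eseries0; last first.
    by move=> k _ _ /=; rewrite expr0n/= addr0 sqrtr0 expr0n.
  by rewrite -[X in (X < _)%E]/(0%:E)%E; exact: ltry.
rewrite !inE => a_fin b_fin.
apply: (le_lt_trans (sumsqD _ _ ltr01)); rewrite sumsqZ.
have [x ->] : exists x, sumsq a = x%:E.
  by exists (fine (sumsq a)); rewrite fineK// ge0_fin_numE.
have [y ->] : exists y, sumsq b = y%:E.
  by exists (fine (sumsq b)); rewrite fineK// ge0_fin_numE.
by rewrite -!EFinM -EFinD ltry.
Qed.

HB.instance Definition _ :=
  GRing.isSubmodClosed.Build _ _ H2_pred H2_submod_closed.

Record H2 : Type := MkH2 {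
  H2_coef :> nat -> R[i] ;
  H2_coefP : H2_coef \in H2_pred }.

HB.instance Definition _ := [isSub of H2 for H2_coef].
HB.instance Definition _ := [Choice of H2 by <:].
HB.instance Definition _ := [SubChoice_isSubLmodule of H2 by <:].

(* the norm of a normed space over R[i] takes its values in R[i] *)
Definition H2_norm (f : H2) : R[i] := (Num.sqrt (fine (sumsq f)))%:C.

Let sumsq_fin (f : H2) : sumsq f \is a fin_num.
Proof.
rewrite ge0_fin_numE//.
by case: f => a /=; rewrite inE.
Qed.

Let H2_normZ (l : R[i]) (f : H2) : H2_norm (l *: f) = `|l| * H2_norm f.
Proof.
rewrite /H2_norm sumsqZ fineM ?sumsq_fin//= sqrtrM ?sqr_ge0//.
have n0 : 0 <= Normc.normc l by case: l => x y; exact: sqrtr_ge0.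
by rewrite sqrtr_sqr ger0_norm// rmorphM.
Qed.

Let H2_norm0_eq0 (f : H2) : H2_norm f = 0 -> f = 0.
Proof.
move=> /(congr1 (@complex.Re R))/=/eqP; rewrite sqrtr_eq0 => s0.
have {}s0 : sumsq f = 0%E.
  apply/eqP; rewrite eq_le sumsq_ge0 andbT -(fineK (sumsq_fin f)).
  by rewrite lee_fin.
apply: val_inj; apply/funext => k /=.
have : (0 <= (Normc.normc (f k) ^+ 2)%:E <= sumsq f)%E.
  rewrite lee_fin sqr_ge0/= /sumsq.
  rewrite (@nneseriesD1 _ _ k)//; last by move=> *; rewrite lee_fin sqr_ge0.
  by rewrite leeDl// nneseries_ge0// => *; rewrite lee_fin sqr_ge0.
rewrite s0 !lee_fin -eq_le eq_sym sqrf_eq0 => /eqP; exact: Normc.eq0_normc.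
Qed.

Let H2_normD (f g : H2) : H2_norm (f + g) <= H2_norm f + H2_norm g.
Proof.
rewrite /H2_norm -rmorphD lecR.
set A := Num.sqrt (fine (sumsq f)); set B := Num.sqrt (fine (sumsq g)).
have A0 : 0 <= A by exact: sqrtr_ge0.
have B0 : 0 <= B by exact: sqrtr_ge0.
have eA : sumsq f = (A ^+ 2)%:E.
  by rewrite sqr_sqrtr ?fine_ge0// fineK ?sumsq_fin.
have eB : sumsq g = (B ^+ 2)%:E.
  by rewrite sqr_sqrtr ?fine_ge0// fineK ?sumsq_fin.
have [A_0|An0] := eqVneq A 0.
  have -> : f = 0 by apply: H2_norm0_eq0; rewrite /H2_norm -/A A_0.
  by rewrite add0r A_0 add0r.
have [B_0|Bn0] := eqVneq B 0.
  have -> : g = 0 by apply: H2_norm0_eq0; rewrite /H2_norm -/B B_0.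
  by rewrite addr0 B_0 addr0.
have Ap : 0 < A by rewrite lt_def An0.
have Bp : 0 < B by rewrite lt_def Bn0.
rewrite -[leRHS]ger0_norm ?addr_ge0// -sqrtr_sqr ler_wsqrtr//.
rewrite -lee_fin fineK ?sumsq_fin//.
apply: (le_trans (sumsqD _ _ (divr_gt0 Bp Ap))).
rewrite eA eB -!EFinM -EFinD lee_fin invf_div.
suff -> : (1 + B / A) * A ^+ 2 + (1 + A / B) * B ^+ 2 = (A + B) ^+ 2 by [].
by field; rewrite An0 Bn0.
Qed.

HB.instance Definition _ := @Lmodule_isNormed.Build R[i] H2
  H2_norm H2_normD H2_normZ H2_norm0_eq0.

End hardy_space.

Section composition_operators.
Variable R : realType.

Definition compact_operator (T : {linear H2 R -> H2 R}) : Prop :=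
  precompact (T @` [set f | `|f| <= 1]).

(* T is C_psi: f |-> f o psi.  The elements of H^2 are functions on the
   half-plane Re s > 1/2, which the symbols below map into itself. *)
Definition is_composition_operator (psi : R[i] -> R[i])
    (T : {linear H2 R -> H2 R}) : Prop :=
  forall (f : H2 R) (s : R[i]), half_plane 2^-1 s ->
    dirichlet (T f) s = dirichlet f (psi s).

(* psi(s) = c0 s + sum_(n >= 1) c_n n^{-s} *)
Definition symbol_fun (c0 : nat) (c : nat -> R[i]) (s : R[i]) : R[i] :=
  c0%:R * s + dirichlet c s.

Record G_ge1 (c0 : nat) (c : nat -> R[i]) : Prop := {
  G_ge1_c0 : (1 <= c0)%N ;
  G_ge1_unif : forall e : R, 0 < e ->
    {uniform half_plane e, dirichlet_partial c @ \oo --> dirichlet c} ;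
  G_ge1_range :
    (forall s, half_plane 0 s -> half_plane 0 (dirichlet c s)) \/
    (exists tau : R, forall s, half_plane 0 s -> dirichlet c s = 0 +i* tau) }.

End composition_operators.

Section counting_function.
Variable R : realType.

(* order of vanishing of f at s, possibly 0 or +oo *)
Definition order_of_zero (f : R[i] -> R[i]) (s : R[i]) : \bar R :=
  ereal_sup [set (k%:R)%:E | k in
    [set k : nat | forall j, (j < k)%N -> derive1n j f s = 0]].

Definition counting_fun (psi : R[i] -> R[i]) (w : R[i]) : \bar R :=
  (\esum_(s in half_plane 0 `&` psi @^-1` [set w])
     (order_of_zero (fun z => psi z - w)%R s * (Re s)%:E))%E.

(* the filter of the limits Re w -> 0+, Im w unrestricted *)
Definition Re_to_0plus : set_system R[i] :=
  filter_from [set d : R | 0 < d] (fun d => [set w | 0 < Re w < d]).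

Global Instance Re_to_0plus_filter : ProperFilter Re_to_0plus.
Proof.
apply: filter_from_proper; last first.
  move=> d /= d0; exists ((d / 2)%:C) => /=.
  by rewrite divr_gt0//= ltr_pdivrMr// mulr_natr mulr2n ltrDl.
apply: filter_from_filter; first by exists 1 => /=.
move=> d e /= d0 e0; exists (Num.min d e); first by rewrite /= lt_min d0.
by move=> w /=; rewrite lt_min => /and3P[-> -> ->].
Qed.

End counting_function.

Section infinite_torus.
Variable R : realType.

(* set_type carries the induced topology *)
Definition circle : Type := set_type [set z : R[i] | `|z| = 1].

HB.instance Definition _ := Topological.on circle.

Let circle1_subproof : (1 : R[i]) \in [set z : R[i] | `|z| = 1].
Proof. by rewrite inE /= normr1. Qed.

Definition circle1 : circle := exist _ 1 circle1_subproof.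

HB.instance Definition _ := isPointed.Build circle circle1.

(* normalized Lebesgue (arc length) measure *)
Definition circle_measure (A : set circle) : \bar R :=
  lebesgue_measure (`[0, 1] `&`
    [set t : R | exists2 z : circle, A z & cexp (0 +i* (2 * pi * t)) = \val z]).

(* T^oo with the Borel sigma-algebra of its product topology;
   chi j is the coordinate of index j + 1 *)
Definition Tinf : Type := g_sigma_algebraType (@open {ptws nat -> circle}).
HB.instance Definition _ := Measurable.on Tinf.

(* m is the product of the normalized Lebesgue measures, that is, the
   normalized Haar measure of T^oo: such an m exists and is unique. *)
Definition is_torus_measure (m : set Tinf -> \bar R) : Prop :=
  forall (n : nat) (A : nat -> set circle),
    (forall j, <<s @open circle >> (A j)) ->
    m [set chi | forall j, (j < n)%N -> A j (chi j)] =
      (\prod_(j < n) circle_measure (A j))%E.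

(* number of primes smaller than p; for p prime, p is the prime number
   of rank prime_index p, counting from 0 *)
Definition prime_index (p : nat) : nat := count prime (iota 0 p).

(* the completely multiplicative function with value chi_j at the j-th prime *)
Definition character (chi : Tinf) (n : nat) : R[i] :=
  \prod_(p <- primes n) (\val (chi (prime_index p)) : R[i]) ^+ logn p n.

Definition twist (c : nat -> R[i]) (chi : Tinf) : nat -> R[i] :=
  fun k => c k * character chi k.+1.

End infinite_torus.

(* Main.v *)
Require Import Defs.
From HB Require Import structures.
From mathcomp Require Import all_boot all_order all_algebra.
From mathcomp Require Import complex.
From mathcomp Require Import all_classical all_reals all_analysis measurable_realfun.
From mathcomp Require Import ring lra.

Set Implicit Arguments.
Unset Strict Implicit.
Unset Printing Implicit Defensive.

Import Order.TTheory GRing.Theory Num.Theory.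
Import numFieldNormedType.Exports.

Local Open Scope classical_set_scope.
Local Open Scope ring_scope.
Local Open Scope complex_scope.

(** Write [psi_chi s = c0 s + phi_chi s] and [sigma = Re w].  For a fixed character, the function
    [F = (psi_chi - w) / (psi_chi + conj w)] is bounded by 1 on the half-plane [Re s > e], and
    [1 - |F|^2 = 4 sigma Re psi_chi / |psi_chi + conj w|^2]; dividing out its zeros and comparing
    with Poisson kernels, the maximum principle yields a Littlewood-type inequality which bounds
    the sum of [Re s - e] over the zeros by a multiple of the integral of
    [sigma^2 / |psi_chi (e + i t) + conj w|^2] over [t].

    A vertical translation of [phi_chi] is the action of a Kronecker flow on [chi], which preserves
    the Haar measure.  Averaging over [chi] therefore makes the integral over [t] explicit, and by
    Fatou's lemma as [e] tends to 0, the average of [N / sigma] is at most a constant times the limit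
    of [E (sigma / (sigma + Re phi_chi e))], up to [sigma].  Moreover
    [sigma / (sigma + r) <= sigma log n + e^2 n^(-2 r)], and the average of [n^(-2 Re phi_chi e)] is
    bounded by a multiple of [||C_psi n^-s||^2]: approximate [n^-psi] by Dirichlet polynomials and
    use their mean squares along the flow.  The coefficients of [C_psi n^-s] tend to 0 with [1 / n],
    so compactness makes [||C_psi n^-s||] small for some [n]; then let [sigma] tend to 0. *)

(** * The modulus on [R[i]] and the complex exponential *)

Local Notation Re := (@complex.Re _).
Local Notation Im := (@complex.Im _).
Local Notation cn := (@Normc.normc _).

(** The symbols have no boundary values on [Re s = 0] in general, so everything is done on
    [Re s >= e]; there the twisted series converge uniformly in [s] and in [chi] at once, because
    Kronecker's theorem compares them with vertical translates of the given one. The integral over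
    [t] never appears as such: it is replaced by finitely many Poisson kernels whose sum dominates
    [1 / |psi_chi + conj w|^2] on the line. Each term belongs to one height [t_i], and the flow is
    undone term by term, with its own translation, so no double integral over [chi] and [t] is
    formed. Afterwards only the linear part [c0 (e + i t_i)] depends on the node, and the weighted
    sum over the nodes is a Riemann sum of a Poisson kernel. The mean squares are likewise averages
    over arithmetic progressions. The counting function enters the integral only through a pointwise
    bound by a lower limit of measurable majorants. *)

Section modulus.
Variable R : realType.
Implicit Types (z u v : R[i]) (x y t : R).

Lemma ReM z u : Re (z * u) = Re z * Re u - Im z * Im u.
Proof. by case: z => a b; case: u. Qed.
Lemma ImM z u : Im (z * u) = Re z * Im u + Im z * Re u.
Proof. by case: z => a b; case: u. Qed.
Lemma ReD z u : Re (z + u) = Re z + Re u.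
Proof. by case: z => a b; case: u. Qed.
Lemma ImD z u : Im (z + u) = Im z + Im u.
Proof. by case: z => a b; case: u. Qed.
Lemma ReN z : Re (- z) = - Re z.
Proof. by case: z. Qed.
Lemma ImN z : Im (- z) = - Im z.
Proof. by case: z. Qed.
Definition ReE := (ReM, ImM, ReD, ImD, ReN, ImN).

Lemma Re_sum (I : Type) (r : seq I) (P : pred I) (f : I -> R[i]) :
  Re (\sum_(i <- r | P i) f i) = \sum_(i <- r | P i) Re (f i).
Proof. by apply: (big_morph _ ReD). Qed.
Lemma Re_nat n : Re (n%:R : R[i]) = n%:R.
Proof. by elim: n => //= n IH; rewrite -addn1 !natrD ReD IH. Qed.
Lemma Im_nat n : Im (n%:R : R[i]) = 0.
Proof. by elim: n => //= n IH; rewrite -addn1 !natrD ImD IH addr0. Qed.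

Lemma complex_eqP z u : Re z = Re u -> Im z = Im u -> z = u.
Proof. by case: z => a b; case: u => c d /= -> ->. Qed.

Lemma natrC n : n%:R%:C = n%:R :> R[i].
Proof. by apply: complex_eqP; rewrite /= ?Re_nat ?Im_nat. Qed.

Lemma cn_ge0 z : 0 <= cn z.
Proof. by case: z => x y; exact: sqrtr_ge0. Qed.
Lemma cn_sqr z : cn z ^+ 2 = Re z ^+ 2 + Im z ^+ 2.
Proof. by case: z => x y /=; rewrite sqr_sqrtr ?addr_ge0 ?sqr_ge0. Qed.
Lemma cnD z u : cn (z + u) <= cn z + cn u.
Proof. exact: le_normcD. Qed.
Lemma cnN z : cn (- z) = cn z.
Proof. exact: normcN. Qed.
Lemma cnBC z u : cn (z - u) = cn (u - z).
Proof. by rewrite -cnN opprB. Qed.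
Lemma cnB z u : cn (z - u) <= cn z + cn u.
Proof. by rewrite -(cnN u) cnD. Qed.
Lemma cn_trans v z u : cn (z - u) <= cn (z - v) + cn (v - u).
Proof. by have := cnD (z - v) (v - u); rewrite addrA subrK. Qed.
Lemma cnM z u : cn (z * u) = cn z * cn u.
Proof. exact: Normc.normcM. Qed.
Lemma cn0 : cn (0 : R[i]) = 0.
Proof. exact: Normc.normc0. Qed.
Lemma cn1 : cn (1 : R[i]) = 1.
Proof. exact: Normc.normc1. Qed.
Lemma cnV z : cn z^-1 = (cn z)^-1.
Proof. exact: Normc.normcV. Qed.
Lemma cnX z n : cn (z ^+ n) = cn z ^+ n.
Proof. by elim: n => [|n IH]; rewrite ?expr0 ?cn1// !exprS cnM IH. Qed.
Lemma cn_eq0 z : (cn z == 0) = (z == 0).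
Proof. by apply/eqP/eqP => [/Normc.eq0_normc//|->]; rewrite cn0. Qed.
Lemma cn_gt0 z : (0 < cn z) = (z != 0).
Proof. by rewrite lt_def cn_ge0 andbT cn_eq0. Qed.
Lemma cnR x : cn x%:C = `|x|.
Proof. by rewrite /= expr0n /= addr0 sqrtr_sqr. Qed.
Lemma cn_nat n : cn (n%:R : R[i]) = n%:R.
Proof. by rewrite -natrC cnR ger0_norm. Qed.
Lemma cn_lb z u : cn z - cn u <= cn (z - u).
Proof. by rewrite lerBlDr; have := cnD (z - u) u; rewrite subrK. Qed.

Lemma cn_dist z u : `|cn z - cn u| <= cn (z - u).
Proof. by rewrite ler_norml cn_lb andbT lerNl opprB -(cnBC u z) cn_lb. Qed.
Lemma cn_sum (I : Type) (r : seq I) (P : pred I) (f : I -> R[i]) :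
  cn (\sum_(i <- r | P i) f i) <= \sum_(i <- r | P i) cn (f i).
Proof.
elim/big_ind2 : _ => [|z a u b za ub|//]; first by rewrite cn0.
by rewrite (le_trans (cnD _ _))// lerD.
Qed.
Lemma cn_prod (I : Type) (r : seq I) (P : pred I) (f : I -> R[i]) :
  cn (\prod_(i <- r | P i) f i) = \prod_(i <- r | P i) cn (f i).
Proof. by apply: (big_morph _ cnM cn1). Qed.

Lemma ler_cn z x : 0 <= x -> (cn z <= x) = (Re z ^+ 2 + Im z ^+ 2 <= x ^+ 2).
Proof. by move=> x0; rewrite -cn_sqr ler_sqr ?nnegrE ?cn_ge0. Qed.
Lemma ler_Re z : `|Re z| <= cn z.
Proof.
rewrite -ler_sqr ?nnegrE ?cn_ge0// cn_sqr real_normK ?num_real//.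
by rewrite lerDl sqr_ge0.
Qed.
Lemma ler_Im z : `|Im z| <= cn z.
Proof.
rewrite -ler_sqr ?nnegrE ?cn_ge0// cn_sqr real_normK ?num_real//.
by rewrite lerDr sqr_ge0.
Qed.
Lemma Re_le_cn z : Re z <= cn z.
Proof. exact: le_trans (ler_norm _) (ler_Re z). Qed.
Lemma cn_le_ReIm z : cn z <= `|Re z| + `|Im z|.
Proof.
rewrite ler_cn ?addr_ge0// -(real_normK (num_real (Re z))) -(real_normK (num_real (Im z))).
have := normr_ge0 (Re z); have := normr_ge0 (Im z); nra.
Qed.

Lemma cn_conj z : cn z^* = cn z.
Proof. by case: z => x y /=; rewrite sqrrN. Qed.
Lemma Re_conj z : Re z^* = Re z. Proof. by case: z. Qed.
Lemma Im_conj z : Im z^* = - Im z. Proof. by case: z. Qed.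
Lemma mul_conj z : z * z^* = (cn z ^+ 2)%:C.
Proof.
by apply: complex_eqP; rewrite ReE Re_conj Im_conj /= ?cn_sqr; ring.
Qed.

Lemma normCE z : `|z| = (cn z)%:C. Proof. by []. Qed.

Lemma ltC0 (e : R[i]) : 0 < e -> 0 < Re e /\ e = (Re e)%:C.
Proof. by rewrite ltcE /= => /andP[/eqP e0 ->]; split=> //; case: e e0 => a b /= ->. Qed.

Lemma Re_inv z : Re z^-1 = Re z / cn z ^+ 2.
Proof. by rewrite cn_sqr; case: z. Qed.

Lemma nbhsC (z : R[i]) (A : set R[i]) :
  nbhs z A <-> exists2 r : R, 0 < r & forall u, cn (u - z) < r -> A u.
Proof.
split.
  move=> /nbhs_normP[e /ltC0[e0 ee] eA]; exists (Re e) => // u ur; apply: eA.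
  by rewrite /ball_/= normCE ee ltcR cnBC.
move=> [r r0 rA]; apply/nbhs_normP; exists r%:C; first by rewrite /= ltcR.
by move=> u; rewrite /ball_/= normCE ltcR cnBC; exact: rA.
Qed.

Lemma cvgC (u : nat -> R[i]) (l : R[i]) :
  u @ \oo --> l <-> forall k : R, 0 < k ->
    exists N, forall n, (N <= n)%N -> cn (u n - l) <= k.
Proof.
split.
  move=> ul k k0; have /ul[N _ NA] : nbhs l [set v | cn (v - l) < k].
    by apply/nbhsC; exists k.
  by exists N => n Nn; apply: ltW; exact: NA.
move=> H A /nbhsC[r r0 rA]; have [|N NP] := H (r / 2); first by rewrite divr_gt0.
exists N => // n /= Nn; apply: rA; apply: (le_lt_trans (NP _ Nn)).
by rewrite ltr_pdivrMr// mulr_natr mulr2n ltrDl.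
Qed.

Lemma limnC (u : nat -> R[i]) (l : R[i]) : u @ \oo --> l -> limn u = l.
Proof. by move=> ul; apply: cvg_lim => //; exact: norm_hausdorff. Qed.

Lemma cauchyC (u : nat -> R[i]) :
  (forall k : R, 0 < k -> exists N, forall n m, (N <= n)%N -> (N <= m)%N ->
     cn (u n - u m) <= k) -> u @ \oo --> limn u.
Proof.
move=> H; suff : exists l : R[i], u @ \oo --> l.
  by move=> [l ul]; rewrite (limnC ul); exact: ul.
have aux (f : R[i] -> R) : (forall z v, `|f z - f v| <= cn (z - v)) ->
    exists l : R, forall k : R, 0 < k -> exists N, forall n, (N <= n)%N -> `|f (u n) - l| <= k.
  move=> fl; have /cauchy_cvgP fc : cauchy ((f \o u) @ \oo).
    apply: cauchy_exP => e e0; have [|N NP] := H (e / 2); first by rewrite divr_gt0.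
    exists (f (u N)); exists N => // n /= Nn; rewrite /ball/=.
    by apply: (le_lt_trans (fl _ _)); rewrite (le_lt_trans (NP _ _ _ _))// ltr_pdivrMr// mulr_natr mulr2n ltrDl.
  exists (lim ((f \o u) @ \oo)) => k k0.
  move/cvgrPdist_le : fc => /(_ _ k0)[N _ NA]; exists N => n Nn; rewrite distrC.
  by exact: NA.
have [|a Ha] := aux Re; first by move=> z v; rewrite -ReN -ReD ler_Re.
have [|b Hb] := aux Im; first by move=> z v; rewrite -ImN -ImD ler_Im.
exists (a +i* b); apply/cvgC => k k0.
have k2 : 0 < k / 2 by rewrite divr_gt0.
have [N1 H1] := Ha _ k2; have [N2 H2] := Hb _ k2.
exists (maxn N1 N2) => n; rewrite geq_max => /andP[n1 n2].
apply: (le_trans (cn_le_ReIm _)); rewrite !ReE /=.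
by rewrite [k]splitr lerD// ?H1 ?H2.
Qed.

End modulus.

Section cexp.
Variable R : realType.
Implicit Types (z u : R[i]).

Lemma Re_cexp z : Re (cexp z) = expR (Re z) * cos (Im z).
Proof. by rewrite /cexp ReM /= mul0r subr0. Qed.
Lemma Im_cexp z : Im (cexp z) = expR (Re z) * sin (Im z).
Proof. by rewrite /cexp ImM /= mul0r addr0. Qed.
Lemma cexpD z u : cexp (z + u) = cexp z * cexp u.
Proof.
apply: complex_eqP; rewrite ?Re_cexp ?Im_cexp !ReE ?Re_cexp ?Im_cexp expRD ?cosD ?sinD. all: rewrite /=; ring.
Qed.
Lemma cexp0 : cexp (0 : R[i]) = 1.
Proof. by apply: complex_eqP; rewrite ?Re_cexp ?Im_cexp /= expR0 ?cos0 ?sin0 mul1r. Qed.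
Lemma cn_cexp z : cn (cexp z) = expR (Re z).
Proof.
apply/eqP; rewrite -(@eqrXn2 _ 2) ?cn_ge0 ?expR_ge0// cn_sqr Re_cexp Im_cexp.
by rewrite !exprMn -mulrDr cos2Dsin2 mulr1.
Qed.
Lemma cexpMn z n : cexp (z *+ n) = cexp z ^+ n.
Proof. by elim: n => [|n IH]; rewrite ?mulr0n ?cexp0// mulrS exprS cexpD IH. Qed.
Lemma npow_opp1 z : npow_opp 1 z = 1.
Proof. by rewrite /npow_opp ln1 mulr0 cexp0. Qed.
Lemma npow_oppM m n z : (0 < m)%N -> (0 < n)%N ->
  npow_opp (m * n) z = npow_opp m z * npow_opp n z.
Proof.
move=> m0 n0; rewrite /npow_opp -cexpD -mulrDr; congr (cexp (_ * _)).
by rewrite natrM lnM ?posrE ?ltr0n// rmorphD.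
Qed.
Lemma npow_oppD n z u : npow_opp n (z + u) = npow_opp n z * npow_opp n u.
Proof. by rewrite /npow_opp -cexpD -mulrDl opprD. Qed.
Lemma cn_npow_opp n z : cn (npow_opp n z) = expR (- Re z * ln n%:R).
Proof. by rewrite /npow_opp cn_cexp ReM /= ReN mulr0 subr0. Qed.
End cexp.

(** * Taylor expansions and jets *)

Section taylor.
Variable R : realType.
Implicit Types (f g : R -> R[i]) (t : R) (z h : R[i]).

(** Differentiation in a real variable, taken on each component so that the real mean value theorem
    applies. *)
Definition cder f t z :=
  is_derive t 1 (fun x => Re (f x)) (Re z) /\ is_derive t 1 (fun x => Im (f x)) (Im z).

Lemma is_derive_eq_val (f : R -> R) t a b : is_derive t 1 f a -> a = b -> is_derive t 1 f b.
Proof. by move=> + <-. Qed.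

Lemma cder_eq f t z z' : cder f t z -> z = z' -> cder f t z'.
Proof. by move=> + <-. Qed.

Lemma cder_cst z t : cder (fun=> z) t 0.
Proof. by split; apply: is_derive_cst. Qed.

Lemma cderD f g t z h : cder f t z -> cder g t h -> cder (fun x => f x + g x) t (z + h).
Proof.
move=> [a b] [c d]; split; rewrite ReE.
  by under eq_fun do rewrite ReE; exact: is_deriveD.
by under eq_fun do rewrite ReE; exact: is_deriveD.
Qed.

Lemma cderZ f t z h : cder f t z -> cder (fun x => h * f x) t (h * z).
Proof.
move=> [a b]; split; rewrite ReE.
  under eq_fun do rewrite ReE.
  by apply: is_deriveB; apply: is_deriveZ.
under eq_fun do rewrite ReE.
by apply: is_deriveD; apply: is_deriveZ.
Qed.

Lemma cderB f g t z h : cder f t z -> cder g t h -> cder (fun x => f x - g x) t (z - h).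
Proof.
move=> fz gh; have := cderD fz (cderZ (-1) gh); rewrite mulN1r.
by under eq_fun do rewrite mulN1r.
Qed.

Lemma cder_sum (I : Type) (r : seq I) (F : I -> R -> R[i]) (D : I -> R[i]) t :
  (forall i, cder (F i) t (D i)) ->
  cder (fun x => \sum_(i <- r) F i x) t (\sum_(i <- r) D i).
Proof.
move=> H; elim: r => [|i r IH].
  by rewrite big_nil; under eq_fun do rewrite big_nil; exact: cder_cst.
by rewrite big_cons; under eq_fun do rewrite big_cons; exact: cderD.
Qed.

Lemma cder_exprn n t : cder (fun x => x%:C ^+ n) t (n%:R * t%:C ^+ n.-1).
Proof.
have E x m : x%:C ^+ m = (x ^+ m)%:C :> R[i] by rewrite rmorphXn.
under eq_fun do rewrite E.
rewrite E -natrC -rmorphM /=; split => /=; last exact: is_derive_cst.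
have H := is_deriveX n (@is_derive_id R R t 1).
apply: (is_derive_eq_val (a := (n%:R * t ^+ n.-1) *: 1)); last by rewrite -[LHS]/(_ * 1) mulr1.
by rewrite (_ : (GRing.exp (R:=R))^~ n = (id : R -> R) ^+ n)//; apply/funext => x; rewrite fctE.
Qed.

Lemma cder_cexp (z h : R[i]) t :
  cder (fun x => cexp (z + x%:C * h)) t (h * cexp (z + t%:C * h)).
Proof.
have ER x : Re (z + x%:C * h) = Re z + x * Re h by rewrite !ReE /=; ring.
have EI x : Im (z + x%:C * h) = Im z + x * Im h by rewrite !ReE /=; ring.
have D1 a b : is_derive t 1 (fun x : R => a + x * b) b.
  have H := is_deriveD (@is_derive_cst R R R a t 1) (is_deriveZ b (@is_derive_id R R t 1)).
  apply: (is_derive_eq_val (a := b *: 1)); last by rewrite -[LHS]/(b * 1) mulr1.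
  rewrite add0r in H.
  have E : (cst a + b \*: id : R -> R) = (fun x => a + x * b).
    by apply/funext => x /=; rewrite mulrC.
  by rewrite -E; exact: H.
split.
  under eq_fun do rewrite Re_cexp ER EI.
  rewrite ReE Re_cexp Im_cexp ER EI.
  apply: is_derive_eq_val.
  rewrite /GRing.scale /=; ring.
under eq_fun do rewrite Im_cexp ER EI.
rewrite ReE Re_cexp Im_cexp ER EI.
apply: is_derive_eq_val.
rewrite /GRing.scale /=; ring.
Qed.

Lemma mean_value_inequality_real (f f' : R -> R) (K : R) : (forall t, is_derive t 1 f (f' t)) ->
  (forall t, 0 <= t <= 1 -> `|f' t| <= K) -> forall t, 0 <= t <= 1 -> `|f t - f 0| <= K.
Proof.
move=> df fK t /andP[]; rewrite le_eqVlt => /orP[/eqP <- _|t0 t1].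
  rewrite subrr normr0; apply: le_trans (normr_ge0 (f' 0)) (fK _ _); lra.
have cf : {within `[0, t], continuous f}.
  by apply: derivable_within_continuous => x _; have [] := df x.
have [c] := MVT t0 (fun x _ => df x) cf.
rewrite in_itv /= => /andP[c0 c1] ->; rewrite normrM subr0 (gtr0_norm t0).
have := fK c; rewrite (ltW c0) (le_trans (ltW c1) t1) => /(_ isT).
have := normr_ge0 (f' c); nra.
Qed.

(** The real mean value theorem is applied to the real and to the imaginary part, hence the factor
    2; it reappears as [2 ^+ k] in the Taylor remainders, where only the power of [h] matters. *)
Lemma mean_value_inequality f f' (K : R) : (forall t, cder f t (f' t)) ->
  (forall t, 0 <= t <= 1 -> cn (f' t) <= K) ->
  forall t, 0 <= t <= 1 -> cn (f t - f 0) <= 2 * K.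
Proof.
move=> df fK t t01; apply: (le_trans (cn_le_ReIm _)).
rewrite !ReE mulr2n mulrDl mul1r lerD//.
  apply: (@mean_value_inequality_real (fun x => Re (f x)) (fun x => Re (f' x))) => // x => [|x01]; first by have [] := df x.
  exact: le_trans (ler_Re _) (fK _ x01).
apply: (@mean_value_inequality_real (fun x => Im (f x)) (fun x => Im (f' x))) => // x => [|x01]; first by have [] := df x.
exact: le_trans (ler_Im _) (fK _ x01).
Qed.

(** In the applications [G j t] is the [j]-th derivative at [s + t h], so that differentiating in
    [t] brings out a factor [h]. Induction on [k]: the remainder of order [k + 1] of [G j] vanishes
    at 0, and its derivative is [h] times the remainder of order [k] of [G j.+1]. *)
Lemma taylor_cder (G : nat -> R -> R[i]) (h : R[i]) (C : R) (k : nat) :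
  (forall j t, cder (G j) t (h * G j.+1 t)) ->
  forall j, (forall t, 0 <= t <= 1 -> cn (G (j + k)%N t) <= C) ->
  forall t, 0 <= t <= 1 ->
    cn (G j t - \sum_(i < k) G (j + i)%N 0 * (t%:C * h) ^+ i / i`!%:R) <= 2 ^+ k * C * cn h ^+ k.
Proof.
move=> dG; elim: k => [|k IH] j GC t t01.
  by rewrite big_ord0 subr0 expr0 mul1r expr0 mulr1; have := GC t t01; rewrite addn0.
pose f t := G j t - \sum_(i < k.+1) G (j + i)%N 0 * (t%:C * h) ^+ i / i`!%:R.
pose f' t := h * (G j.+1 t - \sum_(i < k) G (j.+1 + i)%N 0 * (t%:C * h) ^+ i / i`!%:R).
have f0 : f 0 = 0.
  rewrite /f big_ord_recl /= addn0 expr0 fact0 !divr1 mulr1 big1 ?addr0 ?subrr// => i _.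
  by rewrite mul0r expr0n /= mulr0 mul0r.
have := @mean_value_inequality f f' (2 ^+ k * C * cn h ^+ k.+1) _ _ t t01.
rewrite f0 subr0 (_ : 2 ^+ k.+1 * C * cn h ^+ k.+1 = 2 * (2 ^+ k * C * cn h ^+ k.+1)); last by rewrite exprS; ring.
apply.
- move=> x; rewrite /f /f' mulrBr; apply: cderB; first exact: dG.
  under eq_fun do rewrite big_ord_recl expr0 fact0.
  rewrite -[X in cder _ _ X]add0r; apply: cderD; first exact: cder_cst.
  rewrite mulr_sumr; apply: cder_sum => i.
  have /(@cderZ _ _ _ (G (j + bump 0 i)%N 0 * h ^+ i.+1 / i.+1`!%:R)) := cder_exprn i.+1 x.
  have -> : (fun y => G (j + bump 0 i)%N 0 * h ^+ i.+1 / i.+1`!%:R * y%:C ^+ i.+1) = (fun y => G (j + bump 0 i)%N 0 * (y%:C * h) ^+ bump 0 i / (bump 0 i)`!%:R).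
    by apply/funext => y; rewrite /bump /= add1n exprMn; ring.
  move/cder_eq; apply; rewrite /bump /= add1n addSnnS exprMn factS natrM exprS.
  have n0 (m : nat) : (0 < m)%N -> (m%:R : R[i]) != 0 by rewrite pnatr_eq0 lt0n.
  by field; rewrite nat1r !n0 ?fact_gt0.
- move=> x x01; rewrite /f' cnM exprS mulrCA ler_wpM2l ?cn_ge0//.
  by apply: IH => // y y01; rewrite addSnnS; exact: GC.
Qed.

End taylor.

Section jets.
Variable R : realType.
Implicit Types (f g q : R[i] -> R[i]) (s z h : R[i]).

Lemma cexp_taylor h (k : nat) :
  cn (cexp h - \sum_(i < k) h ^+ i / i`!%:R) <= 2 ^+ k * expR (cn h) * cn h ^+ k.
Proof.
have := @taylor_cder R (fun _ t => cexp (0 + t%:C * h)) h (expR (cn h)) k _ 0 _ 1.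
rewrite add0r mul1r mul0r.
under eq_bigr do rewrite addr0 cexp0 mul1r.
apply; last by rewrite ler01 lexx.
- by move=> _ t; exact: cder_cexp.
- move=> t /andP[t0 t1]; rewrite add0r cn_cexp ler_expR (le_trans (Re_le_cn _))//.
  by rewrite cnM cnR ger0_norm// ler_piMl ?cn_ge0.
Qed.

Definition bounded_near0 g := exists C r : R, 0 < r /\ forall h, cn h < r -> cn (g h) <= C.

Lemma bounded_near0_cst z : bounded_near0 (fun=> z).
Proof. by exists (cn z), 1; split => // h _. Qed.
Lemma bounded_near0_id : bounded_near0 id.
Proof. by exists 1, 1; split => // h /ltW. Qed.
Lemma bounded_near0D f g : bounded_near0 f -> bounded_near0 g -> bounded_near0 (fun h => f h + g h).
Proof.
move=> [C [r [r0 H]]] [C' [r' [r'0 H']]]; exists (C + C'), (Num.min r r').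
split; first by rewrite lt_min r0.
move=> h; rewrite lt_min => /andP[h1 h2]; apply: (le_trans (cnD _ _)).
by rewrite lerD ?H ?H'.
Qed.
Lemma bounded_near0M f g : bounded_near0 f -> bounded_near0 g -> bounded_near0 (fun h => f h * g h).
Proof.
move=> [C [r [r0 H]]] [C' [r' [r'0 H']]]; exists (C * C'), (Num.min r r').
split; first by rewrite lt_min r0.
move=> h; rewrite lt_min => /andP[h1 h2]; rewrite cnM.
by rewrite ler_pM ?cn_ge0 ?H ?H'.
Qed.
Lemma bounded_near0X f n : bounded_near0 f -> bounded_near0 (fun h => f h ^+ n).
Proof.
move=> Hf; elim: n => [|n IH]; first exact: bounded_near0_cst.
by under eq_fun do rewrite exprS; exact: bounded_near0M.
Qed.
Lemma bounded_near0_eq f g (r : R) : 0 < r -> (forall h, cn h < r -> f h = g h) -> bounded_near0 f -> bounded_near0 g.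
Proof.
move=> r0 fg [C [r' [r'0 H]]]; exists C, (Num.min r r'); split; first by rewrite lt_min r0.
by move=> h; rewrite lt_min => /andP[h1 h2]; rewrite -fg// H.
Qed.

(* This replaces holomorphy: it is stable under the algebraic operations and the exponential, and it
   is all that the maximum principle below requires. *)
Definition jet3 f s := exists b c q, bounded_near0 q /\
  forall h, f (s + h) = f s + b * h + c * h ^+ 2 + q h * h ^+ 3.

Lemma jet3_est f s b c (C r : R) : 0 < r ->
  (forall h, cn h < r -> cn (f (s + h) - (f s + b * h + c * h ^+ 2)) <= C * cn h ^+ 3) ->
  jet3 f s.
Proof.
(* [q] is the remainder divided by [h ^+ 3]; at [h = 0] the convention [0^-1 = 0] gives it the value
   0. *)
move=> r0 H; exists b, c, (fun h => (f (s + h) - (f s + b * h + c * h ^+ 2)) / h ^+ 3).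
split.
  exists `|C|, r; split => // h /H; rewrite cnM cnV cnX.
  have := cn_ge0 h; rewrite le_eqVlt => /orP[/eqP <- _|h0 hC]; first by rewrite expr0n/= invr0 mulr0.
  by rewrite ler_pdivrMr ?exprn_gt0// (le_trans hC)// ler_wpM2r ?exprn_ge0 ?cn_ge0// ler_norm.
move=> h; have [->|h0] := eqVneq h 0; first by rewrite !(addr0, mulr0, expr0n).
by rewrite divfK ?expf_neq0// subrKC.
Qed.

Lemma bounded_near0_jet3 f s : jet3 f s -> bounded_near0 (fun h => f (s + h)).
Proof.
move=> [b [c [q [qB E]]]]; under eq_fun do rewrite E.
by do ![apply: bounded_near0D|apply: bounded_near0M|apply: bounded_near0X|apply: bounded_near0_cst|exact: bounded_near0_id|exact: qB].
Qed.

Lemma jet3_cst z s : jet3 (fun=> z) s.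
Proof.
exists 0, 0, (fun=> 0); split; first exact: bounded_near0_cst.
by move=> h; rewrite !mul0r !addr0.
Qed.

Lemma jet3_id s : jet3 id s.
Proof.
exists 1, 0, (fun=> 0); split; first exact: bounded_near0_cst.
by move=> h; rewrite mul1r !mul0r !addr0.
Qed.

Lemma jet3D f g s : jet3 f s -> jet3 g s -> jet3 (fun x => f x + g x) s.
Proof.
move=> [b [c [q [qB E]]]] [b' [c' [q' [qB' E']]]].
exists (b + b'), (c + c'), (fun h => q h + q' h); split; first exact: bounded_near0D.
by move=> h; rewrite E E'; ring.
Qed.

Lemma jet3M f g s : jet3 f s -> jet3 g s -> jet3 (fun x => f x * g x) s.
Proof.
move=> [b [c [q [qB E]]]] [b' [c' [q' [qB' E']]]].
exists (f s * b' + b * g s), (f s * c' + b * b' + c * g s).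
exists (fun h => f s * q' h + b * c' + c * b' + q h * g s
   + (b * q' h + c * c' + q h * b') * h
   + (c * q' h + q h * c') * h ^+ 2 + q h * q' h * h ^+ 3); split.
  by do ![apply: bounded_near0D|apply: bounded_near0M|apply: bounded_near0X|apply: bounded_near0_cst|exact: bounded_near0_id|exact: qB|exact: qB'].
by move=> h; rewrite E E'; ring.
Qed.

Lemma jet3N f s : jet3 f s -> jet3 (fun x => - f x) s.
Proof.
move=> H; have := jet3M (jet3_cst (-1) s) H.
by under eq_fun do rewrite mulN1r.
Qed.

Lemma jet3B f g s : jet3 f s -> jet3 g s -> jet3 (fun x => f x - g x) s.
Proof. by move=> Hf Hg; apply: jet3D => //; exact: jet3N. Qed.

Lemma jet3X f s n : jet3 f s -> jet3 (fun x => f x ^+ n) s.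
Proof.
move=> Hf; elim: n => [|n IH]; first exact: jet3_cst.
by under eq_fun do rewrite exprS; exact: jet3M.
Qed.

Lemma jet3_prod (I : eqType) (r : seq I) (F : I -> R[i] -> R[i]) s :
  (forall i, i \in r -> jet3 (F i) s) -> jet3 (fun x => \prod_(i <- r) F i x) s.
Proof.
elim: r => [|i r IH] H.
  by under eq_fun do rewrite big_nil; exact: jet3_cst.
under eq_fun do rewrite big_cons; apply: jet3M; first by apply: H; rewrite mem_head.
by apply: IH => j jr; apply: H; rewrite inE jr orbT.
Qed.

Lemma jet3_cont f s (k : R) : jet3 f s -> 0 < k ->
  exists2 r : R, 0 < r & forall h, cn h < r -> cn (f (s + h) - f s) <= k.
Proof.
move=> [b [c [q [qB E]]]] k0.
have [C [r [r0 H]]] : bounded_near0 (fun h => b + c * h + q h * h ^+ 2).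
  by do ![apply: bounded_near0D|apply: bounded_near0M|apply: bounded_near0X|apply: bounded_near0_cst|exact: bounded_near0_id|exact: qB].
have C0 : 0 <= C by apply: le_trans (H 0 _); rewrite ?cn0// cn_ge0.
exists (Num.min r (k / (C + 1))); first by rewrite lt_min r0 divr_gt0 ?ltr_wpDl.
move=> h; rewrite lt_min => /andP[hr hk].
have -> : f (s + h) - f s = (b + c * h + q h * h ^+ 2) * h by rewrite E; ring.
rewrite cnM; move: hk; rewrite ltr_pdivlMr ?ltr_wpDl// => hk.
have := H _ hr; have := cn_ge0 h; have := cn_ge0 (b + c * h + q h * h ^+ 2); nra.
Qed.

Lemma jet3V f s : f s != 0 -> jet3 f s -> jet3 (fun x => (f x)^-1) s.
Proof.
move=> fs0 fT; have [b [c [q [qB E]]]] := fT.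
pose A := f s; pose b' := - b / A ^+ 2; pose c' := b ^+ 2 / A ^+ 3 - c / A ^+ 2.
have A0 : A != 0 by [].
have cA2 : 0 < cn A / 2 by rewrite divr_gt0 ?cn_gt0.
have [r r0 Hr] := jet3_cont fT cA2.
have fh h : cn h < r -> cn A / 2 <= cn (f (s + h)).
  move=> /Hr; rewrite cnBC => hk; have := cn_lb A (f (s + h)); rewrite /A in hk *; lra.
have cA : 0 < cn A by rewrite cn_gt0.
(* [b'] and [c'] are the Taylor coefficients of [1 / f], and [w h * h ^+ 3] is what is left of [1 -
   f (s + h) * (1 / A + b' * h + c' * h ^+ 2)] once the orders 0, 1 and 2 cancel. *)
pose w h := - (b * c' + c * b' + q h / A + (c * c' + q h * b') * h + q h * c' * h ^+ 2).
have [C [r' [r'0 HC]]] : bounded_near0 w.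
  rewrite /w; under eq_fun do rewrite -mulN1r.
  by do ![apply: bounded_near0D|apply: bounded_near0M|apply: bounded_near0X|apply: bounded_near0_cst|exact: bounded_near0_id|exact: qB].
apply: (@jet3_est _ _ b' c' (C / (cn A / 2)) (Num.min r r')); first by rewrite lt_min r0.
move=> h; rewrite lt_min => /andP[hr hr'].
have f0 : f (s + h) != 0 by rewrite -cn_gt0 (lt_le_trans _ (fh _ hr))// divr_gt0.
have -> : (f (s + h))^-1 - ((f s)^-1 + b' * h + c' * h ^+ 2) = w h * h ^+ 3 / f (s + h).
  apply: (mulIf f0); rewrite divfK// mulrBl mulVf// E /w /b' /c' -/A; field.
  by rewrite A0.
rewrite cnM cnM cnX cnV mulrAC ler_wpM2r ?exprn_ge0 ?cn_ge0//.
have C0 : 0 <= C by apply: le_trans (HC _ hr'); rewrite cn_ge0.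
apply: ler_pM; rewrite ?invr_ge0 ?cn_ge0 ?HC//.
by rewrite lef_pV2 ?posrE ?divr_gt0 ?cn_gt0//; exact: fh.
Qed.

Lemma jet3_cexp f s : jet3 f s -> jet3 (fun x => cexp (f x)) s.
Proof.
move=> fT; have [b [c [q [qB E]]]] := fT.
pose v h := b + c * h + q h * h ^+ 2.
have vB : bounded_near0 v by do ![apply: bounded_near0D|apply: bounded_near0M|apply: bounded_near0X|apply: bounded_near0_cst|exact: bounded_near0_id|exact: qB].
have uE h : f (s + h) = f s + v h * h by rewrite E /v; ring.
(* With [v h * h] the increment of [f], [p h * h ^+ 3] collects the terms of order at least 3 in
   [v h * h + (v h * h) ^+ 2 / 2]; the rest of the exponential series is bounded by
   [cexp_taylor]. *)
pose p h := 2^-1 * ((c + q h * h) * (b + v h)) + q h.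
have pB : bounded_near0 p.
  by do ![apply: bounded_near0D|apply: bounded_near0M|apply: bounded_near0X|apply: bounded_near0_cst|exact: bounded_near0_id|exact: qB|exact: vB].
have [Cp [rp [rp0 Hp]]] := pB; have [Cv [rv [rv0 Hv]]] := vB.
have Cv0 : 0 <= Cv by apply: le_trans (Hv 0 _); rewrite ?cn0// cn_ge0.
pose A := cexp (f s).
apply: (@jet3_est _ _ (A * b) (A * (c + b ^+ 2 / 2)) (cn A * (Cp + 8 * expR Cv * Cv ^+ 3)) (Num.min 1 (Num.min rp rv))).
  by rewrite !lt_min ltr01 rp0.
move=> h; rewrite !lt_min => /and3P[h1 hp hv].
rewrite uE cexpD -/A.
have := cexp_taylor (v h * h) 3.
have -> : \sum_(i < 3) (v h * h) ^+ i / i`!%:R = 1 + v h * h + (v h * h) ^+ 2 / 2.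
  by rewrite !big_ord_recl big_ord0 /bump /= expr0 !divr1 addr0 addrA.
set e := (X in cn X <= _) => He.
have -> : A * cexp (v h * h) - (A + A * b * h + A * (c + b ^+ 2 / 2) * h ^+ 2) = A * (e + p h * h ^+ 3).
  by rewrite /e /p /v; field.
rewrite cnM -[leRHS]mulrA ler_wpM2l ?cn_ge0// (le_trans (cnD _ _))// [leRHS]mulrDl [leRHS]addrC lerD//; last first.
  by rewrite cnM cnX ler_wpM2r ?exprn_ge0 ?cn_ge0// Hp.
apply: (le_trans He).
have -> : 8 * expR Cv * Cv ^+ 3 * cn h ^+ 3 = 2 ^+ 3 * expR Cv * (Cv * cn h) ^+ 3 by ring.
have vh : cn (v h * h) <= Cv * cn h by rewrite cnM ler_wpM2r ?cn_ge0 ?Hv.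
apply: ler_pM; rewrite ?mulr_ge0 ?exprn_ge0 ?cn_ge0 ?expR_ge0//.
  rewrite ler_wpM2l ?exprn_ge0// ler_expR (le_trans vh)//.
  by rewrite ler_piMr// ltW.
by rewrite lerXn2r ?nnegrE ?cn_ge0// (le_trans _ vh) ?cn_ge0.
Qed.

End jets.

(** * The maximum principle and Littlewood's inequality *)

Section powers.
Variable R : realType.

(** Bernoulli's inequality for [B / A = 1 + d]. The exponent is a successor so that the case [A = 0]
    is included. *)
Lemma exists_expr_gt (A B c : R) : 0 <= A -> A < B ->
  exists M, A ^+ M.+1 * c < B ^+ M.+1.
Proof.
move=> A0 AB; have B0 : 0 < B := le_lt_trans A0 AB.
have [->|An0] := eqVneq A 0; first by exists 0; rewrite !expr1 mul0r.
have Ap : 0 < A by rewrite lt_def An0.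
pose d := B / A - 1.
have d0 : 0 < d by rewrite subr_gt0 ltr_pdivlMr// mul1r.
have bern M : 1 + M%:R * d <= (B / A) ^+ M.
  elim: M => [|M IH]; first by rewrite mul0r addr0 expr0.
  rewrite exprS -natr1 -[B / A](subrK 1) -/d; rewrite -[B / A](subrK 1) -/d in IH.
  have : 0 <= M%:R :> R by []; nra.
pose M := Num.truncn (c / d); exists M.
rewrite mulrC -ltr_pdivlMr ?exprn_gt0// -expr_div_n.
apply: lt_le_trans (bern _).
have : c / d < M.+1%:R by exact: truncnS_gt.
rewrite ltr_pdivrMr// => cM; lra.
Qed.

End powers.

Section four_point.
Variable R : realType.
Implicit Types (H : R[i] -> R[i]) (s z : R[i]).

(* For a jet 1 + b x + c x^2 the product over the rotations x, -x, ix, -ix is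
   1 + O(x^4): a multiplicative form of the harmonicity of log|H|. *)
Lemma four_point H s : jet3 H s -> H s != 0 -> exists K r : R, 0 < r /\
  forall h : R, 0 < h -> h < r ->
  cn (H s) ^+ 4 * (1 - K * h ^+ 3) <=
  cn (H (s + h%:C)) * cn (H (s - h%:C)) * cn (H (s + 'i * h%:C)) * cn (H (s - 'i * h%:C)).
Proof.
move=> [b0 [c0 [q0 [qB E]]]] H0.
pose A0 := H s; pose b := b0 / A0; pose c := c0 / A0.
have ii : 'i * 'i = -1 :> R[i] by rewrite -expr2 sqr_i.
have ci : cn ('i : R[i]) = 1.
  by apply/eqP; rewrite -(@eqrXn2 _ 2) ?cn_ge0// cn_sqr /= expr0n /= add0r.
have rotB (w : R[i]) : cn w = 1 -> bounded_near0 (fun h => q0 (w * h) / A0).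
  move=> w1; apply: bounded_near0M; last exact: bounded_near0_cst.
  have [C [r [r0 HC]]] := qB; exists C, r; split => // h hr.
  by apply: HC; rewrite cnM w1 mul1r.
(* The cubes of the rotations, [1], [-1], [-i] and [i], are absorbed into the four remainders, so
   that each expansion is in powers of the same [x]. *)
pose e0 (x : R[i]) : R[i] := q0 (1 * x) / A0.
pose e1 (x : R[i]) : R[i] := -1 * (q0 ((-1) * x) / A0).
pose e2 (x : R[i]) : R[i] := - 'i * (q0 ('i * x) / A0).
pose e3 (x : R[i]) : R[i] := 'i * (q0 ((- 'i) * x) / A0).
have e0B : bounded_near0 e0 by apply: rotB; rewrite cn1.
have e1B : bounded_near0 e1.
  by apply: bounded_near0M; [exact: bounded_near0_cst|apply: rotB; rewrite cnN cn1].
have e2B : bounded_near0 e2 by apply: bounded_near0M; [exact: bounded_near0_cst|apply: rotB].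
have e3B : bounded_near0 e3 by apply: bounded_near0M; [exact: bounded_near0_cst|apply: rotB; rewrite cnN].
have E0 x : H (s + x) = A0 * (1 + b * x + c * x ^+ 2 + e0 x * x ^+ 3).
  by rewrite E /e0 mul1r /b /c -/A0; field.
have E1 x : H (s - x) = A0 * (1 - b * x + c * x ^+ 2 + e1 x * x ^+ 3).
  by rewrite E /e1 !mulN1r /b /c -/A0; field.
have i3 : 'i ^+ 3 = - 'i :> R[i] by rewrite exprS expr2 ii mulrN1.
have E2 x : H (s + 'i * x) = A0 * (1 + 'i * b * x - c * x ^+ 2 + e2 x * x ^+ 3).
  by rewrite E /e2 /b /c -/A0 !exprMn i3 expr2 ii; field.
have E3 x : H (s - 'i * x) = A0 * (1 - 'i * b * x - c * x ^+ 2 + e3 x * x ^+ 3).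
  by rewrite -mulNr E /e3 /b /c -/A0 !exprMn ![(- 'i) ^+ _]exprNn i3 [_ * 'i ^+ 2]mulrC expr2 ii; field.
(* Opposite points are paired: [a0 * a1 = A] and [a2 * a3 = B]. Since [u + v = 2 c^2 x^2], the terms
   of order 2 of [A * B] cancel; one opposite pair alone would leave a term [(2 c - b^2) x^2]. *)
pose a0 (x : R[i]) : R[i] := 1 + b * x + c * x ^+ 2; pose a1 (x : R[i]) : R[i] := 1 + (- b) * x + c * x ^+ 2.
pose a2 (x : R[i]) : R[i] := 1 + 'i * b * x + (- c) * x ^+ 2; pose a3 (x : R[i]) : R[i] := 1 + (- 'i) * b * x + (- c) * x ^+ 2.
pose u (x : R[i]) : R[i] := 2 * c + c ^+ 2 * x ^+ 2 + (- b ^+ 2); pose v (x : R[i]) : R[i] := (- 2) * c + c ^+ 2 * x ^+ 2 + b ^+ 2.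
pose A (x : R[i]) : R[i] := 1 + x ^+ 2 * u x; pose B (x : R[i]) : R[i] := 1 + x ^+ 2 * v x.
pose F (x : R[i]) : R[i] := a0 x * e1 x + a1 x * e0 x + x ^+ 3 * e0 x * e1 x.
pose G (x : R[i]) : R[i] := a2 x * e3 x + a3 x * e2 x + x ^+ 3 * e2 x * e3 x.
pose w (x : R[i]) : R[i] := x * (2 * c ^+ 2 + u x * v x) + A x * G x + B x * F x + x ^+ 3 * F x * G x.
have lin (p q : R[i]) : bounded_near0 (fun x => 1 + p * x + q * x ^+ 2).
  apply: bounded_near0D; last by apply: bounded_near0M; [exact: bounded_near0_cst|apply: bounded_near0X; exact: bounded_near0_id].
  by apply: bounded_near0D; [exact: bounded_near0_cst|apply: bounded_near0M; [exact: bounded_near0_cst|exact: bounded_near0_id]].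
have uvB (p q : R[i]) : bounded_near0 (fun x => p + c ^+ 2 * x ^+ 2 + q).
  apply: bounded_near0D; last exact: bounded_near0_cst.
  by apply: bounded_near0D; [exact: bounded_near0_cst|apply: bounded_near0M; [exact: bounded_near0_cst|apply: bounded_near0X; exact: bounded_near0_id]].
have uB : bounded_near0 u by exact: uvB.
have vB : bounded_near0 v by exact: uvB.
have Xn n : bounded_near0 (fun x : R[i] => x ^+ n) by apply: bounded_near0X; exact: bounded_near0_id.
have AB : bounded_near0 A by apply: bounded_near0D; [exact: bounded_near0_cst|exact: bounded_near0M].
have BB : bounded_near0 B by apply: bounded_near0D; [exact: bounded_near0_cst|exact: bounded_near0M].
have FB : bounded_near0 F.
  apply: bounded_near0D; last by apply: (bounded_near0M (f := fun x => x ^+ 3 * e0 x)) => //; exact: bounded_near0M.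
  by apply: bounded_near0D; apply: bounded_near0M => //; exact: lin.
have GB : bounded_near0 G.
  apply: bounded_near0D; last by apply: (bounded_near0M (f := fun x => x ^+ 3 * e2 x)) => //; exact: bounded_near0M.
  by apply: bounded_near0D; apply: bounded_near0M => //; exact: lin.
have wB : bounded_near0 w.
  apply: bounded_near0D; last by apply: (bounded_near0M (f := fun x => x ^+ 3 * F x)) => //; exact: bounded_near0M.
  apply: bounded_near0D; last exact: bounded_near0M.
  apply: bounded_near0D; last exact: bounded_near0M.
  by apply: bounded_near0M; [exact: bounded_near0_id|apply: bounded_near0D; [exact: bounded_near0_cst|exact: bounded_near0M]].
have EE x : H (s + x) * H (s - x) * (H (s + 'i * x) * H (s - 'i * x)) = A0 ^+ 4 * (1 + x ^+ 3 * w x).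
  have -> : H (s + x) * H (s - x) = A0 ^+ 2 * (A x + x ^+ 3 * F x).
    by rewrite E0 E1 /A /F /a0 /a1 /u; ring.
  have a23 : a2 x * a3 x = B x.
    transitivity ((1 - c * x ^+ 2) ^+ 2 - 'i * 'i * b ^+ 2 * x ^+ 2); first by rewrite /a2 /a3; ring.
    by rewrite ii /B /v; ring.
  have -> : H (s + 'i * x) * H (s - 'i * x) = A0 ^+ 2 * (B x + x ^+ 3 * G x).
    by rewrite E2 E3 -a23 /G /a2 /a3; ring.
  rewrite /w /A /B /u /v; ring.
have [K [r [r0 HK]]] := wB.
exists K, r; split => // h h0 hr.
have hC : cn (h%:C : R[i]) = h by rewrite cnR gtr0_norm.
rewrite -mulrA -!cnM EE cnM cnX -/A0 ler_wpM2l ?exprn_ge0 ?cn_ge0//.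
have := cn_lb (1 : R[i]) (- (h%:C ^+ 3 * w h%:C)).
rewrite opprK cnN cn1 cnM cnX hC; apply: le_trans.
by rewrite lerB// mulrC ler_wpM2r ?exprn_ge0 ?(ltW h0)// HK// hC.
Qed.

(* [log (|H|^M / (Re s - e + 1))] is strictly subharmonic where [H] does not vanish, so [four_point]
   excludes an interior maximum. *)
Lemma max_principle H (e A : R) :
  (forall s, e <= Re s -> forall k : R, 0 < k -> exists2 r : R, 0 < r &
     forall h, cn h < r -> cn (H (s + h) - H s) <= k) ->
  (forall s, e < Re s -> H s != 0 -> jet3 H s) ->
  (forall s, Re s = e -> cn (H s) <= A) ->
  (forall k : R, 0 < k -> exists rho : R, forall s, e <= Re s -> rho <= cn s -> cn (H s) <= k) ->
  forall s, e <= Re s -> cn (H s) <= A.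
Proof.
move=> Hc HT HA Hinf s1 s1e; rewrite leNgt; apply/negP => As1.
have A0 : 0 <= A by rewrite (le_trans _ (HA e%:C _))// cn_ge0.
have H1 : 0 < cn (H s1) := le_lt_trans A0 As1.
(* The power [M] makes the gap between [A] and [cn (H s1)] outweigh the denominator [Re s1 - e + 1],
   so that [E s1] exceeds every boundary value of [E]. *)
have [m HM] := exists_expr_gt (Re s1 - e + 1) A0 As1; set M := m.+1 in HM.
pose E s := cn (H s) ^+ M / (Re s - e + 1).
have pos s : e <= Re s -> 0 < Re s - e + 1 by move=> es; lra.
have E1A : A ^+ M < E s1 by rewrite ltr_pdivlMr ?pos.
have E10 : 0 < E s1 by rewrite (le_lt_trans _ E1A)// exprn_ge0.
have EH s : e <= Re s -> E s <= cn (H s) ^+ M.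
  move=> es; rewrite ler_pdivrMr ?pos// ler_peMr ?exprn_ge0 ?cn_ge0//; lra.
have [rho Hrho] : exists rho : R, forall s, e <= Re s -> rho <= cn s -> E s < E s1.
  have k0 : 0 < Num.min 1 (E s1 / 2) by rewrite lt_min ltr01 divr_gt0.
  have [rho Hrho] := Hinf _ k0; exists rho => s es rs.
  apply: (le_lt_trans (EH _ es)); have := Hrho _ es rs; rewrite le_min => /andP[h1 h2].
  apply: (@le_lt_trans _ _ (cn (H s))); first by rewrite /M exprS ler_piMr ?cn_ge0// exprn_ile1 ?cn_ge0.
  by rewrite (le_lt_trans h2)// ltr_pdivrMr// mulr_natr mulr2n ltrDl.
(* The maximum is attained on a rectangle that contains [s1] and every point of the half-plane with
   modulus at most [rho]; outside of it [E < E s1]. *)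
have [s0 [s0e s0max]] : exists s0, e <= Re s0 /\ forall s, e <= Re s -> E s <= E s0.
  pose X := `|e| + `|rho| + cn s1.
  pose D := `[e, X] `*` `[- X, X].
  have s1D : D (Re s1, Im s1).
    have CX : cn s1 <= X by rewrite /X lerDr addr_ge0.
    have := le_trans (ler_Im s1) CX; have := le_trans (ler_Re s1) CX.
    rewrite !ler_norml => /andP[_ r2] /andP[i1 i2].
    by rewrite /D; split => /=; rewrite in_itv /=; apply/andP.
  pose f (p : R * R) : R := E (p.1 +i* p.2).
  have [|||[x y]] := @compact_EVT_max _ _ f D.
  - by exists (Re s1, Im s1).
  - by apply: compact_setX; exact: segment_compact.
  - rewrite continuous_subspace_in => -[x y]; rewrite inE => Dp.
    apply: continuous_subspaceT_for => //.
    have xe : e <= x by move: Dp => [] /=; rewrite in_itv /= => /andP[].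
    have c1 : (fun p : R * R => cn (H (p.1 +i* p.2))) @ (x, y) --> cn (H (x +i* y)).
      apply/cvgrPdist_le => k k0; have [r r0 Hr] := Hc (x +i* y) xe _ k0.
      have r2 : 0 < r / 2 by rewrite divr_gt0.
      have N1 : (fun p : R * R => p.1) @ (x, y) --> x by exact: cvg_fst.
      have N2 : (fun p : R * R => p.2) @ (x, y) --> y by exact: cvg_snd.
      move/cvgrPdist_lt : N1 => /(_ _ r2) N1; move/cvgrPdist_lt : N2 => /(_ _ r2) N2.
      near=> p.
      have hp : cn ((p.1 +i* p.2) - (x +i* y)) < r.
        apply: (le_lt_trans (cn_le_ReIm _)); rewrite [r]splitr ltrD//= distrC.
          by near: p.
        by near: p.
      have := Hr _ hp; rewrite subrKC => Hk.
      by apply: le_trans (cn_dist _ _) _; rewrite cnBC.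
    apply: cvgM.
      have := @exprn_continuous R M (cn (H (x +i* y))).
      exact: cvg_comp c1.
    apply: cvgV; first by rewrite gt_eqF// pos.
    apply: cvgD; last exact: cvg_cst.
    apply: cvgB; last exact: cvg_cst.
    exact: cvg_fst.
  rewrite inE => -[/= xX yX] fmax; exists (x +i* y); split; first by move: xX; rewrite in_itv /= => /andP[].
  move=> [x' y'] /= xe'; have [D'|nD'] := pselect (D (x', y')).
    by have := fmax (x', y'); rewrite inE; exact.
  apply: (@le_trans _ _ (E s1)); last first.
    by have := fmax (Re s1, Im s1); rewrite inE => /(_ s1D); rewrite /f /=; case: (s1).
  apply/ltW/Hrho => //; rewrite leNgt; apply/negP => lr; apply: nD'.
  have CX : cn (x' +i* y') <= X.
    apply: (le_trans (ltW lr)); apply: (le_trans (ler_norm _)).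
    by rewrite /X addrAC lerDr addr_ge0 ?cn_ge0.
  have := le_trans (ler_Im _) CX; have := le_trans (ler_Re _) CX.
  rewrite !ler_norml /= => /andP[_ r2] /andP[i1 i2].
  by rewrite /D; split => /=; rewrite in_itv /=; apply/andP.
have E01 : E s1 <= E s0 := s0max _ s1e.
have H0A : A < cn (H s0).
  rewrite ltNge; apply/negP => h; have : E s1 <= A ^+ M.
    apply: le_trans E01 (le_trans (EH _ s0e) _).
    by rewrite lerXn2r ?nnegrE ?cn_ge0.
  by rewrite leNgt E1A.
have s0lt : e < Re s0.
  rewrite lt_neqAle s0e andbT; apply/eqP => es0; have := HA s0 (esym es0).
  by rewrite leNgt H0A.
have H0 : H s0 != 0 by rewrite -cn_gt0 (le_lt_trans A0).
have [K [r [r0 HK]]] := four_point (HT _ s0lt H0) H0.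
pose a := Re s0 - e + 1; pose B := cn (H s0).
have a0 : 0 < a := pos _ s0e.
have B0 : 0 < B by rewrite cn_gt0.
(* At the four points [E] is at most [E s0], and the denominators multiply to [a^2 (a^2 - h^2)].
   This is a loss of order [h^2] against the lower bound [1 - M K h^3] obtained from [four_point];
   the resulting inequality fails for small [h]. *)
have key h : 0 < h -> h < r -> h < Re s0 - e -> K * h ^+ 3 <= 1 ->
    h ^+ 2 <= M%:R * K * h ^+ 3 * a ^+ 2.
  move=> h0 hr he Kh; have := HK _ h0 hr; rewrite -/B.
  set p1 := cn _; set p2 := cn _; set p3 := cn _; set p4 := cn _ => P.
  have bern n : 1 - n%:R * (K * h ^+ 3) <= (1 - K * h ^+ 3) ^+ n.
    elim: n => [|n IH]; first by rewrite mul0r subr0 expr0.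
    rewrite [_ ^+ n.+1]exprS -natr1; have Kh1 : 0 <= 1 - K * h ^+ 3 by rewrite subr_ge0.
    apply: (le_trans _ (ler_wpM2l Kh1 IH)); rewrite -subr_ge0.
    have -> : (1 - K * h ^+ 3) * (1 - n%:R * (K * h ^+ 3)) - (1 - (n%:R + 1) * (K * h ^+ 3)) = n%:R * (K * h ^+ 3) ^+ 2 by ring.
    by rewrite mulr_ge0 ?sqr_ge0.
  have E4 : p1 ^+ M * p2 ^+ M * p3 ^+ M * p4 ^+ M * a ^+ 2 <= B ^+ M ^+ 4 * (a ^+ 2 - h ^+ 2).
    have q1 : p1 ^+ M <= B ^+ M / a * (a + h).
      have es : e <= Re (s0 + h%:C) by rewrite ReE /= (le_trans s0e)// lerDl ltW.
      have := s0max _ es; have := pos _ es; rewrite /E ReE /= => ph.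
      by rewrite ler_pdivrMr// (_ : Re s0 + h - e + 1 = a + h)// /a; ring.
    have q2 : p2 ^+ M <= B ^+ M / a * (a - h).
      have es : e <= Re (s0 - h%:C) by rewrite !ReE /= lerBrDr -lerBrDl ltW.
      have := s0max _ es; have := pos _ es; rewrite /E !ReE /= => ph.
      by rewrite ler_pdivrMr// (_ : Re s0 - h - e + 1 = a - h)// /a; ring.
    have q3 : p3 ^+ M <= B ^+ M / a * a.
      have := s0max (s0 + 'i * h%:C); rewrite !ReE /= /E !ReE /= !(mul0r, mulr0, subr0, addr0).
      by move=> /(_ s0e); rewrite ler_pdivrMr.
    have q4 : p4 ^+ M <= B ^+ M / a * a.
      have := s0max (s0 - 'i * h%:C); rewrite !ReE /= /E !ReE /= !(mul0r, mulr0, subr0, addr0).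
      by move=> /(_ s0e); rewrite ler_pdivrMr.
    have pp (q : R) : 0 <= q -> 0 <= q ^+ M by exact: exprn_ge0.
    apply: (@le_trans _ _ ((B ^+ M / a * (a + h)) * (B ^+ M / a * (a - h)) * (B ^+ M / a * a) * (B ^+ M / a * a) * a ^+ 2)).
      rewrite ler_wpM2r ?exprn_ge0 ?(ltW a0)//.
      by do 3 (apply: ler_pM; rewrite ?mulr_ge0 ?pp ?cn_ge0//).
    rewrite le_eqVlt; apply/orP; left; apply/eqP; field; exact: lt0r_neq0.
  have E5 : (B ^+ 4 * (1 - K * h ^+ 3)) ^+ M <= p1 ^+ M * p2 ^+ M * p3 ^+ M * p4 ^+ M.
    rewrite -!exprMn lerXn2r ?nnegrE ?mulr_ge0 ?exprn_ge0 ?cn_ge0 ?subr_ge0//.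
  have BM : 0 < B ^+ M ^+ 4 by rewrite !exprn_gt0.
  have : B ^+ M ^+ 4 * (1 - M%:R * (K * h ^+ 3)) * a ^+ 2 <= B ^+ M ^+ 4 * (a ^+ 2 - h ^+ 2).
    apply: le_trans E4; rewrite ler_wpM2r ?exprn_ge0 ?(ltW a0)//; apply: le_trans E5.
    by rewrite exprMn -!exprM mulnC ler_wpM2l ?exprn_ge0 ?(ltW B0).
  rewrite -mulrA ler_pM2l//; lra.
(* [K] may be negative, hence [K']. The bounds on [h] keep the points in the half-plane and in the
   range of [four_point], give [h ^+ 3 <= h], and contradict [key]. *)
pose K' := `|K| + 1.
have K'0 : 0 < K' by rewrite /K' ltr_wpDl.
pose h := Num.min (Num.min (r / 2) ((Re s0 - e) / 2)) (Num.min 1 (1 / (M%:R * K' * a ^+ 2 + K') / 2)).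
have M0 : 0 < M%:R * K' * a ^+ 2 by rewrite !mulr_gt0 ?exprn_gt0 ?ltr0n.
have h0 : 0 < h by rewrite !lt_min ltr01 !divr_gt0 ?subr_gt0// addr_gt0.
have : h <= h by []; rewrite {2}/h !le_min => /andP[/andP[h1 h2] /andP[h3 h4]].
have hK : h * (M%:R * K' * a ^+ 2 + K') <= 1 / 2 by move: h4; rewrite mulrAC ler_pdivlMr// addr_gt0.
have KK : K <= K' by rewrite /K' (le_trans (ler_norm _))// lerDl.
have h31 : h ^+ 3 <= h by rewrite exprS ler_piMr ?(ltW h0)// exprn_ile1 ?(ltW h0).
have h3p : 0 < h ^+ 3 by rewrite exprn_gt0.
have half (x : R) : 0 < x -> x / 2 < x by move=> x0; rewrite ltr_pdivrMr// ltr_pMr// ltr1n.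
have hr : h < r by rewrite (le_lt_trans h1)// half.
have he : h < Re s0 - e by rewrite (le_lt_trans h2)// half// subr_gt0.
have Kh : K * h ^+ 3 <= 1.
  have : K * h ^+ 3 <= K' * h ^+ 3 by rewrite ler_wpM2r ?(ltW h3p).
  have : K' * h ^+ 3 <= K' * h by rewrite ler_wpM2l ?(ltW K'0).
  have : 0 < h * (M%:R * K' * a ^+ 2) by rewrite mulr_gt0.
  lra.
have := key h h0 hr he Kh; apply/negP; rewrite -ltNge.
have -> : M%:R * K * h ^+ 3 * a ^+ 2 = (M%:R * a ^+ 2 * h * K) * h ^+ 2 by ring.
rewrite gtr_pMl ?exprn_gt0//.
have : M%:R * a ^+ 2 * h * K <= M%:R * a ^+ 2 * h * K' by rewrite ler_wpM2l// !mulr_ge0 ?exprn_ge0 ?(ltW a0) ?(ltW h0).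
move=> /le_lt_trans; apply.
have : 0 < h * K' by rewrite mulr_gt0.
lra.
Unshelve. all: by end_near.
Qed.

End four_point.

Section littlewood.
Variable R : realType.
Implicit Types (s z w : R[i]).

Lemma expr_bounded_le1 (a q c : R) : 0 < a -> (forall M, a * q ^+ M <= c) -> q <= 1.
Proof.
move=> a0 H; rewrite leNgt; apply/negP => q1.
have [M] := exists_expr_gt (c / a) ler01 q1.
by rewrite expr1n mul1r ltr_pdivrMr// mulrC ltNge H.
Qed.

Lemma le_of_le_add_div (a b C : R) : (forall X, 1 <= X -> a <= b + C / X) -> a <= b.
Proof.
move=> H; rewrite leNgt; apply/negP => ba.
pose X := `|C| / (a - b) + 1.
have ab0 : 0 < a - b by rewrite subr_gt0.
have X1 : 1 <= X by rewrite /X lerDr divr_ge0// ltW.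
have := H X X1; apply/negP; rewrite -ltNge -ltrBrDl ltr_pdivrMr; last by lra.
rewrite /X mulrDr mulr1 mulrCA divff ?gt_eqF// mulr1 ltr_pwDr//.
exact: ler_norm.
Qed.

Lemma cn_reflect s z : cn (s + z^*) ^+ 2 = cn (s - z) ^+ 2 + 4 * Re s * Re z.
Proof. by rewrite !cn_sqr !ReE Re_conj Im_conj; ring. Qed.

(* An element [(a, d, t0)] of [Q] stands for the multiple [a] of the Poisson kernel of height [d]
   centred at [t0].  The maximum principle is applied to [F (F G exp P)^M / (s + 1)] where
   [F = (psi - w) / (psi + conj w)], [G] is the inverse of the Blaschke product of the zeros, and [P],
   built from [Q], satisfies [|F exp P| <= 1] on the line [Re s = e]; letting [M], then [s] along the
   reals, tend to infinity compares the leading terms. *)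
Lemma littlewood_inequality (psi : R[i] -> R[i]) w (e : R) (Z : seq R[i]) (k : R[i] -> nat)
    (Q : seq (R * R * R)) :
  0 < e -> 0 < Re w ->
  (forall s, 0 < Re s -> Re s <= Re (psi s)) -> (forall s, 0 < Re s -> jet3 psi s) ->
  uniq Z ->
  (forall z, z \in Z -> e < Re z /\ (0 < k z)%N /\ exists C r : R, 0 < r /\
     forall h, cn h < r -> cn (psi (z + h) - w) <= C * cn h ^+ k z) ->
  (forall q, q \in Q -> 0 <= q.1.1 /\ 0 < q.1.2) ->
  (forall t, (cn (psi (e +i* t) + w^*) ^+ 2)^-1 <=
     \sum_(q <- Q) q.1.1 * (q.1.2 / (q.1.2 ^+ 2 + (t - q.2) ^+ 2))) ->
  \sum_(z <- Z) (k z)%:R * (Re z - e) <= Re w ^+ 2 * \sum_(q <- Q) q.1.1.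
Proof.
move=> e0; set sg := Re w => sg0 psiR psiT uZ HZ HQ Hb.
pose N s := psi s + w^*.
have ReN_ s : 0 < Re s -> Re s + sg <= Re (N s).
  by move=> s0; rewrite /N ReE Re_conj lerD2r psiR.
have cN s : 0 < Re s -> 0 < cn (N s).
  by move=> s0; apply: lt_le_trans (Re_le_cn _); apply: lt_le_trans (ReN_ _ s0); rewrite addr_gt0.
have N0 s : 0 < Re s -> N s != 0 by move=> /cN; rewrite cn_gt0.
have NT s : 0 < Re s -> jet3 N s by move=> s0; apply: jet3D; [exact: psiT|exact: jet3_cst].
pose F s := (psi s - w) / N s.
have FT s : 0 < Re s -> jet3 F s.
  move=> s0; apply: jet3M; first by apply: jet3B; [exact: psiT|exact: jet3_cst].
  by apply: jet3V; [exact: N0|exact: NT].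
have N2 s : cn (N s) ^+ 2 = cn (psi s - w) ^+ 2 + 4 * Re (psi s) * sg by rewrite cn_reflect.
have F2 s : 0 < Re s -> cn (F s) ^+ 2 = 1 - 4 * Re (psi s) * sg / cn (N s) ^+ 2.
  move=> s0; rewrite cnM cnV exprMn exprVn.
  have -> : cn (psi s - w) ^+ 2 = cn (N s) ^+ 2 - 4 * Re (psi s) * sg by rewrite N2 addrK.
  by rewrite mulrBl divff// expf_neq0// gt_eqF// cN.
have psi0 s : 0 < Re s -> 0 < Re (psi s) by move=> s0; exact: lt_le_trans (psiR _ s0).
have F1 s : 0 < Re s -> cn (F s) <= 1.
  move=> s0; rewrite -(@ler_pXn2r _ 2) ?nnegrE ?cn_ge0// F2// expr1n.
  by rewrite gerBl !mulr_ge0 ?invr_ge0 ?exprn_ge0 ?cn_ge0// ltW// psi0.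
(* On the line [Re s = e] the real part of [1 / D q s] is the Poisson kernel of height [d] centred
   at [t0]. *)
pose D (q : R * R * R) s := s + ((q.1.2 - e) +i* (- q.2)).
have DR q s : q \in Q -> e <= Re s -> Re s - e < Re (D q s).
  by move=> /HQ[_ q0] es; rewrite /D ReE /=; lra.
have D0 q s : q \in Q -> e <= Re s -> D q s != 0.
  move=> qQ es; rewrite -cn_gt0; apply: lt_le_trans (Re_le_cn _).
  by apply: le_lt_trans (DR _ _ qQ es); rewrite subr_ge0.
(* On the line, [|F|^2 <= exp (- 4 sg Re psi / |N|^2)]. As [Re N = Re psi + sg], the first term of
   [2 Re P] cancels this exponent up to [4 sg^2 / |N|^2], which the hypothesis on [Q] lets the
   second term absorb. *)
pose P s := (2 * sg)%:C / N s - (2 * sg ^+ 2)%:C * \sum_(q <- Q) q.1.1%:C / D q s.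
have PT s : e <= Re s -> jet3 P s.
  move=> es; have s0 : 0 < Re s by apply: lt_le_trans es.
  apply: jet3B; first by apply: jet3M; [exact: jet3_cst|apply: jet3V; [exact: N0|exact: NT]].
  apply: jet3M; first exact: jet3_cst.
  have : jet3 (fun s => \sum_(q <- [seq q <- Q | true]) q.1.1%:C / D q s) s.
    elim: {Hb}Q HQ @P DR D0 => [|q Q' IH] HQ _ DR D0 /=.
      by under eq_fun do rewrite big_nil; exact: jet3_cst.
    under eq_fun do rewrite big_cons; apply: jet3D.
      apply: jet3M; first exact: jet3_cst.
      by apply: jet3V; [apply: D0; rewrite ?mem_head|apply: jet3D; [exact: jet3_id|exact: jet3_cst]].
    by apply: IH => [q' q'Q|q' s' q'Q|q' s' q'Q]; [apply: HQ|apply: DR|apply: D0]; rewrite inE q'Q orbT.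
  by rewrite filter_predT.
have RP s : e <= Re s -> Re (P s) = 2 * sg * (Re (N s) / cn (N s) ^+ 2) -
    2 * sg ^+ 2 * \sum_(q <- Q) q.1.1 * (Re (D q s) / cn (D q s) ^+ 2).
  move=> es; rewrite /P ReE ReN !ReM /= !mul0r !subr0 Re_inv Re_sum.
  congr (_ - _ * _); apply: eq_bigr => q _.
  by rewrite ReM /= mul0r subr0 Re_inv.
have RP2 s : e <= Re s -> Re (P s) <= 2.
  move=> es; have s0 : 0 < Re s by apply: lt_le_trans es.
  rewrite RP//; apply: (@le_trans _ _ (2 * sg * (Re (N s) / cn (N s) ^+ 2))).
    rewrite gerBl mulr_ge0 ?mulr_ge0 ?exprn_ge0 ?(ltW sg0)//.
    rewrite big_seq sumr_ge0// => q qQ; rewrite mulr_ge0 ?divr_ge0 ?exprn_ge0 ?cn_ge0//.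
      by have [] := HQ _ qQ.
    by rewrite ltW// (le_lt_trans _ (DR _ _ qQ es))// subr_ge0.
  rewrite -mulrA ler_piMr// mulrA ler_pdivrMr ?exprn_gt0 ?cN// mul1r expr2.
  have := ReN_ _ s0; have := Re_le_cn (N s); have := cN _ s0; nra.
(* The inverse of a Blaschke factor of [Re s > e]: its numerator vanishes at [2 e - conj z], the
   reflection of [z] in the line [Re s = e]. *)
pose B z s := (s + (- (2 * e)%:C + z^*)) / (s - z).
have BE z s : cn (s + (- (2 * e)%:C + z^*)) ^+ 2 = cn (s - z) ^+ 2 + 4 * (Re s - e) * (Re z - e).
  by rewrite !cn_sqr !ReE Re_conj Im_conj /=; ring.
have BT z s : s != z -> jet3 (B z) s.
  move=> sz; apply: jet3M; first by apply: jet3D; [exact: jet3_id|exact: jet3_cst].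
  apply: jet3V; first by rewrite subr_eq0.
  by apply: jet3B; [exact: jet3_id|exact: jet3_cst].
pose G s := \prod_(z <- Z) B z s ^+ k z.
have GT s : s \notin Z -> jet3 G s.
  move=> sZ; apply: jet3_prod => z zZ; apply: jet3X; apply: BT.
  by apply: contraNneq sZ => ->.
(* Near a point of [Z] the product [F G] is only bounded, and at the point itself [G] takes the
   value given by [0^-1 = 0]; the extra factor [F] makes [H] vanish and be continuous there. The
   division by [s + 1] gives the decay at infinity. *)
pose H M s := F s * (F s * G s * cexp (P s)) ^+ M / (s + 1).
have s10 s : e <= Re s -> s + 1 != 0.
  move=> es; rewrite -cn_gt0; apply: lt_le_trans (Re_le_cn _); rewrite ReE /=; lra.
have HZ0 M s : s \in Z -> F s = 0 /\ H M s = 0.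
  move=> sZ; have [es [k0 [C [r [r0 Hr]]]]] := HZ _ sZ.
  have : cn (psi s - w) = 0.
    apply/eqP; rewrite eq_le cn_ge0 andbT; have := Hr 0; rewrite cn0 addr0 expr0n gtn_eqF//= mulr0.
    exact.
  by move/eqP; rewrite cn_eq0 /H /F => /eqP ->; rewrite !mul0r.
have FGB s : e <= Re s -> s \in Z -> bounded_near0 (fun h => F (s + h) * G (s + h)).
  move=> es sZ; have s0 : 0 < Re s by apply: lt_le_trans es.
  have [_ [k0 [C [r [r0 Hr]]]]] := HZ _ sZ.
  pose G' x := \prod_(z <- rem s Z) B z x ^+ k z.
  have G'T : jet3 G' s.
    apply: jet3_prod => z zZ; apply: jet3X; apply: BT.
    by apply: contraTneq zZ => <-; rewrite mem_rem_uniqF.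
  have B1 : bounded_near0 (fun h => (psi (s + h) - w) / h ^+ k s).
    exists `|C|, r; split => // h /Hr; rewrite cnM cnV cnX.
    have := cn_ge0 h; rewrite le_eqVlt => /orP[/eqP <- _|h0 hC]; first by rewrite expr0n gtn_eqF//= invr0 mulr0.
    by rewrite ler_pdivrMr ?exprn_gt0// (le_trans hC)// ler_wpM2r ?exprn_ge0 ?cn_ge0// ler_norm.
  have B2 : bounded_near0 (fun h => (s + h + (- (2 * e)%:C + s^*)) ^+ k s).
    by apply: bounded_near0X; apply: bounded_near0D; [apply: bounded_near0D; [exact: bounded_near0_cst|exact: bounded_near0_id]|exact: bounded_near0_cst].
  have B3 : bounded_near0 (fun h => (N (s + h))^-1 * G' (s + h)).
    apply: bounded_near0M; last exact: bounded_near0_jet3 G'T.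
    by apply: (@bounded_near0_jet3 _ (fun x => (N x)^-1)); apply: jet3V; [exact: N0|exact: NT].
  apply: bounded_near0_eq ltr01 _ (bounded_near0M (bounded_near0M B1 B2) B3) => h _.
  have Bh : B s (s + h) = (s + h + (- (2 * e)%:C + s^*)) / h.
    by rewrite /B; congr (_ / _); ring.
  rewrite /G (big_rem s) //= Bh -/(G' _) /F [X in _ = _ * (X * _)]expr_div_n; ring.
have HC M s : e <= Re s -> forall kp : R, 0 < kp -> exists2 r : R, 0 < r &
     forall h, cn h < r -> cn (H M (s + h) - H M s) <= kp.
  move=> es kp kp0; have s0 : 0 < Re s by apply: lt_le_trans es.
  have [sZ|sZ] := boolP (s \in Z); last first.
    apply: jet3_cont => //; apply: jet3M.
      apply: jet3M; first exact: FT.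
      apply: jet3X; apply: jet3M; first by apply: jet3M; [exact: FT|exact: GT].
      by apply: jet3_cexp; exact: PT.
    by apply: jet3V; [exact: s10|apply: jet3D; [exact: jet3_id|exact: jet3_cst]].
  have [F0 H0] := HZ0 M _ sZ.
  have [C [r [r0 Hr]]] : bounded_near0 (fun h => (F (s + h) * G (s + h) * cexp (P (s + h))) ^+ M * (s + h + 1)^-1).
    apply: bounded_near0M; first by apply: bounded_near0X; apply: bounded_near0M; [exact: FGB|apply: bounded_near0_jet3 (jet3_cexp (PT _ es))].
    apply: (@bounded_near0_jet3 _ (fun x => (x + 1)^-1)).
    by apply: jet3V; [exact: s10|apply: jet3D; [exact: jet3_id|exact: jet3_cst]].
  have C0 : 0 <= C by apply: le_trans (Hr 0 _); rewrite ?cn0// cn_ge0.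
  have kpC : 0 < kp / (C + 1) by rewrite divr_gt0// ltr_wpDl.
  have [r' r'0 Hr'] := jet3_cont (FT _ s0) kpC.
  exists (Num.min r r'); first by rewrite lt_min r0.
  move=> h; rewrite lt_min => /andP[h1 h2]; rewrite H0 subr0 /H -mulrA cnM.
  have := Hr' _ h2; rewrite F0 subr0 ler_pdivlMr ?ltr_wpDl//; apply: le_trans.
  by rewrite ler_wpM2l ?cn_ge0// (le_trans (Hr _ h1))// lerDl.
have HT M s : e < Re s -> H M s != 0 -> jet3 (H M) s.
  move=> es Hs; have s0 : 0 < Re s by apply: lt_trans es.
  have sZ : s \notin Z by apply: contra Hs => sZ; have [_ ->] := HZ0 M _ sZ.
  apply: jet3M.
    apply: jet3M; first exact: FT.
    apply: jet3X; apply: jet3M; first by apply: jet3M; [exact: FT|exact: GT].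
    by apply: jet3_cexp; apply: PT; exact: ltW.
  by apply: jet3V; [apply: s10; exact: ltW|apply: jet3D; [exact: jet3_id|exact: jet3_cst]].
have HB M s : Re s = e -> cn (H M s) <= 1.
  move=> es; have s0 : 0 < Re s by rewrite es.
  have e_s : e <= Re s by rewrite es.
  have G1 : cn (G s) = 1.
    rewrite cn_prod big_seq big1// => z zZ; rewrite cnX; have [ez _] := HZ _ zZ.
    have sz : s != z by apply/eqP => sz; move: ez; rewrite -sz es ltxx.
    have -> : cn (B z s) = 1; last by rewrite expr1n.
    rewrite cnM cnV; have -> : cn (s + (- (2 * e)%:C + z^*)) = cn (s - z).
      by apply/eqP; rewrite -(@eqrXn2 _ 2) ?cn_ge0// BE es subrr mulr0 mul0r addr0.
    by rewrite divff// cn_eq0 subr_eq0.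
  have FP : cn (F s) * expR (Re (P s)) <= 1.
    rewrite -(@ler_pXn2r _ 2) ?nnegrE ?mulr_ge0 ?cn_ge0 ?expR_ge0// expr1n exprMn F2//.
    rewrite -expRM_natl.
    apply: (@le_trans _ _ (expR (- (4 * Re (psi s) * sg / cn (N s) ^+ 2)) * expR (2 * Re (P s)))).
      by rewrite ler_wpM2r ?expR_ge0// expR_ge1Dx.
    rewrite -expRD -[leRHS]expR0 ler_expR RP//.
    have := Hb (Im s); rewrite (_ : e +i* Im s = s); last by rewrite -es; case: (s).
    rewrite -/(N s).
    have -> : \sum_(q <- Q) q.1.1 * (q.1.2 / (q.1.2 ^+ 2 + (Im s - q.2) ^+ 2)) =
        \sum_(q <- Q) q.1.1 * (Re (D q s) / cn (D q s) ^+ 2).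
      apply: eq_bigr => q _; rewrite cn_sqr /D !ReE /= es.
      by rewrite (_ : e + (q.1.2 - e) = q.1.2)//; ring.
    set S := (X in _ <= X) => HS; rewrite /N ReE Re_conj -/(N s) -/sg.
    have : sg ^+ 2 * (cn (N s) ^+ 2)^-1 <= sg ^+ 2 * S by rewrite ler_wpM2l// sqr_ge0.
    rewrite -/S; set v := (_ ^-1); nra.
  rewrite /H cnM cnM cnX cnV cnM cnM G1 mulr1 cn_cexp.
  have c1 : 1 <= cn (s + 1) by apply: le_trans (Re_le_cn _); rewrite ReE /= es; lra.
  rewrite ler_pdivrMr ?(lt_le_trans ltr01)// mul1r (le_trans _ c1)//.
  rewrite mulr_ile1 ?cn_ge0 ?exprn_ge0 ?mulr_ge0 ?cn_ge0 ?expR_ge0 ?F1//.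
  by rewrite exprn_ile1// mulr_ge0 ?cn_ge0 ?expR_ge0.
have Hinf M (kp : R) : 0 < kp -> exists rho : R, forall s, e <= Re s -> rho <= cn s -> cn (H M s) <= kp.
  (* Beyond the radius [rho] each factor [B z] has modulus at most 2, because [|s| >= 2 e + 3 |z|]
     there. *)
  move=> kp0; pose K := \prod_(z <- Z) (2 : R) ^+ k z.
  have K0 : 0 <= K by apply: prodr_ge0 => z _; rewrite exprn_ge0.
  pose rho := 1 + (2 * e + \sum_(z <- Z) 3 * cn z) + (K * expR 2) ^+ M / kp.
  have S0 : 0 <= \sum_(z <- Z) 3 * cn z by apply: sumr_ge0 => z _; rewrite mulr_ge0 ?cn_ge0.
  have T0 : 0 <= (K * expR 2) ^+ M / kp by rewrite divr_ge0 ?(ltW kp0)// exprn_ge0// mulr_ge0 ?expR_ge0.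
  exists rho => s es rs; have s0 : 0 < Re s by apply: lt_le_trans es.
  have GK : cn (G s) <= K.
    rewrite cn_prod /K big_seq [leRHS]big_seq; apply: ler_prod => z zZ.
    rewrite cn_ge0 cnX lerXn2r ?nnegrE ?cn_ge0//.
    have zS : 3 * cn z <= \sum_(z <- Z) 3 * cn z.
      by rewrite (big_rem z)//= lerDl sumr_ge0// => y _; rewrite mulr_ge0 ?cn_ge0.
    have := cn_lb s z => szl.
    have sz : 0 < cn (s - z) by have := cn_ge0 z; rewrite /rho in rs; lra.
    rewrite cnM cnV ler_pdivrMr//.
    have h1 := cnD s (- (2 * e)%:C + z^*); have h2 := cnD (- (2 * e)%:C) z^*.
    rewrite cnN cn_conj cnR ger0_norm in h2; last by rewrite mulr_ge0// ltW.
    have := cn_ge0 z; rewrite /rho in rs; lra.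
  have c1 : cn s <= cn (s + 1).
    rewrite -(@ler_pXn2r _ 2) ?nnegrE ?cn_ge0// !cn_sqr !ReE /= addr0 lerD2r.
    by rewrite lerXn2r ?nnegrE ?lerDl ?addr_ge0 ?(ltW s0).
  have eS0 : 0 <= 2 * e + \sum_(z <- Z) 3 * cn z by rewrite addr_ge0// mulr_ge0// ltW.
  have rho0 : 0 < rho by rewrite /rho ltr_wpDr// ltr_pwDl.
  have c0 : 0 < cn (s + 1) by apply: lt_le_trans c1; exact: lt_le_trans rs.
  rewrite /H cnM cnV ler_pdivrMr//; apply: (@le_trans _ _ ((K * expR 2) ^+ M)); last first.
    rewrite [leRHS]mulrC -ler_pdivrMr//; apply: le_trans c1; apply: le_trans rs.
    by rewrite /rho lerDr addr_ge0.
  rewrite cnM cnX cnM cnM cn_cexp -[leRHS]mul1r.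
  apply: ler_pM; rewrite ?exprn_ge0 ?mulr_ge0 ?cn_ge0 ?expR_ge0 ?F1//.
  rewrite lerXn2r ?nnegrE ?mulr_ge0 ?cn_ge0 ?expR_ge0//.
  apply: ler_pM; rewrite ?mulr_ge0 ?cn_ge0 ?expR_ge0 ?ler_expR ?RP2//.
  by rewrite -[leRHS]mul1r; apply: ler_pM; rewrite ?cn_ge0 ?F1.
have main M s : e <= Re s -> cn (H M s) <= 1 by move=> es; exact: (max_principle (HC M) (HT M) (HB M) (Hinf M) es).
(* Letting [M] tend to infinity removes the two factors that are not raised to the power [M]. *)
have key x : e <= x -> cn (F x%:C) != 0 -> cn (F x%:C * G x%:C * cexp (P x%:C)) <= 1.
  move=> ex F0; apply: (@expr_bounded_le1 (cn (F x%:C)) _ (cn (x%:C + 1))).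
    by rewrite lt_def F0 cn_ge0.
  move=> M; have := main M x%:C ex; rewrite /H cnM cnV cnM cnX ler_pdivrMr ?mul1r//.
  by rewrite cn_gt0 s10.
pose S := \sum_(q <- Q) q.1.1.
have S0 : 0 <= S by rewrite /S big_seq sumr_ge0// => q /HQ[].
(* The logarithm of [key] at a real point, with [log] replaced by the inequality [1 + y <= exp y] on
   each factor. The condition [2 * sg <= x] gives [|psi - w| >= Re psi / 2], and the term in [x^-2]
   is the cost of passing from [|psi - w|^2] to [|psi + conj w|^2]. *)
have key2 x : e < x -> 2 * sg <= x ->
    \sum_(z <- Z) (k z)%:R * (4 * (x - e) * (Re z - e) / cn (x%:C + (- (2 * e)%:C + z^*)) ^+ 2)
    <= 64 * sg ^+ 2 / x ^+ 2 + 4 * sg ^+ 2 * S / (x - e).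
  move=> ex sx; have ex' : e <= Re x%:C by exact: ltW.
  have x0 : 0 < x by apply: lt_trans ex.
  have s0 : 0 < Re (x%:C : R[i]) by [].
  have rx : x <= Re (psi x%:C) := psiR _ s0.
  set rh := Re (psi x%:C) in rx.
  have pw : rh / 2 <= cn (psi x%:C - w).
    apply: le_trans (Re_le_cn _); rewrite !ReE -/rh -/sg; lra.
  have rh0 : 0 < rh by exact: lt_le_trans rx.
  have pw0 : 0 < cn (psi x%:C - w) by apply: lt_le_trans pw; rewrite divr_gt0.
  have NN : rh <= cn (N x%:C).
    by apply: le_trans (Re_le_cn _); rewrite /N ReE Re_conj -/rh lerDl ltW.
  have Nx0 : 0 < cn (N x%:C) by exact: cN.
  have Fx0 : cn (F x%:C) != 0 by rewrite cnM cnV mulf_neq0 ?invr_eq0 ?gt_eqF.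
  have xZ : x%:C \notin Z.
    by apply: contra Fx0 => xZ; have [-> _] := HZ0 0 _ xZ; rewrite cn0.
  have F2' : expR (- (4 * sg * rh / cn (psi x%:C - w) ^+ 2)) <= cn (F x%:C) ^+ 2.
    rewrite expRN -[leRHS]invrK lef_pV2 ?posrE ?expR_gt0 ?invr_gt0 ?exprn_gt0 ?lt_def ?Fx0 ?cn_ge0//.
    rewrite cnM cnV -exprVn invfM invrK exprMn exprVn.
    rewrite N2 -/rh mulrDr mulVf ?expf_neq0 ?gt_eqF//.
    apply: le_trans (expR_ge1Dx _); rewrite lerD2l le_eqVlt; apply/orP; left; apply/eqP; ring.
  have B2 z : z \in Z -> expR (4 * (x - e) * (Re z - e) / cn (x%:C + (- (2 * e)%:C + z^*)) ^+ 2) <= cn (B z x%:C) ^+ 2.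
    move=> zZ; have xz : 0 < cn (x%:C - z).
      by rewrite cn_gt0 subr_eq0; apply: contraNneq xZ => ->.
    have [ez _] := HZ _ zZ.
    have bb := BE z x%:C; set b2 := cn (x%:C + _) ^+ 2 in bb *.
    have b20 : 0 < b2 by rewrite bb /= ltr_pwDl ?exprn_gt0// !mulr_ge0// subr_ge0 ltW.
    rewrite cnM cnV exprMn exprVn -/b2.
    have c2E : cn (x%:C - z) ^+ 2 = b2 - 4 * (x - e) * (Re z - e) by rewrite bb /=; ring.
    have c20 : 0 < cn (x%:C - z) ^+ 2 by rewrite exprn_gt0.
    rewrite -[leLHS]invrK -expRN -[leRHS]invrK invf_div lef_pV2 ?posrE ?expR_gt0 ?(divr_gt0 c20 b20)//.
    rewrite c2E mulrBl divff ?gt_eqF//; exact: expR_ge1Dx.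
  have := key x ex' Fx0.
  rewrite -(@ler_pXn2r _ 2) ?nnegrE ?cn_ge0// expr1n cnM cnM !exprMn cn_cexp -expRM_natl.
  move=> kk.
  have G2 : expR (\sum_(z <- Z) (k z)%:R * (4 * (x - e) * (Re z - e) / cn (x%:C + (- (2 * e)%:C + z^*)) ^+ 2)) <= cn (G x%:C) ^+ 2.
    rewrite expR_sum cn_prod -prodrXl big_seq [leRHS]big_seq; apply: ler_prod => z zZ.
    rewrite expR_ge0 cnX -exprM mulnC exprM expRM_natl lerXn2r ?nnegrE ?expR_ge0 ?exprn_ge0 ?cn_ge0//.
    exact: B2.
  set Y := \sum_(z <- Z) _ in G2 *.
  have : expR (- (4 * sg * rh / cn (psi x%:C - w) ^+ 2)) * expR Y * expR (2 * Re (P x%:C)) <= 1.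
    apply: le_trans kk; rewrite ler_wpM2r ?expR_ge0//.
    by apply: ler_pM; rewrite ?expR_ge0.
  rewrite -!expRD -[leRHS]expR0 ler_expR RP//.
  have HS : \sum_(q <- Q) q.1.1 * (Re (D q x%:C) / cn (D q x%:C) ^+ 2) <= S / (x - e).
    rewrite /S mulr_suml big_seq [leRHS]big_seq; apply: ler_sum => q qQ.
    have dq : x - e < Re (D q x%:C) := DR _ _ qQ ex'.
    have [q1 _] := HQ _ qQ.
    rewrite ler_wpM2l//.
    have Dq0 : 0 < Re (D q x%:C) by apply: le_lt_trans dq; rewrite subr_ge0 ltW.
    have Dc : 0 < cn (D q x%:C) by apply: lt_le_trans (Re_le_cn _).
    rewrite ler_pdivrMr ?exprn_gt0// mulrC ler_pdivlMr ?subr_gt0//.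
    rewrite expr2; apply: ler_pM; rewrite ?(ltW Dq0) ?subr_ge0 ?(ltW ex) ?Re_le_cn//.
    exact: le_trans (ltW dq) (Re_le_cn _).
  set T := \sum_(q <- Q) _ in HS *.
  rewrite {1}/N ReE Re_conj -/rh -/sg.
  set p2 := cn (psi x%:C - w) in pw pw0 *; set n2 := cn (N x%:C) in NN Nx0 *.
  have nn2 : n2 ^+ 2 = p2 ^+ 2 + 4 * rh * sg by exact: N2.
  have d1 : 4 * sg * rh / p2 ^+ 2 - 4 * sg * rh / n2 ^+ 2 <= 64 * sg ^+ 2 / x ^+ 2.
    have -> : 4 * sg * rh / p2 ^+ 2 - 4 * sg * rh / n2 ^+ 2 = 16 * sg ^+ 2 * (rh / p2) ^+ 2 * (n2^-1) ^+ 2.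
      have -> : 4 * sg * rh / p2 ^+ 2 - 4 * sg * rh / n2 ^+ 2 = 4 * sg * rh * (n2 ^+ 2 - p2 ^+ 2) / (p2 ^+ 2 * n2 ^+ 2).
        by field; rewrite !gt_eqF.
      by rewrite nn2 addrAC subrr add0r -nn2; field; rewrite !gt_eqF.
    have a1 : rh / p2 <= 2 by rewrite ler_pdivrMr// mulrC -ler_pdivrMr.
    have a2 : n2^-1 <= x^-1 by rewrite lef_pV2 ?posrE// (le_trans rx).
    have -> : 64 * sg ^+ 2 / x ^+ 2 = 16 * sg ^+ 2 * 2 ^+ 2 * x^-1 ^+ 2 by rewrite exprVn; ring.
    apply: ler_pM; rewrite ?mulr_ge0 ?exprn_ge0 ?invr_ge0 ?divr_ge0 ?(ltW sg0) ?(ltW rh0) ?(ltW pw0) ?(ltW Nx0)//.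
      apply: ler_wpM2l; first by rewrite mulr_ge0 ?sqr_ge0.
      by rewrite lerXn2r ?nnegrE ?divr_ge0 ?(ltW rh0) ?(ltW pw0).
    by rewrite lerXn2r ?nnegrE ?invr_ge0 ?(ltW Nx0) ?(ltW x0).
  have d2 : 4 * sg ^+ 2 * T <= 4 * sg ^+ 2 * S / (x - e).
    by rewrite -[leRHS]mulrA ler_wpM2l// mulr_ge0 ?sqr_ge0.
  have d3 : 0 <= sg ^+ 2 / n2 ^+ 2 by rewrite divr_ge0 ?sqr_ge0.
  have -> : 2 * (2 * sg * ((rh + sg) / n2 ^+ 2) - 2 * sg ^+ 2 * T) =
    4 * sg * rh / n2 ^+ 2 + 4 * (sg ^+ 2 / n2 ^+ 2) - 4 * sg ^+ 2 * T by ring.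
  lra.
(* For [b = Re z - e] and [Y >= 1], the quotient [Y^2 / ((Y + b)^2 + (Im z)^2)] is at least
   [1 - c z / Y]; multiplied by [Y / 4], [key2] at [x = e + Y] then gives the claim up to a multiple
   of [1 / Y]. *)
pose c z := 2 * (Re z - e) + (Re z - e) ^+ 2 + Im z ^+ 2.
pose C1 := \sum_(z <- Z) (k z)%:R * (Re z - e) * c z.
have be z : z \in Z -> 0 < Re z - e by move=> /HZ[]; rewrite subr_gt0.
have c0 z : z \in Z -> 0 <= c z.
  by move=> /be/ltW bz; rewrite /c !addr_ge0 ?sqr_ge0 ?mulr_ge0.
have C10 : 0 <= C1.
  rewrite /C1 big_seq sumr_ge0// => z zZ; rewrite !mulr_ge0 ?c0// ltW//; exact: be.
apply: (@le_of_le_add_div _ _ (16 * sg ^+ 2 + C1)) => X X1.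
pose Y := X + 2 * sg; have Y1 : 1 <= Y by rewrite /Y (le_trans X1)// lerDl mulr_ge0// ltW.
have Y0 : 0 < Y := lt_le_trans ltr01 Y1.
have X0 : 0 < X := lt_le_trans ltr01 X1.
apply: (@le_trans _ _ (sg ^+ 2 * S + (16 * sg ^+ 2 + C1) / Y)); last first.
  have CC : 0 <= 16 * sg ^+ 2 + C1 by rewrite addr_ge0// mulr_ge0 ?sqr_ge0.
  by rewrite lerD2l ler_wpM2l// lef_pV2 ?posrE// /Y lerDl mulr_ge0// ltW.
have eY : e < e + Y by rewrite ltrDl.
have sY : 2 * sg <= e + Y by rewrite /Y addrA lerDr addr_ge0 ?(ltW e0) ?(ltW X0).
have := key2 _ eY sY; rewrite (_ : e + Y - e = Y); last by ring.
move=> kk.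
have : (\sum_(z <- Z) (k z)%:R * (Re z - e)) - C1 / Y <= 16 * sg ^+ 2 / Y + sg ^+ 2 * S.
  apply: (@le_trans _ _ (Y / 4 * (\sum_(z <- Z) (k z)%:R *
        (4 * Y * (Re z - e) / cn ((e + Y)%:C + (- (2 * e)%:C + z^*)) ^+ 2)))).
    rewrite /C1 mulr_suml mulr_sumr -sumrB big_seq [leRHS]big_seq; apply: ler_sum => z zZ.
    have bz := be _ zZ; set b := Re z - e in bz *.
    have -> : cn ((e + Y)%:C + (- (2 * e)%:C + z^*)) ^+ 2 = (Y + b) ^+ 2 + Im z ^+ 2.
      by rewrite cn_sqr !ReE Re_conj Im_conj /= /b; ring.
    have D0' : 0 < (Y + b) ^+ 2 + Im z ^+ 2 by rewrite ltr_pwDl ?sqr_ge0// exprn_gt0// addr_gt0.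
    have -> : (k z)%:R * b - (k z)%:R * b * c z / Y = (k z)%:R * b * (1 - c z / Y) by ring.
    have -> : Y / 4 * ((k z)%:R * (4 * Y * b / ((Y + b) ^+ 2 + Im z ^+ 2))) =
      (k z)%:R * b * (Y ^+ 2 / ((Y + b) ^+ 2 + Im z ^+ 2)) by field; rewrite gt_eqF.
    rewrite ler_wpM2l ?mulr_ge0 ?(ltW bz)// ler_pdivlMr//.
    have -> : (1 - c z / Y) * ((Y + b) ^+ 2 + Im z ^+ 2) =
      Y ^+ 2 - (c z / Y * ((Y + b) ^+ 2 + Im z ^+ 2) - (2 * b * Y + b ^+ 2 + Im z ^+ 2)) by ring.
    rewrite gerBl subr_ge0.
    have h1 : 2 * b * Y + b ^+ 2 + Im z ^+ 2 <= c z * Y.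
      rewrite /c -/b; have := sqr_ge0 b; have := sqr_ge0 (Im z); nra.
    have h2 : c z * Y <= c z / Y * ((Y + b) ^+ 2 + Im z ^+ 2).
      rewrite -[leRHS]mulrA ler_wpM2l ?c0// [leRHS]mulrC ler_pdivlMr//.
      have := sqr_ge0 (Im z); nra.
    exact: le_trans h1 h2.
  apply: (@le_trans _ _ (Y / 4 * (64 * sg ^+ 2 / (e + Y) ^+ 2 + 4 * sg ^+ 2 * S / Y))).
    by rewrite ler_wpM2l// divr_ge0// ltW.
  have -> : Y / 4 * (64 * sg ^+ 2 / (e + Y) ^+ 2 + 4 * sg ^+ 2 * S / Y) =
      16 * sg ^+ 2 * (Y / (e + Y) ^+ 2) + sg ^+ 2 * S.
    by field; rewrite !gt_eqF// addr_gt0.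
  have y2 : Y / (e + Y) ^+ 2 <= Y^-1.
    have eY2 : 0 < (e + Y) ^+ 2 by rewrite exprn_gt0// addr_gt0.
    rewrite ler_pdivrMr// [leRHS]mulrC ler_pdivlMr//; nra.
  by rewrite lerD2r ler_wpM2l// mulr_ge0 ?sqr_ge0.
have -> : (16 * sg ^+ 2 + C1) / Y = 16 * sg ^+ 2 / Y + C1 / Y by ring.
lra.
Qed.

End littlewood.

(** * Mean squares of Dirichlet polynomials and Kronecker's theorem *)

Section bessel.
Variable R : realType.

Lemma sum_real_complex (I : Type) (r : seq I) (P : pred I) (f : I -> R) :
  (\sum_(i <- r | P i) f i)%:C = \sum_(i <- r | P i) (f i)%:C.
Proof. exact: rmorph_sum. Qed.

Lemma le_of_nat_mul (a b C : R) : (forall T : nat, T%:R * a <= T%:R * b + C) -> a <= b.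
Proof.
move=> H; rewrite leNgt; apply/negP => ba.
have ab0 : 0 < a - b by rewrite subr_gt0.
have := H (Num.truncn (C / (a - b))).+1; apply/negP; rewrite -ltNge.
rewrite -ltrBrDl -mulrBr -ltr_pdivrMr//; exact: truncnS_gt.
Qed.

Lemma cn_parallelogram (z u : R[i]) :
  cn (z - u) ^+ 2 + cn (u + z) ^+ 2 = 2 * cn z ^+ 2 + 2 * cn u ^+ 2.
Proof. by rewrite !cn_sqr !ReE; ring. Qed.

Lemma geometric_sum_bound (u : R[i]) (T : nat) : cn u = 1 -> u != 1 ->
  cn (\sum_(m < T) u ^+ m) <= 2 / cn (1 - u).
Proof.
move=> u1 u1'; have d0 : 0 < cn (1 - u) by rewrite cn_gt0 subr_eq0 eq_sym.
rewrite ler_pdivlMr// -cnM mulrC -opprB mulNr -subrX1 cnN.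
by rewrite (le_trans (cnB _ _))// cnX u1 expr1n cn1.
Qed.

(** The diagonal terms give the main part; each off-diagonal one is a geometric sum of ratio
    [z k * conj (z l) != 1], bounded in [T]. [C] depends on the bounds [A] only, so that it serves
    the twists of one polynomial by all characters. *)
Lemma mean_square_bound (N : nat) (z : 'I_N -> R[i]) (A : 'I_N -> R) :
  (forall k, cn (z k) = 1) -> injective z ->
  exists C : R, forall a : 'I_N -> R[i], (forall k, cn (a k) <= A k) -> forall T : nat,
    `|\sum_(m < T) cn (\sum_k a k * z k ^+ m) ^+ 2 - T%:R * \sum_k cn (a k) ^+ 2| <= C.
Proof.
move=> z1 zI.
exists (\sum_k \sum_(l | l != k) A k * A l * (2 / cn (1 - z k * (z l)^*))) => a aA T.
have A0 k : 0 <= A k := le_trans (cn_ge0 _) (aA k).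
have -> : forall x : R, `|x| = cn x%:C by move=> x; rewrite cnR.
have -> : (\sum_(m < T) cn (\sum_k a k * z k ^+ m) ^+ 2 - T%:R * \sum_k cn (a k) ^+ 2)%:C
  = \sum_k \sum_(l | l != k) a k * (a l)^* * \sum_(m < T) (z k * (z l)^*) ^+ m.
  rewrite rmorphB rmorphM /= !sum_real_complex natrC.
  have E m : (cn (\sum_k a k * z k ^+ m) ^+ 2)%:C =
      \sum_k \sum_l a k * (a l)^* * (z k * (z l)^*) ^+ m.
    rewrite -mul_conj (rmorph_sum conjc) mulr_suml; apply: eq_bigr => k _.
    rewrite mulr_sumr; apply: eq_bigr => l _.
    by rewrite rmorphM rmorphXn /= exprMn; ring.
  transitivity (\sum_(m < T) (\sum_k \sum_l a k * (a l)^* * (z k * (z l)^*) ^+ m) - T%:R * \sum_k (cn (a k) ^+ 2)%:C).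
    by congr (_ - _); apply: eq_bigr => m _; exact: E.
  rewrite exchange_big /= mulr_sumr -sumrB; apply: eq_bigr => k _.
  rewrite exchange_big (bigD1 k) //= mul_conj.
  have -> : \sum_(i < T) (cn (a k) ^+ 2)%:C * (z k * (z k)^*) ^+ i = T%:R * (cn (a k) ^+ 2)%:C.
    under eq_bigr do rewrite mul_conj z1 expr1n expr1n mulr1.
    by rewrite sumr_const card_ord -[LHS]mulr_natl.
  rewrite addrAC subrr add0r; apply: eq_bigr => l _.
  by rewrite mulr_sumr.
apply: (le_trans (cn_sum _ _ _)); apply: ler_sum => k _.
apply: (le_trans (cn_sum _ _ _)); apply: ler_sum => l lk.
rewrite cnM cnM cn_conj; apply: ler_pM; rewrite ?mulr_ge0 ?cn_ge0//.
  by apply: ler_pM; rewrite ?cn_ge0.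
apply: geometric_sum_bound; first by rewrite cnM cn_conj !z1 mulr1.
apply: contra lk => /eqP zz; apply/eqP; apply: zI.
by rewrite -[z l]mul1r -zz -mulrA -[(z l)^* * _]mulrC mul_conj z1 expr1n mulr1.
Qed.

(* Small enough for the samples [(k + 1)^(- i step)], [k < N], to be pairwise distinct. *)
Definition sampling_step (N : nat) : R := (1 + ln N%:R)^-1.

Lemma ln_nat_ge0 n : 0 <= ln (n%:R : R).
Proof.
by case: n => [|n]; [rewrite ln0|rewrite ln_ge0// ler1n].
Qed.

Lemma sampling_step_gt0 N : 0 < sampling_step N.
Proof. by rewrite invr_gt0 ltr_pwDl// ln_nat_ge0. Qed.

Lemma npow_opp_iM n (m : nat) (t : R) :
  npow_opp n (0 +i* (m%:R * t)) = npow_opp n (0 +i* t) ^+ m.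
Proof.
rewrite /npow_opp -cexpMn; congr cexp; rewrite -[RHS]mulr_natl -natrC.
by apply: complex_eqP; rewrite !ReE /=; ring.
Qed.

Lemma cn_npow_opp_im n (t : R) : cn (npow_opp n (0 +i* t)) = 1.
Proof. by rewrite cn_npow_opp /= oppr0 mul0r expR0. Qed.

(** The angles [sampling_step N * ln (k + 1)] lie in [[0, 1]], inside the interval [[0, pi]] where
    the cosine is injective, so the real parts already separate the samples. *)
Lemma npow_opp_sampling_inj N : injective (fun k : 'I_N => npow_opp k.+1 (0 +i* sampling_step N) : R[i]).
Proof.
move=> k l kl; have Rc (j : 'I_N) : Re (npow_opp j.+1 (0 +i* sampling_step N)) = cos (sampling_step N * ln j.+1%:R).
  rewrite /npow_opp Re_cexp !ReE /= -[RHS]cosN.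
  rewrite !(oppr0, mul0r, mulr0, subr0, expR0, mul1r, addr0, add0r).
  by congr cos; ring.
have itv (j : 'I_N) : sampling_step N * ln j.+1%:R \in `[0, pi].
  rewrite in_itv /=; apply/andP; split; first by rewrite mulr_ge0 ?ln_nat_ge0// ltW// sampling_step_gt0.
  apply: (@le_trans _ _ 1); last by rewrite (le_trans _ (pi_ge2 R))// ler1n.
  rewrite /sampling_step mulrC ler_pdivrMr ?mul1r ?ltr_pwDl ?ln_nat_ge0//.
  have N0 : (0 < N)%N by case: (N) j => // -[].
  have : ln j.+1%:R <= ln N%:R :> R by rewrite ler_ln ?posrE ?ltr0n// ler_nat ltn_ord.
  lra.
have := cos_inj (itv k) (itv l); rewrite -!Rc => /(_ (congr1 (fun z => Re z) kl)).
move/(mulfI (lt0r_neq0 (sampling_step_gt0 N)))/(@ln_inj R); rewrite !posrE !ltr0n => /(_ isT isT) /eqP.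
by rewrite eqr_nat eqSS => /eqP /ord_inj.
Qed.

Lemma npow_oppDi n (e t : R) :
  npow_opp n (e +i* t) = npow_opp n e%:C * npow_opp n (0 +i* t).
Proof. by rewrite -npow_oppD; congr npow_opp; apply: complex_eqP; rewrite /= ?addr0 ?add0r. Qed.

(** Sampling along an arithmetic progression takes the place of the mean over [t]. The constant is
    common to all [e >= 0] since [n^-e <= 1]. *)
Lemma mean_square_dirichlet (N : nat) (A : nat -> R) :
  exists C : R, forall a : nat -> R[i], (forall k, cn (a k) <= A k) -> forall (e : R) (T : nat), 0 <= e ->
    `|\sum_(m < T) cn (\sum_(k < N) a k * npow_opp k.+1 (e +i* (m%:R * sampling_step N))) ^+ 2 -
      T%:R * \sum_(k < N) (cn (a k) * expR (- e * ln k.+1%:R)) ^+ 2| <= C.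
Proof.
have [C HC] := @mean_square_bound N (fun k => npow_opp k.+1 (0 +i* sampling_step N)) (fun k => A k)
   (fun k => cn_npow_opp_im _ _) (@npow_opp_sampling_inj N).
exists C => a aA e T e0.
have := HC (fun k => a k * npow_opp k.+1 e%:C) _ T.
have -> : \sum_(k < N) (cn (a k) * expR (- e * ln k.+1%:R)) ^+ 2 = \sum_(k < N) cn (a k * npow_opp k.+1 e%:C) ^+ 2.
  by apply: eq_bigr => k _; rewrite cnM cn_npow_opp.
have -> : \sum_(m < T) cn (\sum_(k < N) a k * npow_opp k.+1 (e +i* (m%:R * sampling_step N))) ^+ 2 =
  \sum_(m < T) cn (\sum_(k < N) a k * npow_opp k.+1 e%:C * npow_opp k.+1 (0 +i* sampling_step N) ^+ m) ^+ 2.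
  apply: eq_bigr => m _; congr (cn _ ^+ 2); apply: eq_bigr => k _.
  by rewrite npow_oppDi npow_opp_iM mulrA.
apply => k; rewrite cnM cn_npow_opp /= -[leRHS]mulr1.
apply: ler_pM; rewrite ?cn_ge0 ?expR_ge0//.
by rewrite -[leRHS]expR0 ler_expR mulNr oppr_le0 mulr_ge0// ln_nat_ge0.
Qed.

Lemma bessel_dirichlet (N : nat) (a : nat -> R[i]) (e B : R) : 0 <= e ->
  (forall t, cn (\sum_(k < N) a k * npow_opp k.+1 (e +i* t)) <= B) ->
  \sum_(k < N) (cn (a k) * expR (- e * ln k.+1%:R)) ^+ 2 <= B ^+ 2.
Proof.
move=> e0 aB; have [C HC] := mean_square_dirichlet N (fun k => cn (a k)).
apply: (@le_of_nat_mul _ _ C) => T.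
have := HC a (fun=> lexx _) e T e0; rewrite ler_norml => /andP[+ _].
have : \sum_(m < T) cn (\sum_(k < N) a k * npow_opp k.+1 (e +i* (m%:R * sampling_step N))) ^+ 2 <= T%:R * B ^+ 2.
  rewrite mulr_natl -[X in _ *+ X]card_ord -sumr_const; apply: ler_sum => m _.
  by rewrite lerXn2r ?nnegrE ?cn_ge0// (le_trans _ (aB 0)) ?cn_ge0.
lra.
Qed.

Lemma bessel_coef (N : nat) (a : nat -> R[i]) (e B : R) : 0 <= e -> 0 <= B ->
  (forall t, cn (\sum_(k < N) a k * npow_opp k.+1 (e +i* t)) <= B) ->
  forall k, (k < N)%N -> cn (a k) * expR (- e * ln k.+1%:R) <= B.
Proof.
move=> e0 B0 aB k kN; have := bessel_dirichlet e0 aB.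
rewrite (bigD1 (Ordinal kN)) //= => H.
rewrite -(@ler_pXn2r _ 2) ?nnegrE ?mulr_ge0 ?cn_ge0 ?expR_ge0//.
by apply: le_trans H; rewrite lerDl sumr_ge0// => i _; rewrite sqr_ge0.
Qed.

End bessel.

(** * Bohr's proof of Kronecker's theorem *)

Section kronecker.
Variable R : realType.

(** The term of order [N + 1] of the series of [exp (k ln q)] is [k^N] times a factor that grows
    with [k]. *)
Lemma exists_expr_gt_poly (q : R) (N : nat) : 1 < q -> exists k : nat, k.+1%:R ^+ N < q ^+ k.
Proof.
move=> q1; pose L := ln q; have L0 : 0 < L by rewrite ln_gt0.
have qE : q = expR L by rewrite lnK// posrE; lra.
pose k := (Num.truncn (2 ^+ N * N.+1`!%:R / L ^+ N.+1)).+1; exists k.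
have kL : 2 ^+ N * N.+1`!%:R < k%:R * L ^+ N.+1 by rewrite -ltr_pdivrMr ?exprn_gt0// truncnS_gt.
have k1 : 1 <= k%:R :> R by rewrite ler1n.
have f0 : 0 < N.+1`!%:R :> R by rewrite ltr0n fact_gt0.
apply: (@le_lt_trans _ _ ((2 * k%:R) ^+ N)).
  rewrite lerXn2r ?nnegrE// -natr1; lra.
rewrite qE -expRM_natl.
apply: (lt_le_trans _ (expR_ge1Dxn N _)); last by rewrite mulr_ge0// ltW.
apply: ltr_wpDl => //; rewrite ltr_pdivlMr// !exprMn [k%:R ^+ N.+1]exprSr -mulrA.
have -> : 2 ^+ N * k%:R ^+ N * N.+1`!%:R = k%:R ^+ N * (2 ^+ N * N.+1`!%:R) :> R by ring.
by rewrite ltr_pM2l// exprn_gt0// ltr0n.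
Qed.

Variable chi : nat -> R[i].
Hypothesis chi1 : chi 1 = 1.
Hypothesis chiM : forall m n, (0 < m)%N -> (0 < n)%N -> chi (m * n) = chi m * chi n.
Hypothesis cn_chi : forall n, (0 < n)%N -> cn (chi n) = 1.

Lemma multiplicative_prod (I : finType) (f : I -> nat) :
  (\prod_i chi (f i).+1) = chi (\prod_i (f i).+1)%N.
Proof.
suff [] : (0 < \prod_i (f i).+1)%N /\ \prod_i chi (f i).+1 = chi (\prod_i (f i).+1)%N by [].
elim/big_ind2 : _ => [|m z n u [m0 ->] [n0 ->]|//]; first by rewrite chi1.
by rewrite muln_gt0 m0 n0 chiM.
Qed.

(* Bohr's argument: the k-th power of sum_n conj(chi n) n^-it has at most
   (k+1)^N frequencies, so by Cauchy-Schwarz its mean square is at least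
   N^2k / (k+1)^N. *)
Lemma twisted_sum_sup_ge (N : nat) (B : R) : (0 < N)%N -> 0 <= B ->
  (forall t, cn (\sum_(j < N) (chi j.+1)^* * npow_opp j.+1 (0 +i* t)) <= B) -> N%:R <= B.
Proof.
move=> N0 B0 HB; rewrite leNgt; apply/negP => BN.
have key k : (N%:R ^+ k) ^+ 2 <= (k.+1%:R : R) ^+ N * (B ^+ k) ^+ 2.
  pose n_ (f : {ffun 'I_k -> 'I_N}) := (\prod_i (f i).+1)%N.
  have n_gt0 f : (0 < n_ f)%N by rewrite prodn_gt0.
  have n_le f : (n_ f <= N ^ k)%N.
    by rewrite -[X in (N ^ X)%N]card_ord -prod_nat_const leq_prod.
  have Nk0 : (0 < N ^ k)%N by rewrite expn_gt0 N0.
  have pf f : ((n_ f).-1 < N ^ k)%N by rewrite prednK.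
  pose V f : 'I_(N ^ k) := Ordinal (pf f).
  (* [c v] is the number of [k]-tuples of factors with product [v + 1]; the shift by one is that of
     the coefficient sequences. *)
  pose c (v : 'I_(N ^ k)) : R := \sum_(f | V f == v) 1.
  have c0 v : 0 <= c v by apply: sumr_ge0.
  have FE t : (\sum_(j < N) (chi j.+1)^* * npow_opp j.+1 (0 +i* t)) ^+ k =
     \sum_(v < N ^ k) ((c v)%:C * (chi v.+1)^*) * npow_opp v.+1 (0 +i* t).
    rewrite -[in LHS](card_ord k) -prodr_const bigA_distr_bigA /=.
    rewrite (partition_big V xpredT) //=; apply: eq_bigr => v _.
    rewrite /c rmorph_sum !mulr_suml; apply: eq_bigr => f /eqP <-.
    rewrite mul1r /= prednK// big_split /= -rmorph_prod multiplicative_prod; congr (_ * _).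
    have := @npow_oppM R; move: (0 +i* t) => s nM.
    suff [] : (0 < \prod_i (f i).+1)%N /\ \prod_i npow_opp (f i).+1 s = npow_opp (\prod_i (f i).+1)%N s by [].
    elim/big_ind2 : _ => [|m z n u [m0 ->] [n0 ->]|//]; first by rewrite npow_opp1.
    by rewrite muln_gt0 m0 n0 nM.
  pose c' (n : nat) : R[i] := if insub n is Some v then (c v)%:C * (chi v.+1)^* else 0.
  have bes : \sum_(v < N ^ k) c v ^+ 2 <= (B ^+ k) ^+ 2.
    have := @bessel_dirichlet R (N ^ k) c' 0 (B ^+ k) (lexx _) _.
    have -> : \sum_(k0 < N ^ k) (cn (c' k0) * expR (- 0 * ln k0.+1%:R)) ^+ 2 = \sum_(v < N ^ k) c v ^+ 2.
      apply: eq_bigr => v _; rewrite /c' valK oppr0 mul0r expR0 mulr1 cnM cn_conj cn_chi// mulr1 cnR.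
      by rewrite ger0_norm.
    apply => t; under eq_bigr do rewrite /c' valK.
    by rewrite -FE cnX lerXn2r ?nnegrE ?cn_ge0.
  pose S := [set V f | f in {ffun 'I_k -> 'I_N}]%SET.
  (* The product [n_ f] depends only on how often each [j] is a value of [f], and these numbers form
     a map from ['I_N] to ['I_k.+1]. *)
  have Scard : (#|S| <= k.+1 ^ N)%N.
    have le_k (f : {ffun 'I_k -> 'I_N}) (j : 'I_N) : (#|[set i | f i == j]%SET| < k.+1)%N.
      by rewrite ltnS -[X in (_ <= X)%N](card_ord k) max_card.
    pose cnt (f : {ffun 'I_k -> 'I_N}) : {ffun 'I_N -> 'I_k.+1} := [ffun j => Ordinal (le_k f j)].
    have Vcnt f f' : cnt f = cnt f' -> V f = V f'.
      move=> ff'; apply: val_inj => /=; congr _.-1; rewrite /n_.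
      have nE g : (\prod_i (g i : 'I_N).+1)%N = (\prod_(j < N) j.+1 ^ #|[set i : 'I_k | g i == j]%SET|)%N.
        rewrite (partition_big g xpredT) //=; apply: eq_bigr => j _.
        by rewrite (eq_bigr (fun=> j.+1)) => [|i /eqP->//]; rewrite prod_nat_const cardsE.
      rewrite !nE; apply: eq_bigr => j _; congr (_ ^ _)%N.
      by move/ffunP/(_ j): ff'; rewrite !ffunE => /(congr1 val).
    have -> : S = [set (fun g => odflt (Ordinal Nk0) (omap V [pick f | cnt f == g])) g | g in [set cnt f | f in {ffun 'I_k -> 'I_N}]]%SET.
      apply/setP => v; apply/imsetP/imsetP => [[f _ ->]|[g /imsetP[f _ ->] ->]].
        exists (cnt f); first exact: imset_f.
        by case: pickP => /= [f' /eqP /Vcnt ->|/(_ f)]; rewrite ?eqxx.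
      by case: pickP => /= [f' _|/(_ f)]; [exists f'|rewrite eqxx].
    apply: (leq_trans (leq_imset_card _ _)); apply: (leq_trans (max_card _)).
    by rewrite card_ffun !card_ord.
  have sumc : \sum_(v in S) c v = N%:R ^+ k.
    rewrite /c (exchange_big_dep xpredT) //=.
    transitivity (\sum_(f : {ffun 'I_k -> 'I_N}) (1 : R)).
      apply: eq_bigr => f _; rewrite (big_pred1 (V f)) // => v /=.
      apply/andP/eqP => [[_ /eqP //]|->]; split => //; exact: imset_f.
    by rewrite sumr_const card_ffun !card_ord natrX.
  have sumc2 : \sum_(v in S) c v ^+ 2 <= \sum_(v < N ^ k) c v ^+ 2.
    rewrite [leRHS](bigID (mem S)) /= lerDl sumr_ge0// => v _; exact: sqr_ge0.
  (* The Cauchy-Schwarz inequality on [S], obtained by expanding the sum of the squares of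
     [#|S| c v - N^k]. *)
  have cs : (N%:R ^+ k) ^+ 2 <= #|S|%:R * \sum_(v in S) c v ^+ 2.
    have S0 : (0 < #|S|)%N by apply/card_gt0P; exists (V [ffun=> Ordinal N0]); exact: imset_f.
    have : 0 <= \sum_(v in S) (#|S|%:R * c v - N%:R ^+ k) ^+ 2 by apply: sumr_ge0 => v _; exact: sqr_ge0.
    under eq_bigr => v _ do rewrite sqrrB exprMn.
    rewrite big_split /= sumrB -mulr_sumr sumr_const.
    have -> : \sum_(i in S) #|S|%:R * c i * N%:R ^+ k *+ 2 = #|S|%:R * (N%:R ^+ k) ^+ 2 *+ 2.
      rewrite sumrMnl; congr (_ *+ 2).
      by under eq_bigr do rewrite mulrAC; rewrite -mulr_sumr sumc; ring.
    rewrite -mulr_natl => H; rewrite -(@ler_pM2l _ #|S|%:R) ?ltr0n//; lra.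
  apply: (le_trans cs); apply: ler_pM => //.
  - by apply: sumr_ge0 => v _; exact: sqr_ge0.
  - by rewrite -natrX ler_nat.
  - exact: le_trans sumc2 bes.
have [B0' |Bp] := eqVneq B 0.
  have := key 1%N; rewrite B0' !expr1 expr0n /= mulr0 leNgt exprn_gt0// ltr0n N0 //.
have B_gt0 : 0 < B by rewrite lt_def Bp.
have q1 : 1 < (N%:R / B) ^+ 2.
  by rewrite exprn_egt1// ltr_pdivlMr// mul1r.
have [k] := exists_expr_gt_poly N q1; apply/negP; rewrite -leNgt.
by rewrite -exprM mulnC exprM expr_div_n expr_div_n ler_pdivrMr ?exprn_gt0.
Qed.

(** By [twisted_sum_sup_ge] some [t] gives the sum of the [N] unit vectors [conj (chi n) n^(-i t)] a
    modulus close to [N]; then they are almost aligned, and the vector for [n = 1], equal to 1,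
    fixes the direction. *)
Lemma kronecker (N : nat) (d : R) : 0 < d ->
  exists t : R, forall n, (0 < n <= N)%N -> cn (npow_opp n (0 +i* t) - chi n) <= d.
Proof.
move=> d0; have [->|N0] := posnP N; first by exists 0 => -[].
(* [|1 + u| >= 2 - eta] will give [|u - 1|^2 <= 4 eta <= d^2]; [eta <= 1] keeps [N - eta]
   nonnegative. *)
pose eta := Num.min (d ^+ 2 / 4) 1.
have eta0 : 0 < eta by rewrite lt_min ltr01 divr_gt0// exprn_gt0.
have [t Ht] : exists t, N%:R - eta < cn (\sum_(j < N) (chi j.+1)^* * npow_opp j.+1 (0 +i* t)).
  apply/not_existsP => H.
  have := @twisted_sum_sup_ge N (N%:R - eta) N0 _ _.
  have N1 : 1 <= N%:R :> R by rewrite ler1n.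
  have : eta <= 1 by rewrite ge_min lexx orbT.
  move=> eta1 /(_ _ _) h; have : N%:R <= N%:R - eta; last by lra.
  apply: h; first by lra.
  by move=> t; rewrite leNgt; apply/negP; exact: H.
exists t => n /andP[n0 nN]; have [->|n1] := eqVneq n 1%N.
  by rewrite npow_opp1 chi1 subrr cn0 ltW.
pose u (n : nat) := (chi n)^* * npow_opp n (0 +i* t).
have u1 m : (0 < m)%N -> cn (u m) = 1.
  by move=> m0; rewrite cnM cn_conj cn_npow_opp_im cn_chi ?mulr1.
have -> : cn (npow_opp n (0 +i* t) - chi n) = cn (u n - 1).
  rewrite -[LHS]mul1r -(cn_chi n0) -cn_conj -cnM mulrBr -[(chi n)^* * chi n]mulrC mul_conj cn_chi//.
  by rewrite expr1n.
have n_ : (n.-1 < N)%N by rewrite prednK.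
have sum2 : cn (\sum_(j < N) u j.+1) <= cn (1 + u n) + (N%:R - 2).
  have n01 : Ordinal n_ != Ordinal N0 by rewrite -val_eqE /= -(eqn_add2r 1) !addn1 prednK.
  rewrite (bigD1 (Ordinal N0)) //= (bigD1 (Ordinal n_)) //= addrA prednK//.
  have -> : u 1%N = 1 by rewrite /u chi1 npow_opp1 mulr1 rmorph1.
  apply: (le_trans (cnD _ _)); rewrite lerD2l; apply: (le_trans (cn_sum _ _ _)).
  rewrite (eq_bigr (fun=> 1)) => [|i _]; last by rewrite u1.
  have : \sum_(i < N) (1 : R) = N%:R by rewrite sumr_const card_ord.
  rewrite (bigD1 (Ordinal N0)) //= (bigD1 (Ordinal n_)) //= => <-; lra.
have h1 : 2 - eta <= cn (1 + u n) by lra.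
have h2 : cn (u n - 1) ^+ 2 = 4 - cn (1 + u n) ^+ 2.
  have := cn_parallelogram (u n) 1; rewrite cn1 u1// expr1n; lra.
have eta1 : eta <= 1 by rewrite ge_min lexx orbT.
have eta2 : eta <= d ^+ 2 / 4 by rewrite ge_min lexx.
rewrite -(@ler_pXn2r _ 2) ?nnegrE ?cn_ge0 ?(ltW d0)// h2.
have : (2 - eta) ^+ 2 <= cn (1 + u n) ^+ 2 by rewrite lerXn2r ?nnegrE ?cn_ge0//; lra.
nra.
Qed.

End kronecker.

(** * Uniformly convergent families of Dirichlet series *)

Section uniform_dirichlet.
Variable R : realType.

Lemma dirichlet_partialE (a : nat -> R[i]) N (s : R[i]) :
  dirichlet_partial a N s = \sum_(k < N) a k * npow_opp k.+1 s.
Proof. by rewrite /dirichlet_partial /series /= big_mkord. Qed.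

Lemma npow_opp_real n (d : R) : npow_opp n d%:C = (expR (- d * ln n%:R))%:C.
Proof.
rewrite /npow_opp -rmorphN -rmorphM /=; apply: complex_eqP.
  by rewrite Re_cexp /= cos0 mulr1.
by rewrite Im_cexp /= sin0 mulr0.
Qed.

(** Prepares the Abel summation for the weights [ln n * n^-d]: with [p = n^(-d/2)] they are
    [-(2/d) p^2 ln p], a Lipschitz function of [p] on []0, 1]], so their increments are controlled
    by those of the monotone sequence [p]. *)
Lemma sqr_ln_lipschitz (p q : R) : 0 < q -> q <= p -> p <= 1 ->
  `|p ^+ 2 * ln p - q ^+ 2 * ln q| <= 3 * (p - q).
Proof.
move=> q0 qp p1; have p0 : 0 < p := lt_le_trans q0 qp.
have lnle (x : R) : 0 < x -> ln x <= x - 1.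
  by move=> x0; have := @le_ln1Dx R (x - 1); rewrite subrKC; apply; lra.
have -> : p ^+ 2 * ln p - q ^+ 2 * ln q = (p ^+ 2 - q ^+ 2) * ln p + q ^+ 2 * ln (p / q).
  by rewrite ln_div ?posrE//; ring.
have h1 : 0 <= ln (p / q) by rewrite ln_ge0// ler_pdivlMr// mul1r.
have h2 : q * ln (p / q) <= p - q.
  have := ler_wpM2l (ltW q0) (lnle _ (divr_gt0 p0 q0)).
  by rewrite mulrBr mulr1 mulrCA divff ?lt0r_neq0// mulr1.
have h3 : ln p <= 0 by rewrite ln_le0.
have h4 : - (p * ln p) <= 1.
  have := lnle p^-1; rewrite invr_gt0 lnV ?posrE// => /(_ p0).
  rewrite -(ler_pM2l p0) mulrBr mulfV ?gt_eqF//; lra.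
apply: (le_trans (ler_normD _ _)).
have -> : `|(p ^+ 2 - q ^+ 2) * ln p| = (p - q) * (p + q) * - ln p.
  rewrite normrM (ler0_norm h3) ger0_norm ?subr_sqr// mulr_ge0 ?subr_ge0//; lra.
have -> : `|q ^+ 2 * ln (p / q)| = q * (q * ln (p / q)).
  rewrite ger0_norm; last by rewrite mulr_ge0 ?sqr_ge0.
  by rewrite expr2 mulrA.
have h5 : q * (q * ln (p / q)) <= p - q.
  have : 0 <= q * ln (p / q) by rewrite mulr_ge0// ltW.
  nra.
have h6 : (p + q) * - ln p <= 2.
  have : 0 <= (p - q) * - ln p by rewrite mulr_ge0 ?subr_ge0 ?oppr_ge0.
  lra.
have : (p - q) * ((p + q) * - ln p) <= (p - q) * 2 by rewrite ler_wpM2l// subr_ge0.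
lra.
Qed.

(** The increments of [b] may change sign: they are dominated by those of [p], which telescope. *)
Lemma abel_summation_bound (U : nat -> R[i]) (b p : nat -> R) (k C : R) (N : nat) :
  U 0%N = 0 -> (forall n, cn (U n) <= k) -> 0 <= C ->
  (forall n, `|b n| <= C) -> (forall n, 0 <= p n <= 1) ->
  (forall n, `|b n.+1 - b n| <= C * (p n - p n.+1)) ->
  cn (\sum_(n < N) (U n.+1 - U n) * (b n)%:C) <= k * (2 * C).
Proof.
move=> U0 Uk C0 bC p01 bp; have k0 : 0 <= k by rewrite -cn0 -U0 (le_trans _ (Uk 0%N)).
have -> : \sum_(n < N) (U n.+1 - U n) * (b n)%:C =
    U N * (b N)%:C - \sum_(n < N) U n.+1 * (b n.+1 - b n)%:C.
  elim: N => [|N IH]; first by rewrite !big_ord0 U0 mul0r subr0.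
  by rewrite !big_ord_recr /= IH rmorphB /=; ring.
apply: (le_trans (cnB _ _)).
have h1 : cn (U N * (b N)%:C) <= k * C.
  by rewrite cnM cnR; apply: ler_pM; rewrite ?cn_ge0.
have h2 : cn (\sum_(n < N) U n.+1 * (b n.+1 - b n)%:C) <= k * (C * (p 0%N - p N)).
  apply: (le_trans (cn_sum _ _ _)).
  have -> : k * (C * (p 0%N - p N)) = \sum_(n < N) k * (C * (p n - p n.+1)).
    rewrite -!mulr_sumr; congr (_ * (_ * _)); elim: (N) => [|m IH]; first by rewrite big_ord0 subrr.
    by rewrite big_ord_recr /= -IH; ring.
  by apply: ler_sum => n _; rewrite cnM cnR; apply: ler_pM; rewrite ?cn_ge0.
have h3 : k * (C * (p 0%N - p N)) <= k * C.
  rewrite ler_wpM2l// ler_piMr//; have := p01 0%N; have := p01 N; lra.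
lra.
Qed.

Section family.
Variable I : Type.
Implicit Types (a : I -> nat -> R[i]) (s h : R[i]).

(** [N0] is common to all members of the family; with the characters as indices, the bounds derived
    from it are uniform in [chi]. *)
Definition unif_cauchy a := forall e k : R, 0 < e -> 0 < k -> exists N0, forall i N M s,
  (N0 <= N)%N -> (N0 <= M)%N -> e <= Re s ->
  cn (dirichlet_partial (a i) N s - dirichlet_partial (a i) M s) <= k.

Definition coef_bounded a := forall n, exists A : R, forall i, cn (a i n) <= A.

(* Coefficients of the [j]-th derivative. *)
Definition dcoef (j : nat) a i n : R[i] := (- (ln n.+1%:R)%:C) ^+ j * a i n.

Lemma coef_bounded_dcoef j a : coef_bounded a -> coef_bounded (dcoef j a).
Proof.
move=> aA n; have [A HA] := aA n; exists (ln n.+1%:R ^+ j * A) => i.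
rewrite cnM cnX cnN cnR ger0_norm ?ln_nat_ge0//.
by rewrite ler_wpM2l ?exprn_ge0 ?ln_nat_ge0.
Qed.

Lemma log_weight (d : R) (n : nat) : 0 < d ->
  let b (n : nat) := ln n.+1%:R * expR (- d * ln n.+1%:R) in
  let p (n : nat) := expR (- (d / 2) * ln n.+1%:R) in
  [/\ `|b n| <= 6 / d, 0 <= p n <= 1 & `|b n.+1 - b n| <= 6 / d * (p n - p n.+1)].
Proof.
move=> d0 b p.
have p0 m : 0 < p m by rewrite expR_gt0.
have p1 m : p m <= 1.
  by rewrite -[leRHS]expR0 ler_expR mulNr oppr_le0 mulr_ge0 ?ln_nat_ge0// divr_ge0// ltW.
have bE m : b m = - (2 / d) * (p m ^+ 2 * ln (p m)).
  rewrite /b /p expRK -expRM_natl.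
  have -> : 2%:R * (- (d / 2) * ln m.+1%:R) = - d * ln m.+1%:R :> R by field.
  by field; rewrite gt_eqF.
have pmono : p n.+1 <= p n.
  rewrite ler_expR !mulNr lerN2 ler_wpM2l ?divr_ge0 ?(ltW d0)//.
  by rewrite ler_ln ?posrE ?ltr0n// ler_nat.
have d2 : 0 <= 2 / d by rewrite divr_ge0// ltW.
split.
- rewrite bE normrM normrN (ger0_norm d2).
  have := sqr_ln_lipschitz (p0 n) (p1 n) (lexx 1); rewrite ln1 mulr0 sub0r normrN => H.
  have -> : 6 / d = 2 / d * 3 by field; rewrite gt_eqF.
  by rewrite ler_wpM2l// (le_trans H)//; have := p0 n; lra.
- by rewrite ltW ?p0 ?p1.
- rewrite !bE -mulrBr normrM normrN (ger0_norm d2) distrC.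
  have -> : 6 / d * (p n - p n.+1) = 2 / d * (3 * (p n - p n.+1)) by field; rewrite gt_eqF.
  by rewrite ler_wpM2l// sqr_ln_lipschitz.
Qed.

(** Half of the margin [e] is spent: moving [s] to the left by [d = e / 2] leaves the weight
    [ln n * n^-d], which Abel summation handles against the partial sums at [s - d]. *)
Lemma unif_cauchy_dcoef1 a : unif_cauchy a -> unif_cauchy (dcoef 1 a).
Proof.
move=> aU e k e0 k0; pose d := e / 2; have d0 : 0 < d by rewrite divr_gt0.
pose C := 6 / d; have C0 : 0 < C by rewrite divr_gt0.
have k'0 : 0 < k / (2 * C) by rewrite divr_gt0// mulr_gt0.
have [N0 HN0] := aU d _ d0 k'0; exists N0.
suff H i N M s : (N0 <= M)%N -> (M <= N)%N -> e <= Re s ->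
    cn (dirichlet_partial (dcoef 1 a i) N s - dirichlet_partial (dcoef 1 a i) M s) <= k.
  move=> i N M s nN nM es; have [MN|NM] := leqP M N; first exact: H.
  by rewrite cnBC; apply: H => //; exact: ltnW.
move=> nM MN es.
pose s' := s - d%:C.
have s'd : d <= Re s' by rewrite /s' !ReE /= /d; lra.
pose U n := dirichlet_partial (a i) (M + n)%N s' - dirichlet_partial (a i) M s'.
pose b (n : nat) := ln (M + n).+1%:R * expR (- d * ln (M + n).+1%:R).
pose p (n : nat) := expR (- (d / 2) * ln (M + n).+1%:R).
have -> : dirichlet_partial (dcoef 1 a i) N s - dirichlet_partial (dcoef 1 a i) M s =
   - \sum_(n < N - M) (U n.+1 - U n) * (b n)%:C.
  rewrite -[in LHS](subnKC MN); elim: (N - M)%N => [|n IH].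
    by rewrite addn0 subrr big_ord0 oppr0.
  rewrite big_ord_recr /= opprD -IH !dirichlet_partialE addnS big_ord_recr /= addrAC; congr (_ + _).
  rewrite /U !dirichlet_partialE addnS big_ord_recr /= /dcoef expr1.
  have -> : npow_opp (M + n).+1 s = npow_opp (M + n).+1 s' * (expR (- d * ln (M + n).+1%:R))%:C.
    rewrite -[in LHS](subrK d%:C s) npow_oppD; congr (_ * _).
    exact: npow_opp_real.
  by rewrite /b rmorphM /=; ring.
rewrite cnN.
have -> : k = k / (2 * C) * (2 * C) by rewrite divfK// mulf_neq0// gt_eqF.
apply: (@abel_summation_bound U b p) => //.
- by rewrite /U addn0 subrr.
- by move=> n; apply: HN0 => //; exact: leq_trans nM (leq_addr _ _).
- exact: ltW.
- by move=> n; have [] := log_weight (M + n) d0.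
- by move=> n; have [] := log_weight (M + n) d0.
- by move=> n; have [] := log_weight (M + n) d0; rewrite /b /p addnS.
Qed.

Lemma unif_cauchy_dcoef j a : unif_cauchy a -> unif_cauchy (dcoef j a).
Proof.
move=> aU; elim: j => [|j IH].
  by rewrite (_ : dcoef 0 a = a)//; apply/funext => i; apply/funext => n; rewrite /dcoef expr0 mul1r.
rewrite (_ : dcoef j.+1 a = dcoef 1 (dcoef j a)); first exact: unif_cauchy_dcoef1.
by apply/funext => i; apply/funext => n; rewrite /dcoef exprS expr1 mulrA.
Qed.

Lemma dirichlet_cvg a i s : unif_cauchy a -> 0 < Re s ->
  dirichlet_partial (a i) ^~ s @ \oo --> dirichlet (a i) s.
Proof.
move=> aU s0; apply: cauchyC => k k0; have [N0 HN0] := aU _ _ s0 k0.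
by exists N0 => n m n0 m0; exact: HN0.
Qed.

Lemma cn_lim_le (u : nat -> R[i]) (l : R[i]) (k : R) N0 : u @ \oo --> l ->
  (forall n, (N0 <= n)%N -> cn (u n) <= k) -> cn l <= k.
Proof.
move=> /cvgC ul uk; apply/ler_addgt0Pr => e /ul[N HN].
have nm := leq_maxl N N0; have nm0 := leq_maxr N N0.
have := cnD (l - u (maxn N N0)) (u (maxn N N0)); rewrite subrK.
have := HN _ nm; have := uk _ nm0; rewrite cnBC; lra.
Qed.

Lemma dirichlet_unif a (e k : R) : unif_cauchy a -> 0 < e -> 0 < k ->
  exists N0, forall i N s, (N0 <= N)%N -> e <= Re s ->
    cn (dirichlet_partial (a i) N s - dirichlet (a i) s) <= k.
Proof.
move=> aU e0 k0; have [N0 HN0] := aU _ _ e0 k0; exists N0 => i N s nN es.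
have cv := @dirichlet_cvg _ i _ aU (lt_le_trans e0 es).
apply: (@cn_lim_le (fun n => dirichlet_partial (a i) N s - dirichlet_partial (a i) n s) _ _ N0).
  move/cvgC : cv => cv; apply/cvgC => x /cv[n0 Hn0]; exists n0 => n nn.
  by have := Hn0 _ nn; rewrite -cnN; congr (cn _ <= _); ring.
by move=> n nn; exact: HN0.
Qed.

Lemma dirichlet_bounded a (e : R) : unif_cauchy a -> coef_bounded a -> 0 < e ->
  exists B : R, forall i s, e <= Re s ->
    (forall N, cn (dirichlet_partial (a i) N s) <= B) /\ cn (dirichlet (a i) s) <= B.
Proof.
move=> aU aA e0; have [N0 HN0] := aU _ _ e0 ltr01.
have /choice[A HA] := aA.
have A0 n (i : I) : 0 <= A n by rewrite (le_trans _ (HA n i))// cn_ge0.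
have part i N s : e <= Re s -> cn (dirichlet_partial (a i) N s) <= \sum_(n < N) A n.
  move=> es; rewrite dirichlet_partialE (le_trans (cn_sum _ _ _))//; apply: ler_sum => n _.
  rewrite cnM cn_npow_opp -[leRHS]mulr1; apply: ler_pM; rewrite ?cn_ge0 ?expR_ge0//.
  rewrite -[leRHS]expR0 ler_expR mulNr oppr_le0 mulr_ge0 ?ln_nat_ge0//; lra.
exists (\sum_(n < N0) A n + 1) => i s es.
have HB N : cn (dirichlet_partial (a i) N s) <= \sum_(n < N0) A n + 1.
  have [nN|/ltnW Nn] := leqP N0 N.
    have := HN0 i N N0 s nN (leqnn _) es; have := part i N0 s es.
    have := cn_lb (dirichlet_partial (a i) N s) (dirichlet_partial (a i) N0 s); lra.
  apply: (le_trans (part _ _ _ es)); rewrite -(subnKC Nn) big_split_ord /= -addrA lerDl.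
  by rewrite addr_ge0// sumr_ge0// => j _; exact: (A0 _ i).
split => //; apply: (@cn_lim_le _ _ _ 0%N (@dirichlet_cvg _ i _ aU (lt_le_trans e0 es))) => n _; exact: HB.
Qed.

(** Taylor's formula is applied to the partial sums, whose [k]-th derivatives are bounded
    independently of [N] on the segment from [s] to [s + h]; the limit is taken at the end. *)
Lemma dirichlet_taylor a (e : R) (k : nat) : unif_cauchy a -> coef_bounded a -> 0 < e ->
  exists C : R, forall i s h, e <= Re s -> e <= Re (s + h) ->
    cn (dirichlet (a i) (s + h) - \sum_(j < k) dirichlet (dcoef j a i) s * h ^+ j / j`!%:R)
      <= C * cn h ^+ k.
Proof.
move=> aU aA e0.
have [B HB] := @dirichlet_bounded _ e (unif_cauchy_dcoef k aU) (coef_bounded_dcoef k aA) e0.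
exists (2 ^+ k * B) => i s h es esh.
pose G N j (t : R) := dirichlet_partial (dcoef j a i) N (s + t%:C * h).
have dG N j t : cder (G N j) t (h * G N j.+1 t).
  rewrite /G; under eq_fun do rewrite dirichlet_partialE.
  rewrite dirichlet_partialE mulr_sumr; apply: cder_sum => n.
  have := cderZ (dcoef j a i n) (cder_cexp (- s * (ln n.+1%:R)%:C) (- h * (ln n.+1%:R)%:C) t).
  have E x : - s * (ln n.+1%:R)%:C + x%:C * (- h * (ln n.+1%:R)%:C) = - (s + x%:C * h) * (ln n.+1%:R)%:C by ring.
  under eq_fun do rewrite E; move/cder_eq; apply.
  by rewrite E /npow_opp /dcoef exprS; ring.
have HG N t : 0 <= t <= 1 -> cn (G N (0 + k)%N t) <= B.
  move=> t01; have est : e <= Re (s + t%:C * h).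
    move: esh; rewrite !ReE /= mul0r subr0; nra.
  by have [+ _] := HB i _ est; exact.
have H N := @taylor_cder R (G N) h B k (dG N) 0%N (HG N) 1 _.
have part N : cn (dirichlet_partial (a i) N (s + h) - \sum_(j < k) dirichlet_partial (dcoef j a i) N s * h ^+ j / j`!%:R) <= 2 ^+ k * B * cn h ^+ k.
  have h01 : 0 <= (1 : R) <= 1 by rewrite ler01 lexx.
  have := H h01 N; rewrite /G mul1r mul0r addr0.
  rewrite (_ : dcoef 0 a i = a i)//.
  by apply/funext => n; rewrite /dcoef expr0 mul1r.
have s0 := lt_le_trans e0 es; have sh0 := lt_le_trans e0 esh.
apply: (@cn_lim_le _ _ _ 0%N _ (fun n _ => part n)).
have c1 := @dirichlet_cvg _ i _ aU sh0.
have c2 j := @dirichlet_cvg _ i _ (unif_cauchy_dcoef j aU) s0.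
apply: cvgB; first exact: c1.
apply: cvg_big => [|j _]; first by move=> /= x; exact: add_continuous.
apply: cvgM; last exact: cvg_cst.
apply: cvgM; last exact: cvg_cst.
exact: c2.
Qed.

End family.

End uniform_dirichlet.

(** * Twisted symbols *)

Section characters.
Variable R : realType.
Implicit Types (chi : Tinf R) (t : R).

Lemma cn_circle (z : circle R) : cn (\val z : R[i]) = 1.
Proof. by have /= := set_valP z; rewrite normCE => -[]. Qed.

Definition mkcircle (z : R[i]) (z1 : cn z = 1) : circle R :=
  exist _ z (mem_set (congr1 (real_complex R) z1) : z \in [set z : R[i] | `|z| = 1]).

Lemma val_mkcircle z (z1 : cn z = 1) : \val (mkcircle z1) = z :> R[i].
Proof. by []. Qed.

Lemma circle_inj (z u : circle R) : \val z = \val u :> R[i] -> z = u.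
Proof. exact: val_inj. Qed.

Lemma multiplicative_ext (f g : nat -> R[i]) : f 1 = 1 -> g 1 = 1 ->
  (forall m n, (0 < m)%N -> (0 < n)%N -> f (m * n)%N = f m * f n) ->
  (forall m n, (0 < m)%N -> (0 < n)%N -> g (m * n)%N = g m * g n) ->
  (forall p, prime p -> f p = g p) -> forall n, (0 < n)%N -> f n = g n.
Proof.
move=> f1 g1 fM gM fg n; have [m] := ubnP n; elim: m n => // m IH n nm n0.
have [->|n1] := eqVneq n 1%N; first by rewrite f1 g1.
have n2 : (1 < n)%N by rewrite ltn_neqAle eq_sym n1.
have pp := pdiv_prime n2; have /dvdnP[k E] := pdiv_dvd n.
have k0 : (0 < k)%N by move: n0; rewrite E muln_gt0 => /andP[].
have p0 := prime_gt0 pp.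
have fgk : f k = g k.
  by apply: IH => //; rewrite -ltnS (leq_trans _ nm)// ltnS E ltn_Pmulr// prime_gt1.
by rewrite E fM// gM// fgk fg// -E.
Qed.

Lemma character1 chi : character chi 1 = 1.
Proof. by rewrite /character big_nil. Qed.

Lemma characterM chi m n : (0 < m)%N -> (0 < n)%N ->
  character chi (m * n) = character chi m * character chi n.
Proof.
move=> m0 n0; pose v p : R[i] := \val (chi (prime_index p)).
(* Each character is written over the primes of [m * n]; those that do not divide [k] get the
   exponent 0. *)
have ext k : (0 < k)%N -> (k %| m * n)%N -> character chi k = \prod_(p <- primes (m * n)) v p ^+ logn p k.
  move=> k0 kd; rewrite /character.
  rewrite [RHS](bigID (fun p => p \in primes k)) /= [X in _ * X]big1 ?mulr1; last first.
    move=> p; rewrite -logn_gt0 -eqn0Ngt => /eqP ->; exact: expr0.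
  rewrite -[LHS]/(\prod_(p <- primes k) v p ^+ logn p k) -[RHS]big_filter; apply: perm_big; apply: uniq_perm.
  - exact: primes_uniq.
  - by rewrite filter_uniq// primes_uniq.
  - move=> p; rewrite mem_filter; case: (boolP (p \in primes k)) => //=.
    rewrite !mem_primes => /and3P[-> _ pk]; rewrite muln_gt0 m0 n0 /=.
    by rewrite (dvdn_trans pk).
rewrite (ext (m * n)%N) ?muln_gt0 ?m0// (ext m) ?dvdn_mulr// (ext n) ?dvdn_mull//.
by rewrite -big_split; apply: eq_bigr => p _; rewrite lognM// exprD.
Qed.

Lemma character_prime chi p : prime p -> character chi p = \val (chi (prime_index p)).
Proof. by move=> pp; rewrite /character primes_prime// big_seq1 logn_prime// eqxx expr1. Qed.

Lemma cn_character chi n : cn (character chi n) = 1.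
Proof.
rewrite /character cn_prod big1// => p _.
by rewrite cnX cn_circle expr1n.
Qed.

Lemma prime_index_inj p q : prime p -> prime q -> prime_index p = prime_index q -> p = q.
Proof.
suff H a b : prime a -> (a < b)%N -> (prime_index a < prime_index b)%N.
  move=> pp pq E; case: (ltngtP p q) => // /H => [/(_ pp)|/(_ pq)]; by rewrite E ltnn.
move=> pa ab; rewrite /prime_index -(subnKC ab) iotaD count_cat.
apply: leq_trans (leq_addr _ _).
by rewrite -(addn1 a) iotaD count_cat add0n /= pa addn0 addn1.
Qed.

(** The Kronecker flow turns the coordinate of the prime [p] by [p^(-i t)]. The prime is recovered
    from its rank by choice, and 1 is a default value. *)
Definition flow_coord t (j : nat) : R[i] :=
  if pselect (exists p, prime p /\ prime_index p = j) is left h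
  then npow_opp (projT1 (cid h)) (0 +i* t) else 1.

Lemma cn_flow_coord t j : cn (flow_coord t j) = 1.
Proof. by rewrite /flow_coord; case: pselect => h; rewrite ?cn1// cn_npow_opp_im. Qed.

Lemma flow_coord_prime t p : prime p -> flow_coord t (prime_index p) = npow_opp p (0 +i* t).
Proof.
move=> pp; rewrite /flow_coord; case: pselect => h; last by exfalso; apply: h; exists p.
by case: (cid h) => q [qp] /= /(prime_index_inj qp pp) ->.
Qed.

Lemma cn_mulcircle (z : circle R) (u : R[i]) : cn u = 1 -> cn (\val z * u) = 1.
Proof. by move=> u1; rewrite cnM cn_circle u1 mulr1. Qed.

Definition rotate (al : nat -> R[i]) (al1 : forall j, cn (al j) = 1) chi : Tinf R :=
  fun j => mkcircle (cn_mulcircle (chi j) (al1 j)).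

Definition flow t chi : Tinf R := rotate (cn_flow_coord t) chi.

Lemma character_flow t chi n : (0 < n)%N ->
  character (flow t chi) n = character chi n * npow_opp n (0 +i* t).
Proof.
apply: (multiplicative_ext (f := character (flow t chi)) (g := fun n => character chi n * npow_opp n (0 +i* t))).
- exact: character1.
- by rewrite character1 npow_opp1 mulr1.
- exact: characterM.
- by move=> a b a0 b0; rewrite characterM// npow_oppM//; ring.
- by move=> p pp; rewrite !character_prime// val_mkcircle flow_coord_prime.
Qed.

Lemma dirichlet_flow (c : nat -> R[i]) t chi s :
  dirichlet (twist c (flow t chi)) s = dirichlet (twist c chi) (s + (0 +i* t)).
Proof.
rewrite /dirichlet; congr (lim (_ @ \oo)); apply/funext => N.
rewrite !dirichlet_partialE; apply: eq_bigr => k _.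
by rewrite /twist character_flow// npow_oppD; ring.
Qed.

(** Kronecker's theorem with precision [d / (K + 1)], where [K] is the sum of the moduli of the
    terms. One [t] serves all [M <= N], as differences of partial sums require. *)
Lemma kronecker_partial (c : nat -> R[i]) chi (N : nat) (s : R[i]) (d : R) : 0 < d ->
  exists t : R, forall M, (M <= N)%N ->
    cn (dirichlet_partial (twist c chi) M s - dirichlet_partial c M (s + (0 +i* t))) <= d.
Proof.
move=> d0; pose K := \sum_(k < N) cn (c k) * expR (- Re s * ln k.+1%:R).
have K0 : 0 <= K by apply: sumr_ge0 => k _; rewrite mulr_ge0 ?cn_ge0 ?expR_ge0.
have d'0 : 0 < d / (K + 1) by rewrite divr_gt0// ltr_wpDl.
have [t Ht] := kronecker (character1 chi) (characterM chi) (fun n _ => cn_character chi n) N d'0.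
exists t => M MN; rewrite !dirichlet_partialE -sumrB.
apply: (le_trans (cn_sum _ _ _)); apply: (@le_trans _ _ (K * (d / (K + 1)))); last first.
  by rewrite mulrCA ler_piMr ?(ltW d0)// ler_pdivrMr ?ltr_wpDl// mul1r lerDl.
apply: (@le_trans _ _ (\sum_(k < M) cn (c k) * expR (- Re s * ln k.+1%:R) * (d / (K + 1)))).
  apply: ler_sum => k _; rewrite /twist npow_oppD.
  have -> : c k * character chi k.+1 * npow_opp k.+1 s - c k * (npow_opp k.+1 s * npow_opp k.+1 (0 +i* t))
    = c k * npow_opp k.+1 s * (character chi k.+1 - npow_opp k.+1 (0 +i* t)) by ring.
  rewrite cnM cnM cn_npow_opp ler_wpM2l ?mulr_ge0 ?cn_ge0 ?expR_ge0// cnBC.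
  by apply: Ht; rewrite /= (leq_trans _ MN).
rewrite -mulr_suml ler_wpM2r ?(ltW d'0)//.
rewrite /K -(subnKC MN) big_split_ord /= lerDl sumr_ge0// => k _.
by rewrite mulr_ge0 ?cn_ge0 ?expR_ge0.
Qed.

End characters.

(** * Estimates for the twisted symbols, uniform in the character *)

Section symbols.
Variables (R : realType) (c0 : nat) (c : nat -> R[i]).
Hypothesis hpsi : G_ge1 c0 c.

Lemma dirichlet_partial_unif (e k : R) : 0 < e -> 0 < k -> exists N0, forall N s, (N0 <= N)%N -> e < Re s ->
  cn (dirichlet c s - dirichlet_partial c N s) <= k.
Proof.
move=> e0 k0; have := G_ge1_unif hpsi e0.
have kC : 0 < k%:C by rewrite ltcR.
move=> /(_ [set h | forall s, half_plane e s -> ball (dirichlet c s) k%:C (h s)]) [].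
  apply/uniform_nbhs; exists [set xy | ball xy.1 k%:C xy.2]; split => //.
  exact: (entourage_ball _ (PosNum kC)).
move=> N0 _ HN0; exists N0 => N s nN es; have := HN0 N nN s es.
by rewrite -ball_normE /ball_ /= normCE ltcR => /ltW.
Qed.

(** Both partial sums are compared with those of [c] at [s + i t], a point with the same real part,
    so a threshold for [c] works for every [chi]. The half-planes of [G_ge1] are open, hence
    [e / 2]. *)
Lemma unif_cauchy_twist : unif_cauchy (twist c : Tinf R -> nat -> R[i]).
Proof.
move=> e k e0 k0; have e20 : 0 < e / 2 by rewrite divr_gt0.
have k20 : 0 < k / 2 by rewrite divr_gt0.
have [N0 HN0] := dirichlet_partial_unif e20 k20; exists N0 => chi N M s nN nM es.
apply/ler_addgt0Pr => d d0; have d20 : 0 < d / 2 by rewrite divr_gt0.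
have [t Ht] := kronecker_partial c chi (maxn N M) s d20.
have es' : e / 2 < Re (s + (0 +i* t)) by rewrite ReE /=; lra.
have h1 := Ht _ (leq_maxl N M); have h2 := Ht _ (leq_maxr N M).
have h3 := HN0 _ _ nN es'; have h4 := HN0 _ _ nM es'.
set A := dirichlet_partial _ N s in h1 *; set B := dirichlet_partial _ M s in h2 *.
set A' := dirichlet_partial c N _ in h1 h3 *; set B' := dirichlet_partial c M _ in h2 h4 *.
set D := dirichlet c _ in h3 h4.
have q1 := cn_trans A' A B; have q2 := cn_trans D A' B; have q3 := cn_trans B' D B.
rewrite cnBC in h3; rewrite cnBC in h2; lra.
Qed.

Lemma coef_bounded_twist : coef_bounded (twist c : Tinf R -> nat -> R[i]).
Proof. by move=> n; exists (cn (c n)) => chi; rewrite /twist cnM cn_character mulr1. Qed.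

Lemma Re_dirichlet_ge0 s : 0 < Re s -> 0 <= Re (dirichlet c s).
Proof.
move=> s0; have [H|[tau H]] := G_ge1_range hpsi; last by rewrite H.
by have /ltW := H s s0.
Qed.

Lemma Re_twist_ge0 (chi : Tinf R) s : 0 < Re s -> 0 <= Re (dirichlet (twist c chi) s).
Proof.
move=> s0; set D := dirichlet (twist c chi) s; rewrite leNgt; apply/negP => neg.
(* Three approximations within [d] each cannot bring [Re D = - 4 d] up to a nonnegative number. *)
pose d := - Re D / 4.
have d0 : 0 < d by rewrite divr_gt0// oppr_gt0.
have s20 : 0 < Re s / 2 by rewrite divr_gt0.
have [N1 HN1] := dirichlet_unif unif_cauchy_twist s0 d0.
have [N2 HN2] := dirichlet_partial_unif s20 d0.
pose N := maxn N1 N2.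
have h1 := HN1 chi N s (leq_maxl _ _) (lexx _).
have [t Ht] := kronecker_partial c chi N s d0.
have h2 := Ht N (leqnn _).
have es' : Re s / 2 < Re (s + (0 +i* t)) by rewrite ReE /=; lra.
have h3 := HN2 N _ (leq_maxr _ _) es'.
have h4 : 0 <= Re (dirichlet c (s + (0 +i* t))) by apply: Re_dirichlet_ge0; lra.
rewrite -/D in h1.
set A := dirichlet_partial _ N s in h1 h2 *; set A' := dirichlet_partial c N _ in h2 h3 *.
set D' := dirichlet c _ in h3 h4.
have g1 := Re_le_cn (A - D); have g2 := Re_le_cn (A' - A); have g3 := Re_le_cn (D' - A').
rewrite cnBC in g2; rewrite !ReE in g1 g2 g3.
rewrite /d in h1 h2 h3; lra.
Qed.

Lemma Re_symbol_ge (chi : Tinf R) s : 0 < Re s -> Re s <= Re (symbol_fun c0 (twist c chi) s).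
Proof.
move=> s0; rewrite /symbol_fun ReE ReM Re_nat Im_nat mul0r subr0.
have := Re_twist_ge0 chi s0; have : 1 <= c0%:R :> R by rewrite ler1n (G_ge1_c0 hpsi).
nra.
Qed.

Lemma dcoef_dcoef (I : Type) (a : I -> nat -> R[i]) i j : dcoef i (dcoef j a) = dcoef (i + j) a.
Proof. by apply/funext => x; apply/funext => n; rewrite /dcoef mulrA exprD. Qed.

Lemma dcoef0 (I : Type) (a : I -> nat -> R[i]) : dcoef 0 a = a.
Proof. by apply/funext => x; apply/funext => n; rewrite /dcoef expr0 mul1r. Qed.

Lemma jet3_symbol (chi : Tinf R) s : 0 < Re s -> jet3 (symbol_fun c0 (twist c chi)) s.
Proof.
move=> s0; have s20 : 0 < Re s / 2 by rewrite divr_gt0.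
have [C HC] := dirichlet_taylor 3 unif_cauchy_twist coef_bounded_twist s20.
apply: jet3D; first by apply: jet3M; [exact: jet3_cst|exact: jet3_id].
apply: (@jet3_est _ _ _ (dirichlet (dcoef 1 (twist c) chi) s) (dirichlet (dcoef 2 (twist c) chi) s / 2) C (Re s / 2)) => //.
move=> h hs; have hR := ler_Re h; rewrite ler_norml in hR; move/andP: hR => [hR _].
have e1 : Re s / 2 <= Re s by lra.
have e2 : Re s / 2 <= Re (s + h) by rewrite ReE; lra.
have := HC chi s h e1 e2.
rewrite !big_ord_recl big_ord0 /bump /= dcoef0 expr0 !expr1 !divr1 mulr1 addr0.
by rewrite addrA (mulrAC _ (h ^+ 2)).
Qed.

Definition symbol_derive (w : R[i]) (chi : Tinf R) (j : nat) s : R[i] :=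
  dirichlet (dcoef j (twist c) chi) s +
  (if j == 0%N then c0%:R * s - w else if j == 1%N then c0%:R else 0).

Lemma derive1_quadratic (f : R[i] -> R[i]) (s d : R[i]) (C r : R) : 0 < r ->
  (forall h, cn h < r -> cn (f (s + h) - f s - d * h) <= C * cn h ^+ 2) -> derive1 f s = d.
Proof.
move=> r0 Hf; apply: cvg_lim; first exact: norm_hausdorff.
move=> A /nbhsC[e e0 eA].
have r'0 : 0 < Num.min r (e / (`|C| + 1)) by rewrite lt_min r0 divr_gt0// ltr_wpDl.
have : nbhs (0 : R[i]) [set h | cn h < Num.min r (e / (`|C| + 1))].
  by apply/nbhsC; exists (Num.min r (e / (`|C| + 1))) => // u; rewrite subr0.
apply: filterS => h; rewrite /= lt_min => /andP[hr he] h0; apply: eA.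
have ch0 : 0 < cn h by rewrite cn_gt0.
have -> : h^-1 *: (f (h + s) - f s) - d = h^-1 * (f (s + h) - f s - d * h).
  by rewrite mulrBr [d * h]mulrC mulKf// addrC [h + s]addrC addrC.
rewrite cnM cnV ltr_pdivrMl//; apply: (le_lt_trans (Hf _ hr)).
rewrite expr2 mulrA [ltRHS]mulrC ltr_pM2r//.
rewrite ltr_pdivlMr ?ltr_wpDl// in he.
apply: le_lt_trans he; rewrite mulrC ler_wpM2l ?(ltW ch0)//.
by rewrite (le_trans (ler_norm _))// lerDl.
Qed.

(** Connects [order_of_zero] with the termwise derivatives: the second-order Taylor bound of each of
    them shows that the next one is its derivative. *)
Lemma derive1n_symbol (w : R[i]) (chi : Tinf R) (j : nat) s : 0 < Re s ->
  derive1n j (fun z => symbol_fun c0 (twist c chi) z - w) s = symbol_derive w chi j s.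
Proof.
elim: j s => [|j IH] s s0.
  by rewrite derive1n0 /symbol_derive /= dcoef0 /symbol_fun; ring.
rewrite derive1nS; have s20 : 0 < Re s / 2 by rewrite divr_gt0.
have [C HC] := dirichlet_taylor 2 (unif_cauchy_dcoef j unif_cauchy_twist) (coef_bounded_dcoef j coef_bounded_twist) s20.
apply: (@derive1_quadratic _ _ _ C (Re s / 2)) => // h hs.
have hR := ler_Re h; rewrite ler_norml in hR; move/andP: hR => [hR _].
have e1 : Re s / 2 <= Re s by lra.
have e2 : Re s / 2 <= Re (s + h) by rewrite ReE; lra.
rewrite !IH//; last by rewrite (lt_le_trans _ e2).
have := HC chi s h e1 e2.
rewrite !big_ord_recl big_ord0 /bump /= dcoef0 dcoef_dcoef add1n expr0 expr1 !divr1 mulr1 addr0.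
congr (cn _ <= _); rewrite /symbol_derive; case: j {IH HC} => [|[|j]] /=; ring.
Qed.

Lemma symbol_order (w : R[i]) (chi : Tinf R) (k : nat) s : 0 < Re s -> (0 < k)%N ->
  (forall j, (j < k)%N -> derive1n j (fun z => symbol_fun c0 (twist c chi) z - w) s = 0) ->
  exists C r : R, 0 < r /\ forall h, cn h < r ->
    cn (symbol_fun c0 (twist c chi) (s + h) - w) <= C * cn h ^+ k.
Proof.
move=> s0 k0 Hk; have s20 : 0 < Re s / 2 by rewrite divr_gt0.
have [C HC] := dirichlet_taylor k unif_cauchy_twist coef_bounded_twist s20.
(* For [k = 1] the linear term [c0 * h] is not cancelled and goes into the constant. *)
exists (C + c0%:R), (Re s / 2); split => // h hs.
have hR := ler_Re h; rewrite ler_norml in hR; move/andP: hR => [hR _].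
have e1 : Re s / 2 <= Re s by lra.
have e2 : Re s / 2 <= Re (s + h) by rewrite ReE; lra.
have := HC chi s h e1 e2.
have D0 j : (j < k)%N -> dirichlet (dcoef j (twist c) chi) s = - (if j == 0%N then c0%:R * s - w else if j == 1%N then c0%:R else 0).
  by move=> jk; apply/eqP; rewrite -subr_eq0 opprK; apply/eqP; rewrite -[LHS]/(symbol_derive w chi j s) -derive1n_symbol// Hk.
case: k k0 Hk HC D0 => // -[|k] _ Hk HC D0.
  rewrite big_ord1 D0//= expr0 expr1 divr1 mulr1 => H.
  have -> : symbol_fun c0 (twist c chi) (s + h) - w =
    dirichlet (twist c chi) (s + h) - - (c0%:R * s - w) + c0%:R * h by rewrite /symbol_fun; ring.
  apply: (le_trans (cnD _ _)); rewrite mulrDl lerD// cnM cn_nat//.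
have -> : \sum_(j < k.+2) dirichlet (dcoef j (twist c) chi) s * h ^+ j / j`!%:R = - (c0%:R * s - w) - c0%:R * h.
  rewrite !big_ord_recl /= !D0//= /bump /= expr0 expr1 !divr1 mulr1 big1 ?addr0 ?mulNr// => i _.
  by rewrite D0/= ?oppr0 ?mul0r// !ltnS ltn_ord.
have -> : dirichlet (twist c chi) (s + h) - (- (c0%:R * s - w) - c0%:R * h) = symbol_fun c0 (twist c chi) (s + h) - w.
  by rewrite /symbol_fun; ring.
move=> H; apply: (le_trans H); rewrite ler_wpM2r ?exprn_ge0 ?cn_ge0// lerDl//.
Qed.

End symbols.

(** * The Kronecker flow preserves the Haar measure *)

Section circle_rotation.
Variable R : realType.
Implicit Types (t th : R).

Lemma open_circleP (U : set (circle R)) :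
  open U <-> exists2 V : set R[i], open V & U = [set z | V (\val z)].
Proof. by split=> [[V oV <-]|[V oV ->]]; exists V. Qed.

Lemma openCP (V : set R[i]) :
  open V <-> forall z, V z -> exists2 r : R, 0 < r & forall u, cn (u - z) < r -> V u.
Proof.
rewrite openE; split=> H z Vz; first exact/nbhsC/(H z Vz).
by apply/nbhsC/(H z Vz).
Qed.

Lemma cn_unit_exp t : cn (cexp (0 +i* (2 * pi * t))) = 1.
Proof. by rewrite cn_cexp /= expR0. Qed.

Definition unit_exp t : circle R := mkcircle (cn_unit_exp t).

Lemma unit_exp1 t : unit_exp (t + 1) = unit_exp t.
Proof.
apply: circle_inj; rewrite !val_mkcircle; apply/complex_eqP.
  by rewrite !Re_cexp /= mulrDr mulr1 cosD mulr_natl cos2pi sin2pi !mulr0 subr0 mulr1.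
by rewrite !Im_cexp /= mulrDr mulr1 sinD mulr_natl cos2pi sin2pi !mulr0 addr0 mulr1.
Qed.

Lemma near_continuous (f : R -> R) t (r : R) : continuous f -> 0 < r ->
  exists2 d, 0 < d & forall u, `|u - t| < d -> `|f u - f t| < r.
Proof.
move=> cf r0; have /cvgrPdist_lt/(_ r r0) := cf t.
rewrite near_simpl => /nbhs_ballP[d /= d0 H]; exists d => // u ud.
by rewrite distrC; apply: H; rewrite /ball /= distrC.
Qed.

Lemma unit_exp_preimage_open (U : set (circle R)) : open U -> open (unit_exp @^-1` U).
Proof.
move=> /open_circleP[V /openCP oV ->]; rewrite openE => t /= Vt.
have [r r0 H] := oV _ Vt.
have [|d1 d10 H1] := @near_continuous (fun t => cos (2 * pi * t)) t (r / 2) _ (divr_gt0 r0 (ltr0Sn _ 1)).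
  move=> x; apply: continuous_comp; last exact: continuous_cos.
  exact: mulrl_continuous.
have [|d2 d20 H2] := @near_continuous (fun t => sin (2 * pi * t)) t (r / 2) _ (divr_gt0 r0 (ltr0Sn _ 1)).
  move=> x; apply: continuous_comp; last exact: continuous_sin.
  exact: mulrl_continuous.
apply/nbhs_ballP; exists (Num.min d1 d2) => /=; first by rewrite lt_min d10.
move=> u; rewrite /ball /= distrC lt_min => /andP[/H1 h1 /H2 h2].
apply: H; apply: (le_lt_trans (cn_le_ReIm _)).
rewrite ReD ImD ReN ImN [ltRHS]splitr !Re_cexp !Im_cexp /= expR0 !mul1r.
exact: ltrD.
Qed.

Lemma measurable_unit_exp (A : set (circle R)) :
  <<s @open (circle R) >> A -> measurable (unit_exp @^-1` A : set R).
Proof.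
move=> mA.
have mf : @measurable_fun _ _ (measurableTypeR R) (g_sigma_algebraType (@open (circle R))) setT unit_exp.
  apply: (@measurability _ _ (measurableTypeR R) (g_sigma_algebraType (@open (circle R))) setT unit_exp (@open (circle R))) => // _ [U oU <-]; rewrite setTI.
  apply: measurable_realfun.open_measurable; exact: unit_exp_preimage_open.
by have := mf measurableT A mA; rewrite setTI.
Qed.

Lemma circle_measureE (A : set (circle R)) :
  circle_measure A = lebesgue_measure (`[0, 1] `&` unit_exp @^-1` A).
Proof.
congr lebesgue_measure; congr (_ `&` _); apply/seteqP; split=> t /=.
  by move=> [z Az e]; rewrite (_ : unit_exp t = z)//; apply: circle_inj; rewrite val_mkcircle.
by move=> At; exists (unit_exp t).
Qed.

Lemma lebesgue_measure_translation (A : set R) th : measurable A ->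
  lebesgue_measure ((fun x => x + th) @^-1` A) = lebesgue_measure A.
Proof.
move=> mA; rewrite -[LHS]/(pushforward lebesgue_measure ((fun x => x + th) : _ -> measurableTypeR R) A).
have mf : @measurable_fun _ _ R (measurableTypeR R) setT (fun x => x + th).
  exact: measurable_realfun.measurable_funD.
apply/esym/(lebesgue_measure_unique (mu := [the measure _ _ of pushforward lebesgue_measure ((fun x => x + th) : _ -> measurableTypeR R)])) => //=.
move=> _ [[a b]] _ <-; rewrite /pushforward.
have -> : (fun x => x + th) @^-1` `]a, b]%classic = `]a - th, b - th]%classic.
  by apply/seteqP; split=> x; rewrite /= !in_itv /= ltrBlDr lerBrDr.
rewrite !lebesgue_measure_itv/= !lte_fin ltrD2r; case: ifP => // _.
by rewrite -!EFinB; congr (_%:E); ring.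
Qed.

Lemma lebesgue_measureU (X Y : set R) : measurable X -> measurable Y -> X `&` Y = set0 ->
  lebesgue_measure (X `|` Y) = adde (lebesgue_measure X) (lebesgue_measure Y).
Proof. by move=> mX mY XY; rewrite measureU. Qed.

(** [circle_measure] is written with a closed interval, while the rotation argument cuts and
    reassembles half-open ones. *)
Lemma lebesgue_measure_itvcc (X : set R) : measurable X ->
  lebesgue_measure (`[0, 1] `&` X) = lebesgue_measure (`]0, 1] `&` X).
Proof.
move=> mX; have -> : `[0, 1]%classic = [set 0] `|` `]0, 1]%classic :> set R.
  apply/seteqP; split=> t /=; rewrite !in_itv /=.
    by move=> /andP[t0 ->]; move: t0; rewrite andbT le_eqVlt => /orP[/eqP|]; [left|right].
  by move=> [->|/andP[/ltW -> ->]//]; rewrite lexx ler01.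
rewrite setIUl lebesgue_measureU.
- suff -> : lebesgue_measure ([set 0] `&` X) = 0%E by rewrite [LHS]add0e.
  apply/eqP; rewrite -measure_le0 -(lebesgue_measure_set1 (0 : R)).
  by apply: le_measure; rewrite ?inE//; exact: measurableI.
- exact: measurableI.
- exact: measurableI.
- by apply/seteqP; split=> t //= [[-> _] []]; rewrite in_itv /= ltxx.
Qed.

(** The preimage [B] of the set under the angle map is 1-periodic. Translation carries []0, 1]] to
    []th, 1 + th]], and the part beyond 1 is moved back by 1 onto []0, th]]. *)
Lemma circle_measure_rotation (A : set (circle R)) th (u : R[i]) (u1 : cn u = 1) :
  <<s @open (circle R) >> A -> u = cexp (0 +i* (2 * pi * th)) ->
  circle_measure [set z : circle R | A (mkcircle (cn_mulcircle z u1))] = circle_measure A.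
Proof.
move=> /measurable_unit_exp; rewrite !circle_measureE; set B := _ @^-1` A => mB ue.
have -> : unit_exp @^-1` [set z | A (mkcircle (cn_mulcircle z u1))] = (fun x => x + th) @^-1` B.
  apply/seteqP; split=> t /=; rewrite /B /=; congr A; apply: circle_inj; rewrite !val_mkcircle /=.
    by rewrite ue -cexpD; congr cexp; apply/complex_eqP => /=; ring.
  by rewrite ue -cexpD; congr cexp; apply/complex_eqP => /=; ring.
have perN (k : nat) t : B (t + k%:R) <-> B t.
  elim: k => [|k IH]; first by rewrite addr0.
  by rewrite -natr1 addrA; rewrite /B /= unit_exp1.
have per (k : int) t : B (t + k%:~R) <-> B t.
  case: k => k; first exact: perN.
  by rewrite NegzE mulrNz -(perN k.+1 (t - _)) subrK.
(* By periodicity only the fractional part of [th] matters. *)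
wlog th01 : th {ue} / 0 <= th < 1.
  move=> H; have t01 : 0 <= th - (Num.floor th)%:~R < 1.
    by rewrite subr_ge0 ltrBlDr addrC Num.Theory.floor_le /= -[X in _ + X]/(1%:~R) -intrD Num.Theory.floorD1_gt.
  rewrite -(H _ t01); congr lebesgue_measure; congr (_ `&` _).
  by apply/seteqP; split=> t /=; rewrite addrA -mulrNz per.
have [th0 th1] := andP th01.
have mBt x (S : set R) : measurable S -> measurable ((fun t => t + x) @^-1` S).
  move=> mS.
  have mf : @measurable_fun _ _ R (measurableTypeR R) setT (fun t => t + x).
    exact: measurable_realfun.measurable_funD.
  by have := mf measurableT S mS; rewrite setTI.
rewrite lebesgue_measure_itvcc ?lebesgue_measure_itvcc//; last exact: mBt.
have E1 : lebesgue_measure (`]0, 1] `&` (fun t : R => t + th) @^-1` B) =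
  adde (lebesgue_measure (`]th, 1] `&` B)) (lebesgue_measure (`]0, th] `&` B)).
  rewrite -(lebesgue_measure_translation th (measurableI _ _ (measurable_itv `]th, 1]%R) mB)).
  rewrite -(lebesgue_measure_translation (th - 1) (measurableI _ _ (measurable_itv `]0%R, th]) mB)).
  rewrite -lebesgue_measureU.
  - congr lebesgue_measure; apply/seteqP; split=> t /=; rewrite !in_itv /=.
      move=> [/andP[t0 t1] Bt]; have [tt|tt] := lerP (t + th) 1; [left|right].
        by split => //; rewrite andbT ltrDr.
      split; first by apply/andP; split; lra.
      by rewrite addrA -[- 1]/((-1)%:~R) per.
    move=> [[/andP[a b] Bt]|[/andP[a b]]].
      by split => //; apply/andP; split; lra.
    rewrite addrA -[- 1]/((-1)%:~R) per => Bt; split => //.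
    by apply/andP; split; lra.
  - by apply: mBt; exact: measurableI.
  - by apply: mBt; exact: measurableI.
  - by apply/seteqP; split=> t //=; rewrite !in_itv /= => -[[/andP[a b] _] [/andP[e f] _]]; lra.
rewrite E1 [LHS]addeC -[LHS]lebesgue_measureU.
- rewrite -setIUl; congr (lebesgue_measure (_ `&` _)).
  apply/seteqP; split=> t /=; rewrite !in_itv /=.
    by move=> [/andP[a b]|/andP[a b]]; apply/andP; split; lra.
  by move=> /andP[a b]; have [tt|tt] := lerP t th; [left|right]; apply/andP; split => //; lra.
- exact: measurableI.
- exact: measurableI.
- by apply/seteqP; split=> t //=; rewrite !in_itv /= => -[[/andP[a b] _] [/andP[e f] _]]; lra.
Qed.

End circle_rotation.

(** * Measurability and invariance on the infinite torus *)

Section torus.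
Variable R : realType.
Local Notation circleM := (g_sigma_algebraType (@open (circle R))).

(* Functions of [chi] are measured with respect to the sigma-algebra of the cylinders, on which the
   measure is determined by its defining property. *)
Definition cylinder : set (set (Tinf R)) := [set X | exists (n : nat) (A : nat -> set (circle R)),
  (forall j, <<s @open (circle R) >> (A j)) /\ X = [set chi | forall j, (j < n)%N -> A j (chi j)]].

Local Notation Tcyl := (g_sigma_algebraType cylinder).

Lemma measurable_coord j (A : set (circle R)) :
  <<s @open (circle R) >> A -> measurable [set chi : Tinf R | A (chi j)].
Proof.
move=> mA.
have mf : @measurable_fun _ _ (Tinf R) circleM setT (fun chi => chi j).
  apply: (@measurability _ _ (Tinf R) circleM setT (fun chi => chi j) (@open (circle R))) => // _ [U oU <-].
  rewrite setTI; apply: sub_sigma_algebra.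
  suff : open ((fun chi : {ptws nat -> circle R} => chi j) @^-1` U) by [].
  rewrite openE => chi Uchi.
  by apply: (@proj_continuous nat (fun=> circle R) j chi U); exact: open_nbhs_nbhs.
by have := mf measurableT A mA; rewrite setTI.
Qed.

Lemma cylinder_measurable : cylinder `<=` (@measurable _ (Tinf R)).
Proof.
move=> _ [n [A [mA ->]]].
have -> : [set chi : Tinf R | forall j, (j < n)%N -> A j (chi j)] =
  \bigcap_(j in `I_n) [set chi | A j (chi j)] by [].
by apply: bigcap_measurableType => j _; exact: measurable_coord.
Qed.

Lemma cylinder_setI : setI_closed cylinder.
Proof.
move=> _ _ [n [A [mA ->]]] [n' [A' [mA' ->]]].
pose B k (C : nat -> set (circle R)) j := if (j < k)%N then C j else setT.
have mB k C : (forall j, <<s @open (circle R) >> (C j)) -> forall j, <<s @open (circle R) >> (B k C j).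
  by move=> mC j; rewrite /B; case: ifP => // _; exact: (@measurableT _ circleM).
exists (maxn n n'), (fun j => B n A j `&` B n' A' j); split.
  by move=> j; apply: (@measurableI _ circleM); exact: mB.
apply/seteqP; split=> chi /=.
  move=> [H H'] j _; split; rewrite /B; case: ifP => //; [exact: H|exact: H'].
move=> H; split=> j jn.
  by have [] := H j (leq_trans jn (leq_maxl _ _)); rewrite /B jn.
by have [] := H j (leq_trans jn (leq_maxr _ _)); rewrite /B jn.
Qed.

Lemma cylinderT : cylinder setT.
Proof.
exists 0%N, (fun=> setT); split; first by move=> j; exact: (@measurableT _ circleM).
by apply/seteqP; split.
Qed.

Lemma measurable_mulcircle (u : R[i]) (u1 : cn u = 1) (A : set (circle R)) :
  <<s @open (circle R) >> A -> <<s @open (circle R) >> [set z | A (mkcircle (cn_mulcircle z u1))].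
Proof.
move=> mA.
have mf : @measurable_fun _ _ circleM circleM setT (fun z => mkcircle (cn_mulcircle z u1)).
  apply: (@measurability _ _ circleM circleM setT _ (@open (circle R))) => // _ [U oU <-].
  rewrite setTI; apply: sub_sigma_algebra.
  have /open_circleP[V /openCP oV ->] := oU; apply/open_circleP.
  exists [set z | V (z * u)] => //; apply/openCP => z /= /oV[r r0 H]; exists r => // v vz.
  by apply: H; rewrite -mulrBl cnM u1 mulr1.
by have := mf (@measurableT _ circleM) A mA; rewrite setTI.
Qed.

Lemma flow_coord_angle t j : exists th : R, flow_coord t j = cexp (0 +i* (2 * pi * th)).
Proof.
rewrite /flow_coord; case: pselect => h; last first.
  by exists 0; rewrite mulr0; apply/complex_eqP; rewrite ?Re_cexp ?Im_cexp /= expR0 ?cos0 ?sin0 ?mulr1 ?mulr0.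
exists (- t * ln (projT1 (cid h))%:R / (2 * pi)); rewrite /npow_opp; congr cexp; apply/complex_eqP => /=.
  by ring.
rewrite [RHS]mulrC divfK; first by ring.
by rewrite mulf_neq0 ?pnatr_eq0// gt_eqF// pi_gt0.
Qed.

Lemma flow_preimage t (n : nat) (A : nat -> set (circle R)) :
  flow t @^-1` [set chi | forall j, (j < n)%N -> A j (chi j)] =
  [set chi | forall j, (j < n)%N -> [set z | A j (mkcircle (cn_mulcircle z (cn_flow_coord t j)))] (chi j)].
Proof. by []. Qed.

Lemma measurable_flow t : @measurable_fun _ _ (Tinf R) Tcyl setT (flow t).
Proof.
apply: (@measurability _ _ (Tinf R) Tcyl setT (flow t) cylinder) => // _ [_ [n [A [mA ->]]] <-].
rewrite setTI flow_preimage; apply: cylinder_measurable.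
by exists n, (fun j => [set z | A j (mkcircle (cn_mulcircle z (cn_flow_coord t j)))]); split => // j; exact: measurable_mulcircle.
Qed.

(** The identity goes from the Borel sigma-algebra, on which [m] is given, to that of the cylinders:
    a function measurable for the latter can be integrated against [m]. *)
Lemma measurable_id_cylinder : @measurable_fun _ _ (Tinf R) Tcyl setT id.
Proof.
apply: (@measurability _ _ (Tinf R) Tcyl setT id cylinder) => // _ [X cX <-].
by rewrite setTI; exact: cylinder_measurable.
Qed.

Lemma measurable_cyl_coord j (A : set (circle R)) :
  <<s @open (circle R) >> A -> measurable ([set chi | A (chi j)] : set Tcyl).
Proof.
move=> mA; apply: sub_sigma_algebra; exists j.+1, (fun k => if k == j then A else setT); split.
  by move=> k; case: ifP => // _; exact: (@measurableT _ circleM).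
apply/seteqP; split=> chi /=; first by move=> Ac k _; case: eqP => // ->.
by move=> /(_ j (ltnSn j)); rewrite eqxx.
Qed.

Definition cmeasurable (f : Tcyl -> R[i]) :=
  measurable_fun setT (fun x => Re (f x)) /\ measurable_fun setT (fun x => Im (f x)).

Lemma measurable_coord_fun (g : R[i] -> R) j : (forall z u, `|g z - g u| <= cn (z - u)) ->
  measurable_fun setT (fun chi : Tcyl => g (\val (chi j))).
Proof.
move=> gL.
have H : @measurable_fun _ _ circleM (measurableTypeR R) setT (fun z => g (\val z)).
  apply: (@measurability _ _ circleM (measurableTypeR R) setT _ _ (RGenOInfty.measurableE R)).
  move=> _ [_ [x ->] <-]; rewrite setTI; apply: sub_sigma_algebra.
  apply/open_circleP; exists [set z | x < g z]; last first.
    by apply/seteqP; split=> z /=; rewrite in_itv /= andbT.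
  apply/openCP => z /= xz; exists (g z - x); first by rewrite subr_gt0.
  move=> u uz; have := le_lt_trans (gL u z) uz; rewrite ltr_norml; lra.
move=> _ Y mY; rewrite setTI.
by apply: (@measurable_cyl_coord j [set z | Y (g (\val z))]); have := H (@measurableT _ circleM) Y mY; rewrite setTI.
Qed.

Lemma cmeasurable_coord j : cmeasurable (fun chi => \val (chi j)).
Proof.
split; apply: (measurable_coord_fun (g := fun z => _ z)) => z u.
  by rewrite -ReN -ReD ler_Re.
by rewrite -ImN -ImD ler_Im.
Qed.

Lemma cmeasurable_cst z : cmeasurable (fun=> z).
Proof. by split; exact: measurable_cst. Qed.

Lemma cmeasurableD f g : cmeasurable f -> cmeasurable g -> cmeasurable (fun x => f x + g x).
Proof.
move=> [f1 f2] [g1 g2]; split.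
  by under eq_fun do rewrite ReD; exact: measurable_funD.
by under eq_fun do rewrite ImD; exact: measurable_funD.
Qed.

Lemma cmeasurableM f g : cmeasurable f -> cmeasurable g -> cmeasurable (fun x => f x * g x).
Proof.
move=> [f1 f2] [g1 g2]; split.
  by under eq_fun do rewrite ReM; apply: measurable_funB; exact: measurable_funM.
by under eq_fun do rewrite ImM; apply: measurable_funD; exact: measurable_funM.
Qed.

Lemma cmeasurableX f n : cmeasurable f -> cmeasurable (fun x => f x ^+ n).
Proof.
move=> mf; elim: n => [|n IH]; first exact: cmeasurable_cst.
by under eq_fun do rewrite exprS; exact: cmeasurableM.
Qed.

Lemma cmeasurable_sum n (f : nat -> Tcyl -> R[i]) :
  (forall k, cmeasurable (f k)) -> cmeasurable (fun x => \sum_(k < n) f k x).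
Proof.
move=> mf; elim: n => [|n IH].
  by under eq_fun do rewrite big_ord0; exact: cmeasurable_cst.
by under eq_fun do rewrite big_ord_recr /=; exact: cmeasurableD.
Qed.

Lemma cmeasurable_prod (I : Type) (s : seq I) (f : I -> Tcyl -> R[i]) :
  (forall k, cmeasurable (f k)) -> cmeasurable (fun x => \prod_(k <- s) f k x).
Proof.
move=> mf; elim: s => [|a s IH].
  by under eq_fun do rewrite big_nil; exact: cmeasurable_cst.
by under eq_fun do rewrite big_cons /=; exact: cmeasurableM.
Qed.

Lemma cmeasurable_lim (u : nat -> Tcyl -> R[i]) f : (forall n, cmeasurable (u n)) ->
  (forall x, u ^~ x @ \oo --> f x) -> cmeasurable f.
Proof.
move=> mu uf; split.
  apply: (@measurable_fun_cvg _ _ _ _ (fun n x => Re (u n x))) => [n|x _]; first by have [] := mu n.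
  apply/cvgrPdist_le => e /((cvgC _ _).1 (uf x) e)[N HN]; exists N => // n /HN H.
  by rewrite distrC -ReN -ReD; apply: (le_trans (ler_Re _)).
apply: (@measurable_fun_cvg _ _ _ _ (fun n x => Im (u n x))) => [n|x _]; first by have [] := mu n.
apply/cvgrPdist_le => e /((cvgC _ _).1 (uf x) e)[N HN]; exists N => // n /HN H.
by rewrite distrC -ImN -ImD; apply: (le_trans (ler_Im _)).
Qed.

Lemma cmeasurable_dirichlet (c0 : nat) (c : nat -> R[i]) s : G_ge1 c0 c -> 0 < Re s ->
  cmeasurable (fun chi => dirichlet (twist c chi) s).
Proof.
move=> hpsi s0; apply: (@cmeasurable_lim (fun N chi => dirichlet_partial (twist c chi) N s)) => [N|chi].
  under eq_fun do rewrite dirichlet_partialE /twist.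
  apply: (@cmeasurable_sum N (fun k x => c k * character x k.+1 * npow_opp k.+1 s)) => k; apply: cmeasurableM; last exact: cmeasurable_cst.
  apply: cmeasurableM; first exact: cmeasurable_cst.
  apply: cmeasurable_prod => p; apply: cmeasurableX; exact: cmeasurable_coord.
exact: (@dirichlet_cvg R (Tinf R) (twist c) chi s (unif_cauchy_twist hpsi) s0).
Qed.

Lemma measurable_cn_sqr f : cmeasurable f -> measurable_fun setT (fun x => cn (f x) ^+ 2).
Proof.
by move=> [f1 f2]; under eq_fun do rewrite cn_sqr; apply: measurable_funD; exact: measurable_funX.
Qed.

Variables (m : probability (Tinf R) R) (hm : is_torus_measure m).

(** On a cylinder [m] is a product of arc lengths and the flow merely rotates each coordinate, so
    the two push-forwards agree there; cylinders are stable under intersection, which determines the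
    measures. *)
Lemma flow_invariant t (X : set Tcyl) : measurable X ->
  pushforward m (flow t : Tinf R -> Tcyl) X = pushforward m (id : Tinf R -> Tcyl) X.
Proof.
move=> mX.
apply: (@g_sigma_algebra_measure_unique _ R Tcyl cylinder _ (fun=> setT)) => //.
- by move=> Y cY; exact: sub_sigma_algebra.
- by move=> i; exact: cylinderT.
- by apply/seteqP; split=> // chi _; exists 0%N.
- exact: measurable_flow.
- exact: measurable_id_cylinder.
- exact: cylinder_setI.
- move=> _ _ _ /= [n [A [mA ->]]]; rewrite /pushforward flow_preimage.
  rewrite preimage_id; apply: (etrans (hm n (A := fun j => [set z | A j (mkcircle (cn_mulcircle z (cn_flow_coord t j)))]) _)).
    by move=> j; exact: measurable_mulcircle.
  apply/esym; apply: (etrans (hm n mA)); apply/esym.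
  apply: eq_bigr => j _; have [th E] := flow_coord_angle t j.
  exact: circle_measure_rotation E.
- by move=> ? k; rewrite /= /pushforward preimage_setT probability_setT ltry.
Qed.

Lemma integral_flow (t : R) (f : Tcyl -> \bar R) : measurable_fun setT f -> (forall x, 0 <= f x)%E ->
  (\int[m]_(x in setT) f (flow t x) = \int[m]_(x in setT) f x)%E.
Proof.
move=> mf f0.
rewrite -[LHS]/(integral m (flow t @^-1` setT) (f \o flow t)).
rewrite -(ge0_integral_pushforward (measurable_flow t) m measurableT mf)//.
rewrite -[RHS]/(integral m (id @^-1` setT) (f \o id)).
rewrite -(ge0_integral_pushforward measurable_id_cylinder m measurableT mf)//.
apply: eq_measure_integral.
- exact: measurable_id_cylinder.
- exact: measurable_flow.
- by move=> *; exact: flow_invariant.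
Qed.

(** The integral of a nonnegative function is a supremum over the simple functions below it, hence
    monotone on arbitrary functions; this is how the counting function is compared with its
    majorants. *)
Lemma le_integral_nonneg d (T : measurableType d) (mu : {measure set T -> \bar R}) (f g : T -> \bar R) :
  (forall x, 0 <= f x)%E -> (forall x, f x <= g x)%E ->
  (\int[mu]_(x in setT) f x <= \int[mu]_(x in setT) g x)%E.
Proof.
move=> f0 fg; have g0 x : (0 <= g x)%E by exact: le_trans (f0 x) (fg x).
rewrite !ge0_integralTE//; apply: ereal_sup_le => _ [h hf <-].
by exists h => // x; exact: le_trans (hf x) (fg x).
Qed.

End torus.

(** * Approximation of [n^-psi] by Dirichlet polynomials *)

Section dirichlet_polynomials.
Variable R : realType.
Implicit Types (Q : Tinf R -> R[i] -> R[i]) (q : nat -> R[i]).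

(** One coefficient sequence describes the twists by all characters at once; it is zero beyond [N],
    so that two polynomials can be brought to a common length. *)
Definition dpoly_coef Q q (N : nat) := (forall k, (N <= k)%N -> q k = 0) /\
  forall chi s, Q chi s = \sum_(k < N) twist q chi k * npow_opp k.+1 s.

Definition dpoly Q := exists q N, dpoly_coef Q q N.

Lemma dpoly_widen Q q N M : dpoly_coef Q q N -> (N <= M)%N -> dpoly_coef Q q M.
Proof.
move=> [q0 QE] NM; split; first by move=> k Mk; apply: q0; exact: leq_trans Mk.
move=> chi s; rewrite QE (big_ord_widen M (fun k => twist q chi k * npow_opp k.+1 s) NM).
rewrite big_mkcond; apply: eq_bigr => k _; case: ifP => // /negbT; rewrite -leqNgt => /q0 E.
by rewrite /twist E !mul0r.
Qed.

Lemma dpolyD Q Q' : dpoly Q -> dpoly Q' -> dpoly (fun chi s => Q chi s + Q' chi s).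
Proof.
move=> [q [N QN]] [q' [N' QN']].
have [q0 QE] := dpoly_widen QN (leq_maxl N N'); have [q0' QE'] := dpoly_widen QN' (leq_maxr N N').
exists (fun k => q k + q' k), (maxn N N'); split; first by move=> k Nk; rewrite q0// q0'// addr0.
by move=> chi s; rewrite QE QE' -big_split; apply: eq_bigr => k _; rewrite /twist /=; ring.
Qed.

Lemma dpolyZ z Q : dpoly Q -> dpoly (fun chi s => z * Q chi s).
Proof.
move=> [q [N [q0 QE]]]; exists (fun k => z * q k), N; split; first by move=> k /q0 ->; rewrite mulr0.
by move=> chi s; rewrite QE mulr_sumr; apply: eq_bigr => k _; rewrite /twist /=; ring.
Qed.

Lemma dpoly_monomial n : (0 < n)%N -> dpoly (fun chi s => character chi n * npow_opp n s).
Proof.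
case: n => // n _; exists (fun k => (k == n)%:R), n.+1; split.
  by move=> k nk; rewrite gtn_eqF.
move=> chi s; rewrite big_ord_recr /= big1 ?add0r /twist ?eqxx ?mul1r// => i _.
by rewrite ltn_eqF ?mul0r.
Qed.

Lemma dpoly_ext Q Q' : (forall chi s, Q chi s = Q' chi s) -> dpoly Q -> dpoly Q'.
Proof. by move=> E [q [N [q0 QE]]]; exists q, N; split => // chi s; rewrite -E. Qed.

Lemma dpoly_cst z : dpoly (fun _ _ => z).
Proof.
by apply: dpoly_ext (dpolyZ z (dpoly_monomial (ltn0Sn 0))) => chi s; rewrite character1 npow_opp1 !mulr1.
Qed.

Lemma dpoly_sum n (F : nat -> Tinf R -> R[i] -> R[i]) : (forall k, dpoly (F k)) ->
  dpoly (fun chi s => \sum_(k < n) F k chi s).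
Proof.
move=> dF; elim: n => [|n IH].
  by apply: dpoly_ext (dpoly_cst 0) => chi s; rewrite big_ord0.
by apply: dpoly_ext (dpolyD IH (dF n)) => chi s; rewrite big_ord_recr.
Qed.

(** Multiplicativity of the characters makes twisting compatible with products. *)
Lemma dpolyM Q Q' : dpoly Q -> dpoly Q' -> dpoly (fun chi s => Q chi s * Q' chi s).
Proof.
move=> [q [N [q0 QE]]] [q' [N' [q0' QE']]].
apply: (@dpoly_ext (fun chi s => \sum_(k < N) \sum_(l < N') (q k * q' l) *
   (character chi (k.+1 * l.+1) * npow_opp (k.+1 * l.+1) s))).
  move=> chi s; rewrite QE QE' mulr_suml; apply: eq_bigr => k _; rewrite mulr_sumr.
  by apply: eq_bigr => l _; rewrite characterM// npow_oppM// /twist; ring.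
apply: (@dpoly_sum N (fun k chi s => \sum_(l < N') (q k * q' l) *
   (character chi (k.+1 * l.+1) * npow_opp (k.+1 * l.+1) s))) => k.
apply: (@dpoly_sum N' (fun l chi s => (q k * q' l) *
   (character chi (k.+1 * l.+1) * npow_opp (k.+1 * l.+1) s))) => l.
by apply: dpolyZ; apply: dpoly_monomial.
Qed.

Lemma dpolyX Q n : dpoly Q -> dpoly (fun chi s => Q chi s ^+ n).
Proof.
move=> dQ; elim: n => [|n IH]; first exact: dpoly_cst.
by apply: dpoly_ext (dpolyM dQ IH) => chi s; rewrite exprS.
Qed.

Lemma dpoly_partial (c : nat -> R[i]) N : dpoly (fun chi s => dirichlet_partial (twist c chi) N s).
Proof.
apply: (@dpoly_ext (fun chi s => \sum_(k < N) c k * (character chi k.+1 * npow_opp k.+1 s))).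
  by move=> chi s; rewrite dirichlet_partialE; apply: eq_bigr => k _; rewrite /twist; ring.
apply: (@dpoly_sum N (fun k chi s => c k * (character chi k.+1 * npow_opp k.+1 s))) => k.
by apply: dpolyZ; exact: dpoly_monomial.
Qed.

Lemma expr_diff_le (x y : R[i]) (r : R) M : 1 <= r -> cn x <= r -> cn y <= r ->
  cn (x ^+ M - y ^+ M) <= M%:R * r ^+ M * cn (x - y).
Proof.
move=> r1 xr yr; have r0 : 0 <= r := le_trans ler01 r1.
elim: M => [|M IH]; first by rewrite !expr0 subrr cn0 !mul0r.
have -> : x ^+ M.+1 - y ^+ M.+1 = x * (x ^+ M - y ^+ M) + (x - y) * y ^+ M by rewrite !exprS; ring.
apply: (le_trans (cnD _ _)); rewrite cnM [cn ((x - y) * _)]cnM cnX.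
have h1 : cn x * cn (x ^+ M - y ^+ M) <= r * (M%:R * r ^+ M * cn (x - y)).
  by apply: ler_pM; rewrite ?cn_ge0.
have h2 : cn y ^+ M <= r ^+ M by rewrite lerXn2r ?nnegrE ?cn_ge0.
have h3 : r ^+ M <= r ^+ M.+1 by rewrite ler_weXn2l.
have h4 : cn (x - y) * cn y ^+ M <= cn (x - y) * r ^+ M.+1.
  by apply: ler_wpM2l; [exact: cn_ge0|exact: le_trans h3].
apply: (le_trans (lerD h1 h4)); rewrite -[M.+1%:R]natr1 exprS; lra.
Qed.

(** Through Euler's limit the exponential of a Dirichlet polynomial is approximated by Dirichlet
    polynomials. The bases [exp (h / M)] and [1 + h / M] have modulus at most [exp (|h| / M)], so
    their powers differ by at most a constant times [M] times the difference of the bases, which is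
    of order [M^-2]. *)
Lemma cexp_power_limit (h : R[i]) M : (0 < M)%N ->
  cn (cexp h - (1 + h / M%:R) ^+ M) <= 4 * expR (2 * cn h) * cn h ^+ 2 / M%:R.
Proof.
move=> M0; have M0' : 0 < M%:R :> R by rewrite ltr0n.
have MC : (M%:R : R[i]) != 0 by rewrite pnatr_eq0 -lt0n.
have -> : cexp h = cexp (h / M%:R) ^+ M.
  by rewrite -cexpMn; congr cexp; rewrite -[RHS]mulr_natr divfK.
set u := h / M%:R; have cu : cn u = cn h / M%:R by rewrite /u cnM cnV cn_nat.
have cu0 : 0 <= cn u := cn_ge0 _.
have e1 : 1 <= expR (cn u) by rewrite -[leLHS]expR0 ler_expR.
apply: (le_trans (expr_diff_le M e1 _ _)).
- by rewrite cn_cexp ler_expR Re_le_cn.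
- by apply: (le_trans (cnD _ _)); rewrite cn1; exact: expR_ge1Dx.
have := cexp_taylor u 2; rewrite big_ord_recr big_ord1 /= expr0 expr1 !divr1 => H.
have E : expR (cn u) ^+ M = expR (cn h) by rewrite -expRM_natl cu mulrC divfK// gt_eqF.
rewrite E; apply: (@le_trans _ _ (M%:R * expR (cn h) * (2 ^+ 2 * expR (cn u) * cn u ^+ 2))).
  by apply: ler_wpM2l => //; rewrite mulr_ge0 ?ler0n ?expR_ge0.
have uh : expR (cn u) <= expR (cn h).
  by rewrite ler_expR cu ler_pdivrMr// ler_peMr ?cn_ge0// ler1n.
rewrite expRM_natl cu expr_div_n.
have -> : M%:R * expR (cn h) * (2 ^+ 2 * expR (cn h / M%:R) * (cn h ^+ 2 / M%:R ^+ 2)) =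
  (4 * cn h ^+ 2 / M%:R * expR (cn h)) * expR (cn h / M%:R) by field; rewrite gt_eqF.
have -> : 4 * expR (cn h) ^+ 2 * cn h ^+ 2 / M%:R = (4 * cn h ^+ 2 / M%:R * expR (cn h)) * expR (cn h) by ring.
rewrite -cu; apply: ler_wpM2l => //; rewrite mulr_ge0 ?expR_ge0// divr_ge0 ?ler0n// mulr_ge0 ?sqr_ge0//.
Qed.

End dirichlet_polynomials.

Section composition.
Variables (R : realType) (c0 : nat) (c : nat -> R[i]).
Hypothesis hpsi : G_ge1 c0 c.

Lemma npow_opp_symbol n chi s : npow_opp n (symbol_fun c0 (twist c chi) s) =
  npow_opp n s ^+ c0 * cexp (- (ln n%:R)%:C * dirichlet (twist c chi) s).
Proof.
rewrite /symbol_fun npow_oppD; set D := dirichlet _ s; rewrite /npow_opp -cexpMn.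
have -> : - s * (ln n%:R)%:C *+ c0 = - (c0%:R * s) * (ln n%:R)%:C by rewrite -mulr_natl mulrA mulrN.
by have -> : - D * (ln n%:R)%:C = - (ln n%:R)%:C * D by rewrite !mulNr mulrC.
Qed.

Lemma cexp_diff_le (u v : R[i]) :
  cn (cexp u - cexp v) <= 2 * expR (cn v) * expR (cn (u - v)) * cn (u - v).
Proof.
have -> : cexp u - cexp v = cexp v * (cexp (u - v) - 1).
  by rewrite mulrBr mulr1 -cexpD [v + _]addrC subrK.
rewrite cnM; have := cexp_taylor (u - v) 1; rewrite big_ord1 expr0 divr1 !expr1 => H.
have h1 : cn (cexp v) <= expR (cn v) by rewrite cn_cexp ler_expR Re_le_cn.
have -> : 2 * expR (cn v) * expR (cn (u - v)) * cn (u - v) = expR (cn v) * (2 * expR (cn (u - v)) * cn (u - v)) by ring.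
by apply: ler_pM => //; exact: cn_ge0.
Qed.

(** Twisting the Dirichlet series of [n^-psi] by [chi] gives [chi(n)^c0 n^(-psi_chi)], because of
    the factor [n^(-c0 s)]; hence one coefficient sequence serves all [chi]. *)
Lemma dpoly_approx n (e k : R) : (0 < n)%N -> 0 < e -> 0 < k ->
  exists2 Q, dpoly Q & forall chi s, e <= Re s ->
    cn (Q chi s - character chi n ^+ c0 * npow_opp n (symbol_fun c0 (twist c chi) s)) <= k.
Proof.
move=> n0 e0 k0; have uc := unif_cauchy_twist hpsi.
have [B0 HB0] := dirichlet_bounded uc (coef_bounded_twist c) e0.
pose L : R := ln n%:R; have L0 : 0 <= L by exact: ln_nat_ge0.
pose B := `|B0|; have B0' : 0 <= B by exact: normr_ge0.
have eLB := expR_gt0 (L * B); have e1 := expR_gt0 (1 : R).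
have k2 : 0 < k / 2 by rewrite divr_gt0.
(* Half of [k] is for replacing [phi_chi] by a partial sum, with [w <= 1] bounding the exponential
   of the difference by [expR 1]; the other half is for Euler's limit. *)
pose w := Num.min 1 (k / 2 / (2 * expR (L * B) * expR 1)).
have w0 : 0 < w by rewrite lt_min ltr01/= divr_gt0// !mulr_gt0.
have w1 : w <= 1 by rewrite ge_min lexx.
have wk : 2 * expR (L * B) * expR 1 * w <= k / 2.
  by rewrite mulrC -ler_pdivlMr ?mulr_gt0// ge_min lexx orbT.
have d0 : 0 < w / (L + 1) by rewrite divr_gt0// ltr_wpDl.
have [N0 HN0] := dirichlet_unif uc e0 d0.
pose M := (Num.truncn (4 * expR (2 * (L * B)) * (L * B) ^+ 2 / (k / 2))).+1.
have M0 : 0 < M%:R :> R by rewrite ltr0n.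
have HM : 4 * expR (2 * (L * B)) * (L * B) ^+ 2 / M%:R <= k / 2.
  rewrite ler_pdivrMr// [leRHS]mulrC -ler_pdivrMr//; apply: ltW; exact: truncnS_gt.
pose P chi s := dirichlet_partial (twist c chi) N0 s.
exists (fun chi s => (character chi n * npow_opp n s) ^+ c0 * (1 + (- L%:C / M%:R) * P chi s) ^+ M).
  apply: dpolyM; first by apply: dpolyX; exact: dpoly_monomial.
  by apply: dpolyX; apply: dpolyD; [exact: dpoly_cst|apply: dpolyZ; exact: dpoly_partial].
move=> chi s es; have [HP HD] := HB0 chi s es.
set D := dirichlet _ s in HD; have PD : cn (P chi s - D) <= w / (L + 1) by exact: HN0.
rewrite npow_opp_symbol exprMn mulrA -mulrBr cnM -/D.
have -> : - L%:C / M%:R * P chi s = (- L%:C * P chi s) / M%:R by rewrite mulrAC.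
set u := - L%:C * P chi s; set v := - L%:C * D.
have c1 : cn (character chi n ^+ c0 * npow_opp n s ^+ c0) <= 1.
  rewrite cnM !cnX cn_character expr1n mul1r cn_npow_opp -/L exprn_ile1 ?expR_ge0//.
  by rewrite -[leRHS]expR0 ler_expR mulNr oppr_le0 mulr_ge0// (le_trans (ltW e0)).
have cu : cn u <= L * B.
  by rewrite cnM cnN cnR ger0_norm// ler_wpM2l// (le_trans (HP N0)) ?ler_norm.
have cv : cn v <= L * B.
  by rewrite cnM cnN cnR ger0_norm// ler_wpM2l// (le_trans HD) ?ler_norm.
have cuv : cn (u - v) <= w.
  rewrite -mulrBr cnM cnN cnR ger0_norm//; apply: (le_trans (ler_wpM2l L0 PD)).
  by rewrite mulrCA ler_piMr ?(ltW w0)// ler_pdivrMr ?ltr_wpDl// mul1r lerDl.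
apply: (@le_trans _ _ (1 * (k / 2 + k / 2))); last by rewrite mul1r -splitr.
apply: ler_pM => //; rewrite ?cn_ge0//.
have -> : (1 + u / M%:R) ^+ M - cexp v = - (cexp u - (1 + u / M%:R) ^+ M) + (cexp u - cexp v).
  by rewrite opprB addrA subrK.
apply: (le_trans (cnD _ _)); rewrite cnN lerD//.
  apply: (le_trans (cexp_power_limit u (ltn0Sn _))); apply: le_trans HM.
  rewrite ler_wpM2r ?invr_ge0 ?ler0n// -!mulrA ler_wpM2l//.
  apply: ler_pM; rewrite ?expR_ge0 ?sqr_ge0//; first by rewrite ler_expR ler_wpM2l.
  by rewrite lerXn2r ?nnegrE ?cn_ge0// mulr_ge0.
apply: (le_trans (cexp_diff_le u v)); apply: le_trans wk.
apply: ler_pM; rewrite ?cn_ge0 ?mulr_ge0 ?expR_ge0//.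
apply: ler_pM; rewrite ?mulr_ge0 ?expR_ge0//; first by rewrite ler_wpM2l// ler_expR.
by rewrite ler_expR (le_trans cuv).
Qed.

End composition.

(** * The images of the functions [n^-s] *)

Section hardy.
Variable R : realType.
Implicit Types (b : H2 R) (q : nat -> R[i]).

Lemma sumsq_fin_num b : sumsq b \is a fin_num.
Proof.
rewrite ge0_fin_numE; last by apply: nneseries_ge0 => k _ _; rewrite lee_fin sqr_ge0.
by case: b => a /=; rewrite inE.
Qed.

Lemma H2_partial_le b M : \sum_(k < M) cn (b k) ^+ 2 <= fine (sumsq b).
Proof.
rewrite -lee_fin fineK ?sumsq_fin_num// -sumEFin.
rewrite -(big_mkord xpredT (fun k => (cn (b k) ^+ 2)%:E)).
by apply: nneseries_lim_ge => k _; rewrite lee_fin sqr_ge0.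
Qed.

Lemma cn_npow_opp_line1 k t : cn (npow_opp k.+1 (1 +i* t) : R[i]) = k.+1%:R^-1.
Proof. by rewrite cn_npow_opp /= mulN1r expRN lnK// posrE ltr0n. Qed.

Lemma sum_inv_sqr_le M : \sum_(k < M) (k.+1%:R^-1 : R) ^+ 2 <= 3 - 2 / (M%:R + 1).
Proof.
elim: M => [|M IH]; first by rewrite big_ord0 add0r divr1; lra.
rewrite big_ord_recr /=; apply: (le_trans (lerD IH (lexx _))).
rewrite -[M.+1%:R]natr1; set x : R := M%:R; have x0 : 0 <= x by exact: ler0n.
rewrite -subr_ge0.
have -> : 3 - 2 / (x + 1 + 1) - (3 - 2 / (x + 1) + (x + 1)^-1 ^+ 2) = x / ((x + 1) ^+ 2 * (x + 2)).
  by field; apply/andP; split; rewrite gt_eqF//; lra.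
by rewrite divr_ge0// mulr_ge0 ?sqr_ge0//; lra.
Qed.

(** On the line [Re s = 1] the moduli of the terms do not depend on [t], and they are summable
    because [|b_k| / (k + 1) <= |b_k|^2 + 1 / (k + 1)^2]. *)
Lemma H2_cauchy b (d : R) : 0 < d -> exists N0, forall M M' t, (N0 <= M)%N -> (M <= M')%N ->
  cn (\sum_(k < M') b k * npow_opp k.+1 (1 +i* t) - \sum_(k < M) b k * npow_opp k.+1 (1 +i* t)) <= d.
Proof.
move=> d0; pose S M : R := \sum_(k < M) cn (b k) / k.+1%:R.
have Snd : nondecreasing_seq S.
  apply/nondecreasing_seqP => n; rewrite /S big_ord_recr /= lerDl.
  by rewrite mulr_ge0 ?cn_ge0// invr_ge0.
have Sub : has_ubound (range S).
  exists (fine (sumsq b) + 3) => _ [M _ <-].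
  apply: (@le_trans _ _ (\sum_(k < M) (cn (b k) ^+ 2 + k.+1%:R^-1 ^+ 2))).
    apply: ler_sum => k _; have := cn_ge0 (b k); have : 0 <= (k.+1%:R : R)^-1 by rewrite invr_ge0.
    by set x := cn _; set y := _^-1 => y0 x0; have := sqr_ge0 (x - y); nra.
  rewrite big_split lerD ?H2_partial_le//; apply: (le_trans (sum_inv_sqr_le M)).
  by rewrite gerBl divr_ge0// addr_ge0.
have := nondecreasing_is_cvgn Snd Sub; set l := limn S => cS.
have Sl M : S M <= l by exact: nondecreasing_cvgn_le.
have /cvgrPdist_le/(_ d d0)[N0 _ HN0] := cS.
exists N0 => M M' t NM /subnKC <-; move: (M' - M)%N => k; rewrite big_split_ord /= addrAC subrr add0r.
  apply: (le_trans (cn_sum _ _ _)).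
  have := HN0 M NM; rewrite ger0_norm ?subr_ge0//; apply: le_trans.
  apply: (@le_trans _ _ (S (M + k)%N - S M)); last by rewrite lerB.
  rewrite /S big_split_ord /= addrAC subrr add0r.
  by apply: ler_sum => i _; rewrite cnM cn_npow_opp_line1.
Qed.

Lemma H2_tail b (d : R) : 0 < d -> exists N0, forall M t, (N0 <= M)%N ->
  cn (dirichlet b (1 +i* t) - \sum_(k < M) b k * npow_opp k.+1 (1 +i* t)) <= d.
Proof.
move=> d0; have [N0 HN0] := H2_cauchy b d0; exists N0 => M t NM.
have cv : dirichlet_partial b ^~ (1 +i* t) @ \oo --> dirichlet b (1 +i* t).
  apply: cauchyC => k k0; have [N1 HN1] := H2_cauchy b k0.
  exists N1 => n m Nn Nm; rewrite !dirichlet_partialE.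
  by have [nm|mn] := leqP n m; [rewrite cnBC|]; apply: HN1 => //; exact: ltnW.
have {}cv : (fun n => dirichlet_partial b n (1 +i* t) - \sum_(k < M) b k * npow_opp k.+1 (1 +i* t)) @ \oo -->
    dirichlet b (1 +i* t) - \sum_(k < M) b k * npow_opp k.+1 (1 +i* t).
  apply/cvgC => k k0; have [N1 HN1] := (cvgC _ _).1 cv k k0.
  by exists N1 => n /HN1; rewrite opprB addrA subrK.
by apply: (cn_lim_le (N0 := M) cv) => n Mn; rewrite dirichlet_partialE; exact: HN0.
Qed.

(** Bessel's inequality for a single frequency on the line [Re s = 1], where [(j + 1)^-s] has
    modulus [1 / (j + 1)]; this modulus is the factor lost. *)
Lemma coef_diff_le b q N (K : R) : 0 <= K -> (forall k, (N <= k)%N -> q k = 0) ->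
  (forall t, cn (dirichlet b (1 +i* t) - \sum_(k < N) q k * npow_opp k.+1 (1 +i* t)) <= K) ->
  forall j, cn (b j - q j) <= j.+1%:R * K.
Proof.
move=> K0 q0 H j; apply/ler_addgt0Pr => d d0.
have d'0 : 0 < d / j.+1%:R by rewrite divr_gt0// ltr0n.
have [N0 HN0] := H2_tail b d'0; pose M := maxn (maxn N0 N) j.+1.
have NM : (N <= M)%N by rewrite /M !leq_max leqnn orbT.
have := @bessel_coef R M (fun k => b k - q k) 1 (K + d / j.+1%:R) ler01 (addr_ge0 K0 (ltW d'0)) _ j _.
rewrite mulN1r expRN lnK ?posrE ?ltr0n// ler_pdivrMr ?ltr0n//.
have -> : (K + d / j.+1%:R) * j.+1%:R = j.+1%:R * K + d by field; rewrite addrC natr1 pnatr_eq0.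
apply; last by rewrite /M leq_max leqnn orbT.
move=> t.
have -> : \sum_(k < M) (b k - q k) * npow_opp k.+1 (1 +i* t) =
  \sum_(k < M) b k * npow_opp k.+1 (1 +i* t) - \sum_(k < N) q k * npow_opp k.+1 (1 +i* t).
  rewrite (big_ord_widen M (fun k => q k * npow_opp k.+1 (1 +i* t)) NM) [X in _ - X]big_mkcond -sumrB.
  apply: eq_bigr => k _; case: ifP => [_|/negbT]; first by rewrite mulrBl.
  by rewrite -leqNgt => /q0 ->; rewrite !subr0.
rewrite -(subrK (dirichlet b (1 +i* t)) (\sum_(k < M) _)) -addrA.
apply: (le_trans (cnD _ _)); rewrite [leRHS]addrC; apply: lerD; last exact: H.
by rewrite cnBC; apply: HN0; rewrite /M !leq_max leqnn.
Qed.

Definition delta_coef (n : nat) : nat -> R[i] := fun k => (k == n)%:R.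

Lemma sumsq_delta n : sumsq (delta_coef n) = 1%E.
Proof.
rewrite /sumsq (@nneseriesD1 _ _ n)//; last by move=> *; rewrite lee_fin sqr_ge0.
rewrite /delta_coef eqxx cn1 expr1n eseries0 ?adde0// => k _ /negbTE ->.
by rewrite cn0 expr0n.
Qed.

Lemma delta_H2 n : delta_coef n \in @H2_pred R.
Proof. by rewrite inE; rewrite sumsq_delta ltry. Qed.

Definition basis_vector n : H2 R := MkH2 (delta_H2 n).

Lemma dirichlet_basis_vector n s : dirichlet (basis_vector n) s = npow_opp n.+1 s.
Proof.
apply: limnC; apply/cvgC => k k0; exists n.+1 => N nN; rewrite dirichlet_partialE.
rewrite (bigD1 (Ordinal nN)) //= /delta_coef eqxx mul1r big1 ?addr0 ?subrr ?cn0 ?(ltW k0)//.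
by move=> i; rewrite -val_eqE /= => /negbTE ->; rewrite mul0r.
Qed.

Lemma norm_basis_vector n : `|basis_vector n| = 1.
Proof. by rewrite -[LHS]/(H2_norm (basis_vector n)) /H2_norm sumsq_delta /= sqrtr1. Qed.

Lemma coef_le_norm b j (k : R) : `|b| <= k%:C -> cn (b j) <= k.
Proof.
rewrite -[`|b|]/(H2_norm b) /H2_norm lecR; apply: le_trans.
rewrite -[leLHS]ger0_norm ?cn_ge0// -sqrtr_sqr ler_wsqrtr//.
by apply: le_trans (H2_partial_le b j.+1); rewrite big_ord_recr /= lerDr sumr_ge0// => i _; rewrite sqr_ge0.
Qed.

End hardy.

(** * Compactness and the average of [n^(-2 Re phi_chi)] *)

Section operator.
Variables (R : realType) (c0 : nat) (c : nat -> R[i]).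
Hypothesis hpsi : G_ge1 c0 c.
Variable T : {linear H2 R -> H2 R}.
Hypothesis hC : is_composition_operator (symbol_fun c0 c) T.
Hypothesis hcompact : compact_operator T.

Lemma sqr_sum3_le (x u v w : R) : 0 <= x -> x <= u + (w + v) ->
  x ^+ 2 <= 3 * u ^+ 2 + 3 * v ^+ 2 + 3 * w ^+ 2.
Proof.
move=> x0 h; have := sqr_ge0 (u - v); have := sqr_ge0 (u - w); have := sqr_ge0 (v - w).
have : x ^+ 2 <= (u + (w + v)) ^+ 2 by rewrite lerXn2r ?nnegrE ?(le_trans x0 h).
nra.
Qed.

Definition chi_one : Tinf R := fun=> circle1 R.

Lemma character_one n : character chi_one n = 1.
Proof. by rewrite /character big1// => p _; rewrite expr1n. Qed.

Lemma twist_one q : twist q chi_one = q.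
Proof. by apply/funext => k; rewrite /twist character_one mulr1. Qed.

Lemma dirichlet_image n t : dirichlet (T (basis_vector R n)) (1 +i* t) =
  npow_opp n.+1 (symbol_fun c0 c (1 +i* t)).
Proof. by rewrite hC ?dirichlet_basis_vector// /half_plane /= invf_lt1// ltr1n. Qed.

(** [Re psi >= 1] on the line [Re s = 1], so [(n + 1)^-psi] has modulus at most [1 / (n + 1)] there;
    it is compared with the zero polynomial. *)
Lemma image_coef_le n j : cn (T (basis_vector R n) j) <= j.+1%:R * n.+1%:R^-1.
Proof.
have := @coef_diff_le R (T (basis_vector R n)) (fun=> 0) 0 n.+1%:R^-1; rewrite invr_ge0 ler0n => /(_ isT).
move=> /(_ (fun _ _ => erefl)) H; rewrite -[T _ _]subr0; apply: H => t.
rewrite big_ord0 subr0 dirichlet_image cn_npow_opp -[leRHS]lnK ?posrE ?invr_gt0 ?ltr0n//.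
rewrite ler_expR lnV ?posrE ?ltr0n// -[leRHS]mulN1r ler_wpM2r ?ln_nat_ge0// lerN2.
by have := @Re_symbol_ge R c0 c hpsi chi_one (1 +i* t) ltr01; rewrite twist_one.
Qed.

(** By compactness the images of the unit vectors [(n + 1)^-s] have a cluster point; their
    coefficients tend to 0 one by one, so it is 0. The condition [0 < n] makes [ln (n + 1)]
    positive. *)
Lemma exists_small_image (k : R) : 0 < k -> exists2 n, (0 < n)%N & fine (sumsq (T (basis_vector R n))) <= k ^+ 2.
Proof.
move=> k0; have := hcompact; rewrite /compact_operator precompactE => /(_ ((fun n => T (basis_vector R n)) @ \oo)).
case.
  exists 0%N => // n _ /=; apply: subset_closure; exists (basis_vector R n) => //=.
  by rewrite norm_basis_vector.
move=> g [_ cg].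
have near d n0 : 0 < d -> exists2 n, (n0 <= n)%N & `|g - T (basis_vector R n)| <= d%:C.
  move=> d0.
  have [] := cg [set f | exists2 n, (n0 <= n)%N & f = T (basis_vector R n)] (ball g d%:C).
  - by exists n0 => // n n0n /=; exists n.
  - by apply: nbhsx_ballx; rewrite ltcR.
  move=> _ [[n n0n ->]]; rewrite -ball_normE /= => /ltW gn; by exists n.
have g0 j : g j = 0.
  apply/eqP; rewrite -cn_eq0 eq_le cn_ge0 andbT; apply/ler_addgt0Pr => e e0; rewrite add0r.
  have e20 : 0 < e / 2 by rewrite divr_gt0.
  pose n0 := Num.truncn (j.+1%:R / (e / 2)).
  have [n n0n gn] := near (e / 2) n0 e20.
  have h1 : cn (g j - T (basis_vector R n) j) <= e / 2 by have := coef_le_norm j gn.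
  have h2 : j.+1%:R * n.+1%:R^-1 <= e / 2.
    rewrite ler_pdivrMr ?ltr0n// [leRHS]mulrC -ler_pdivrMr//.
    apply: ltW; apply: (lt_le_trans (truncnS_gt _)); by rewrite ler_nat ltnS.
  have := cnD (g j - T (basis_vector R n) j) (T (basis_vector R n) j); rewrite subrK => h3.
  by apply: (le_trans h3); rewrite [e]splitr; apply: lerD => //; exact: le_trans (image_coef_le n j) h2.
have [n n1 gn] := near k 1%N k0; exists n => //.
have {}g0 : g = 0 by apply: val_inj; apply/funext => j /=; rewrite g0.
move: gn; rewrite g0 sub0r normrN -[`|_|]/(H2_norm _) /H2_norm lecR => gn.
rewrite -[leLHS]sqr_sqrtr; first by rewrite lerXn2r ?nnegrE ?sqrtr_ge0// ltW.
by rewrite fine_ge0//; apply: nneseries_ge0 => i _ _; rewrite lee_fin sqr_ge0.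
Qed.

(* Bessel's inequality is applied to a difference of two polynomials approximating [n^{-psi}]: the
   coefficients of the finer one are close to those of [C_psi e_n], by [coef_diff_le]. *)
Lemma dpoly_approx_norm n (e k : R) : 0 < e -> e <= 1 -> 0 < k ->
  exists Q q N, dpoly_coef Q q N /\ (forall chi s, e <= Re s ->
    cn (Q chi s - character chi n.+1 ^+ c0 * npow_opp n.+1 (symbol_fun c0 (twist c chi) s)) <= k) /\
    \sum_(j < N) (cn (q j) * expR (- e * ln j.+1%:R)) ^+ 2 <= 3 * fine (sumsq (T (basis_vector R n))) + 15 * k ^+ 2.
Proof.
move=> e0 e1 k0; have [Q [q [N QN]] HQ] := dpoly_approx hpsi (ltn0Sn n) e0 k0.
exists Q, q, N; split => //; split => //; set b := T _.
(* The length [N] is fixed by the precision [k]; the second precision [l] is chosen after it, so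
   that the errors [(j + 1) l] of the coefficients have a sum of squares at most [k^2] over
   [j < N]. *)
pose A : R := \sum_(j < N) j.+1%:R ^+ 2; have A0 : 0 <= A by apply: sumr_ge0 => j _; rewrite sqr_ge0.
pose l := k / (A + 1); have A1 : 0 < A + 1 by rewrite ltr_wpDl.
have l0 : 0 < l by rewrite divr_gt0.
have lk : l <= k by rewrite ler_pdivrMr// ler_peMr ?(ltW k0)// lerDr.
have [Q' [q' [N' QN']] HQ'] := dpoly_approx hpsi (ltn0Sn n) e0 l0.
pose M := maxn N N'.
have [q0 QE] := dpoly_widen QN (leq_maxl N N'); have [q0' QE'] := dpoly_widen QN' (leq_maxr N N').
have bess : \sum_(j < M) (cn (q j - q' j) * expR (- e * ln j.+1%:R)) ^+ 2 <= (k + l) ^+ 2.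
  apply: (@bessel_dirichlet R M (fun j => q j - q' j)); first exact: ltW.
  move=> t; have -> : \sum_(j < M) (q j - q' j) * npow_opp j.+1 (e +i* t) = Q chi_one (e +i* t) - Q' chi_one (e +i* t).
    by rewrite QE QE' -sumrB; apply: eq_bigr => j _; rewrite !twist_one mulrBl.
  set g := character chi_one n.+1 ^+ c0 * npow_opp n.+1 (symbol_fun c0 (twist c chi_one) (e +i* t)).
  have -> : Q chi_one (e +i* t) - Q' chi_one (e +i* t) = (Q chi_one (e +i* t) - g) - (Q' chi_one (e +i* t) - g).
    by rewrite opprB addrA subrK.
  by apply: (le_trans (cnB _ _)); apply: lerD; [exact: HQ|exact: HQ'].
have coef j : cn (q' j - b j) <= j.+1%:R * l.
  rewrite cnBC; apply: (@coef_diff_le R b q' M); [exact: ltW|exact: q0'|move=> t].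
  have := HQ' chi_one (1 +i* t) e1; rewrite QE' character_one expr1n mul1r cnBC dirichlet_image twist_one.
  by under eq_bigr do rewrite twist_one.
(* The factor 3 comes from the square of a sum of three terms; as [k + l <= 2 k], the errors add up
   to [12 k^2 + 3 k^2]. *)
have bound j : (cn (q j) * expR (- e * ln j.+1%:R)) ^+ 2 <=
   3 * (cn (q j - q' j) * expR (- e * ln j.+1%:R)) ^+ 2 + 3 * cn (b j) ^+ 2 + 3 * l ^+ 2 * j.+1%:R ^+ 2.
  have : cn (q j) <= cn (q j - q' j) + (j.+1%:R * l + cn (b j)).
    have := cnD (q j - q' j) ((q' j - b j) + b j); rewrite !subrK => /le_trans; apply.
    have := cnD (q' j - b j) (b j); rewrite subrK => h; rewrite lerD2l.
    by apply: (le_trans h); rewrite lerD2r.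
  have : 0 <= j.+1%:R * l by rewrite mulr_ge0 ?ler0n ?ltW.
  rewrite -[3 * l ^+ 2 * _]mulrA -[l ^+ 2 * _]exprMn [l * _]mulrC.
  have E0 := expR_gt0 (- e * ln j.+1%:R).
  have E1 : expR (- e * ln j.+1%:R) <= 1.
    by rewrite -[leRHS]expR0 ler_expR mulNr oppr_le0 mulr_ge0 ?ln_nat_ge0 ?ltW.
  have := cn_ge0 (q j); have := cn_ge0 (q j - q' j); have := cn_ge0 (b j).
  move: (expR _) E0 E1 (cn (q j)) (cn (q j - q' j)) (cn (b j)) (j.+1%:R * l) => E E0 E1 x u v w v0 u0 x0 w0 xle.
  have h : x * E <= u * E + (w + v).
    apply: (@le_trans _ _ ((u + (w + v)) * E)); first by rewrite ler_wpM2r// ltW.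
    by rewrite mulrDl lerD2l ler_piMr ?addr_ge0.
  have hx : 0 <= x * E by rewrite mulr_ge0// ltW.
  have hu : 0 <= u * E by rewrite mulr_ge0// ltW.
  move: (x * E) (u * E) h hx hu => X U h hx hu.
  exact: sqr_sum3_le.
apply: (@le_trans _ _ (\sum_(j < N) (3 * (cn (q j - q' j) * expR (- e * ln j.+1%:R)) ^+ 2 +
   3 * cn (b j) ^+ 2 + 3 * l ^+ 2 * j.+1%:R ^+ 2))); first by apply: ler_sum => j _; exact: bound.
rewrite !big_split /= -!mulr_sumr -/A.
have h1 : \sum_(j < N) (cn (q j - q' j) * expR (- e * ln j.+1%:R)) ^+ 2 <= (k + l) ^+ 2.
  apply: le_trans bess; rewrite /M -(subnKC (leq_maxl N N')) big_split_ord /= lerDl.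
  by apply: sumr_ge0 => j _; rewrite sqr_ge0.
have h2 := H2_partial_le b N.
have h3 : (k + l) ^+ 2 <= (2 * k) ^+ 2 by rewrite lerXn2r ?nnegrE; lra.
have h4 : l ^+ 2 * A <= k ^+ 2.
  apply: (@le_trans _ _ (l * k)); last by rewrite expr2 ler_wpM2r// ltW.
  by rewrite expr2 -mulrA ler_wpM2l ?(ltW l0)// /l mulrAC ler_pdivrMr// ler_wpM2l ?(ltW k0)// lerDl.
rewrite exprMn in h3; lra.
Qed.

Variables (m : probability (Tinf R) R) (hm : is_torus_measure m).
Local Notation Tcyl := (g_sigma_algebraType (@cylinder R)).

Lemma measurable_Re_dirichlet (s : R[i]) : 0 < Re s ->
  measurable_fun setT (fun chi : Tcyl => Re (dirichlet (twist c chi) s)).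
Proof. by move=> s0; have [] := cmeasurable_dirichlet hpsi s0. Qed.

Lemma measurable_exp_Re (a : R) (s : R[i]) : 0 < Re s ->
  measurable_fun setT (fun chi : Tcyl => expR (a * Re (dirichlet (twist c chi) s))).
Proof.
move=> /measurable_Re_dirichlet mR; apply: measurableT_comp => //.
by apply: measurable_funM => //; exact: measurable_cst.
Qed.

Lemma integral_le_cst (f : Tinf R -> \bar R) (a : R) :
  (forall x, 0 <= f x)%E -> (forall x, f x <= a%:E)%E -> (\int[m]_(x in setT) f x <= a%:E)%E.
Proof.
move=> f0 fa; apply: (le_trans (le_integral_nonneg m f0 fa)).
rewrite -[X in (X <= _)%E]/(\int[m]_(x in setT) cst a%:E x)%E integral_cst//.
by rewrite [X in (_ * X)%E](_ : _ = 1%E) ?mule1//; exact: probability_setT.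
Qed.

Lemma sume_cst (x : \bar R) M : (\sum_(i < M) x = (M%:R)%:E * x)%E.
Proof.
elim: M => [|M IH]; first by rewrite big_ord0 mul0e.
by rewrite big_ord_recr IH -natr1 EFinD ge0_muleDl ?lee_fin ?ler0n// mul1e.
Qed.

(** By invariance the integral equals that of the mean over [M] points of an orbit of the flow; for
    each [chi] this mean is bounded by a mean square of one polynomial, with an error term common to
    all [chi]. *)
Lemma integral_exp_symbol n (e k : R) : 0 < e -> e <= 1 -> 0 < k ->
  (\int[m]_(chi in setT) (expR (- (2 * ln n.+1%:R) * Re (dirichlet (twist c chi) e%:C)))%:E <=
    (expR (2 * ln n.+1%:R * (c0%:R * e)) * (6 * fine (sumsq (T (basis_vector R n))) + 34 * k ^+ 2))%:E)%E.
Proof.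
move=> e0 e1 k0; have [Q [q [N [[q0 QE] [HQ qn]]]]] := dpoly_approx_norm n e0 e1 k0.
set S := fine _ in qn *; pose L : R := ln n.+1%:R.
have [C HC] := mean_square_dirichlet N (fun j => cn (q j)).
(* [M] is so large that the error [C] of the mean square is at most [M k^2]; the final constant is
   [34 = 2 * 15 + 2 + 2]. *)
pose M := (Num.truncn (C / k ^+ 2)).+1; pose st := sampling_step R N.
have M0 : 0 < M%:R :> R by rewrite ltr0n.
have CM : C <= M%:R * k ^+ 2 by rewrite -ler_pdivrMr ?exprn_gt0// ltW// truncnS_gt.
pose f (chi : Tinf R) := expR (- (2 * L) * Re (dirichlet (twist c chi) e%:C)).
(* [W] undoes the factor [|(n + 1)^(-c0 s)|^2] at [Re s = e], present for [psi_chi] but not for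
   [phi_chi]. *)
pose W := expR (2 * L * (c0%:R * e)).
have fE chi t : f (flow t chi) = W * cn (npow_opp n.+1 (symbol_fun c0 (twist c chi) (e +i* t))) ^+ 2.
  rewrite /f dirichlet_flow cn_npow_opp -/L -expRM_natl -expRD; congr expR.
  have -> : e%:C + (0 +i* t) = (e +i* t) :> R[i] by apply/complex_eqP; rewrite /= ?addr0 ?add0r.
  by rewrite /symbol_fun ReD ReM Re_nat Im_nat /=; ring.
have key chi : \sum_(i < M) f (flow (i%:R * st) chi) <= W * (M%:R * (6 * S + 34 * k ^+ 2)).
  under eq_bigr do rewrite fE; rewrite -mulr_sumr ler_wpM2l ?expR_ge0//.
  have cnq j : cn (twist q chi j) = cn (q j) by rewrite /twist cnM cn_character mulr1.
  have qle j : cn (twist q chi j) <= cn (q j) by rewrite cnq.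
  have := HC _ qle e M (ltW e0).
  under [X in _ * X]eq_bigr do rewrite cnq.
  rewrite ler_norml => /andP[_ h].
  have hQ i : cn (npow_opp n.+1 (symbol_fun c0 (twist c chi) (e +i* (i%:R * st)))) ^+ 2 <=
     2 * cn (Q chi (e +i* (i%:R * st))) ^+ 2 + 2 * k ^+ 2.
    have := HQ chi (e +i* (i%:R * st)) (lexx _); set g := _ ^+ c0 * _ => hg.
    have -> : cn (npow_opp n.+1 (symbol_fun c0 (twist c chi) (e +i* (i%:R * st)))) = cn g.
      by rewrite /g cnM cnX cn_character expr1n mul1r.
    have h1 : cn g <= cn (Q chi (e +i* (i%:R * st))) + k.
      have := cnB (Q chi (e +i* (i%:R * st))) (Q chi (e +i* (i%:R * st)) - g); rewrite opprB addrC subrK.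
      by move=> /le_trans; apply; rewrite lerD2l.
    have := cn_ge0 g; move: (cn g) (cn (Q _ _)) h1 => x y xy x0.
    have := sqr_ge0 (y - k); have : x ^+ 2 <= (y + k) ^+ 2 by rewrite lerXn2r ?nnegrE ?(le_trans x0).
    nra.
  apply: (@le_trans _ _ (\sum_(i < M) (2 * cn (Q chi (e +i* (i%:R * st))) ^+ 2 + 2 * k ^+ 2))).
    by apply: ler_sum => i _; exact: hQ.
  rewrite big_split /= -mulr_sumr sumr_const card_ord -[_ *+ M]mulr_natl.
  under eq_bigr do rewrite QE.
  have : M%:R * \sum_(j < N) (cn (q j) * expR (- e * ln j.+1%:R)) ^+ 2 <= M%:R * (3 * S + 15 * k ^+ 2).
    by rewrite ler_wpM2l ?ler0n.
  move: h CM; rewrite -/st; lra.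
have mf : measurable_fun setT (f : Tcyl -> R) by apply: measurable_exp_Re.
have mfE : measurable_fun setT (fun chi : Tcyl => (f chi)%:E) by exact/measurable_EFinP.
have mfl t : measurable_fun [set: Tinf R] (fun chi => (f (flow t chi))%:E).
  exact: (measurableT_comp mfE (measurable_flow t)).
set I := (\int[m]_(chi in setT) _)%E.
have IE : (\int[m]_(chi in setT) (\sum_(i < M) f (flow (i%:R * st) chi))%:E = (M%:R)%:E * I)%E.
  under eq_integral do rewrite -sumEFin.
  rewrite (@ge0_integral_sum _ _ R m setT measurableT _ (fun (i : 'I_M) chi => (f (flow (i%:R * st) chi))%:E)).
  - rewrite (eq_bigr (fun=> I)); first exact: sume_cst.
    move=> i _; apply: (@integral_flow R m hm (i%:R * st) (fun chi => (f chi)%:E) mfE).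
    by move=> x; rewrite lee_fin expR_ge0.
  - by move=> i; exact: mfl.
  - by move=> i x _; rewrite lee_fin expR_ge0.
have : ((M%:R)%:E * I <= (M%:R)%:E * (W * (6 * S + 34 * k ^+ 2))%:E)%E.
  rewrite -IE -EFinM mulrCA; apply: integral_le_cst => x; last by rewrite lee_fin key.
  by rewrite lee_fin sumr_ge0// => i _; exact: expR_ge0.
by rewrite lee_pmul2l ?lte_fin.
Qed.

End operator.

(** * The counting function *)

Section kernel_sum.
Variable R : realType.
Implicit Types (r y h : R).

Lemma inv_sqr_le (x y : R) : 0 < x -> x <= y -> (y ^+ 2)^-1 <= (x ^+ 2)^-1.
Proof.
move=> x0 xy; have y0 := lt_le_trans x0 xy.
by rewrite lef_pV2 ?posrE ?exprn_gt0// lerXn2r ?nnegrE// ltW.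
Qed.

Lemma kernel_ge r y : 0 < r -> `|y| <= r -> (2 * r)^-1 <= r / (r ^+ 2 + y ^+ 2).
Proof.
move=> r0 yr; have y2 : y ^+ 2 <= r ^+ 2 by rewrite -real_normK ?num_real// lerXn2r ?nnegrE// ltW.
have r2 : 0 < r ^+ 2 by rewrite exprn_gt0.
have -> : (2 * r)^-1 = r / (2 * r ^+ 2) by field; rewrite gt_eqF.
rewrite ler_wpM2l ?(ltW r0)// lef_pV2 ?posrE; try lra.
by rewrite ltr_pwDl// sqr_ge0.
Qed.

(** The function [y / (r + |y|)] is a substitute for the arctangent: its derivative
    [r / (r + |y|)^2] is comparable with [r / (r^2 + y^2)]. The factor 8 covers a step [h <= r] and
    the passage through 0. *)
Lemma kernel_increment r y h : 0 < r -> 0 < h -> h <= r ->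
  h / (r ^+ 2 + y ^+ 2) <= 8 / r * ((y + h) / (r + `|y + h|) - y / (r + `|y|)).
Proof.
move=> r0 h0 hr; have den : 0 < r ^+ 2 + y ^+ 2 by rewrite ltr_pwDl ?exprn_gt0 ?sqr_ge0.
have pos z : 0 <= z -> 0 < r + z by move=> ?; rewrite ltr_wpDr.
have key a b : 0 < a -> 0 < b -> a * b <= 8 * (r ^+ 2 + y ^+ 2) ->
    h / (r ^+ 2 + y ^+ 2) <= 8 / r * (r * h / (a * b)).
  move=> a0 b0 ab; have -> : 8 / r * (r * h / (a * b)) = h * (8 / (a * b)).
    by field; rewrite !gt_eqF.
  rewrite ler_pM2l// ler_pdivlMr ?mulr_gt0// mulrC ler_pdivrMr//.
have [y0|y0] := leP 0 y.
  rewrite (ger0_norm y0) ger0_norm; last by rewrite addr_ge0// ltW.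
  have -> : (y + h) / (r + (y + h)) - y / (r + y) = r * h / ((r + y) * (r + (y + h))).
    by field; rewrite !gt_eqF//; lra.
  apply: key; try lra; nra.
have [yh|yh] := leP (y + h) 0.
  rewrite (ltr0_norm y0) ler0_norm//.
  have -> : (y + h) / (r + - (y + h)) - y / (r + - y) = r * h / ((r + - y) * (r + - (y + h))).
    by field; apply/andP; split; rewrite gt_eqF//; lra.
  apply: key; try lra; nra.
rewrite (ltr0_norm y0) gtr0_norm//.
apply: (@le_trans _ _ (8 / r * (r * h / (2 * r * r)))).
  apply: key; try lra; nra.
apply: ler_wpM2l; first by rewrite divr_ge0// ltW.
have -> : r * h / (2 * r * r) = (y + h) / (r + r) - y / (r + r).
  rewrite -mulrBl addrAC subrr add0r; have -> : r + r = 2 * r by ring.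
  by field; rewrite gt_eqF.
have ip : 0 < (r + r)^-1 by rewrite invr_gt0; lra.
apply: lerD; first by apply: ler_wpM2l; [exact: ltW|rewrite lef_pV2 ?posrE; lra].
rewrite -!mulNr; apply: ler_wpM2l; first lra.
by rewrite lef_pV2 ?posrE; lra.
Qed.

(** A Riemann sum of [1 / (r^2 + y^2)]: the increments telescope, and [16 = 8 * 2] because [g] takes
    its values in [[-1, 1]]. *)
Lemma kernel_sum_le r a h n : 0 < r -> 0 < h -> h <= r ->
  \sum_(i < n) h / (r ^+ 2 + (a + i%:R * h) ^+ 2) <= 16 / r.
Proof.
move=> r0 h0 hr; pose g y := y / (r + `|y|).
have g1 y : `|g y| <= 1.
  rewrite normrM normfV [`|_ + _|]ger0_norm; last by rewrite addr_ge0// ltW.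
  by rewrite ler_pdivrMr ?ltr_pwDl// mul1r lerDr ltW.
apply: (@le_trans _ _ (8 / r * (g (a + n%:R * h) - g a))); last first.
  have := g1 (a + n%:R * h); have := g1 a; rewrite !ler_norml => /andP[? ?] /andP[? ?].
  have -> : 16 / r = 8 / r * 2 by ring.
  by apply: ler_wpM2l; [rewrite divr_ge0// ltW|lra].
elim: n => [|n IH]; first by rewrite big_ord0 mul0r addr0 subrr mulr0.
rewrite big_ord_recr /=; apply: (le_trans (lerD IH (kernel_increment _ r0 h0 hr))).
rewrite -mulrDr -/(g _) -/(g _) addrC addrA subrK.
by have -> : a + n.+1%:R * h = a + n%:R * h + h by rewrite -[n.+1%:R]natr1; ring.
Qed.

End kernel_sum.

(** * A majorant by finitely many Poisson kernels *)

Section majorant.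
Variables (R : realType) (c0 : nat) (c : nat -> R[i]).
Hypothesis hpsi : G_ge1 c0 c.
Local Notation psi chi := (symbol_fun c0 (twist c chi)).

Definition node (d : R) (J i : nat) : R := (i%:R - J%:R) * d.

(* The nodes [|j| <= J] take care of [|t| <= J d], a single wide kernel of the others. *)
Definition majorant (e : R) (w : R[i]) (d : R) (J : nat) (chi : Tinf R) : R :=
  Re w ^+ 2 * (8 * d * \sum_(i < (2 * J).+1) (cn (psi chi (e +i* node d J i) + w^*) ^+ 2)^-1 + 8 / (J%:R * d)).

(** [d] and [J] depend on [e] and [w] but not on [chi]. Within distance [d] of a node [psi_chi]
    varies by at most [Re w <= |psi_chi + conj w|], which costs a factor 2 in the modulus; far away
    the imaginary part [c0 t] dominates. *)
Lemma majorantP (e : R) (w : R[i]) : 0 < e -> 0 < Re w ->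
  exists d J, [/\ 0 < d, c0%:R * d <= Re w, 8 <= J%:R * d &
    forall chi (Z : seq R[i]) (k : R[i] -> nat), uniq Z ->
      (forall z, z \in Z -> e < Re z /\ (0 < k z)%N /\
        forall j, (j < k z)%N -> derive1n j (fun s => psi chi s - w) z = 0) ->
      \sum_(z <- Z) (k z)%:R * (Re z - e) <= majorant e w d J chi].
Proof.
move=> e0; set sg := Re w => sg0; have uc := unif_cauchy_twist hpsi.
have [B0 HB0] := dirichlet_bounded uc (coef_bounded_twist c) e0.
have [C HC] := dirichlet_taylor 1 uc (coef_bounded_twist c) e0.
(* A Lipschitz constant of [psi_chi] on the line, plus 1 for positivity; the step [d] makes the
   variation at most [sg]. *)
pose K := c0%:R + `|C| + 1; have K0 : 0 < K by rewrite ltr_wpDl// addr_ge0.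
pose d := sg / K; have d0 : 0 < d by rewrite divr_gt0.
have Kd : K * d = sg by rewrite /d mulrC divfK// gt_eqF.
pose B := `|B0| + `|Im w|; have B0' : 0 <= B by rewrite addr_ge0.
(* [B] bounds what competes with [c0 t] in the imaginary part, so that
   [|psi_chi + conj w| >= |t| / 2] beyond [W = J d]. The 8 will make the last term of [majorant],
   divided by [Re w], at most [Re w]. *)
pose J := (Num.truncn ((8 + 2 * B) / d)).+1.
have JR : 8 + 2 * B <= J%:R * d by rewrite -ler_pdivrMr// ltW// truncnS_gt.
set W := J%:R * d in JR; have W8 : 8 <= W by lra.
have WB : 2 * B <= W by lra.
exists d, J; split => //.
  by rewrite -Kd ler_wpM2r ?(ltW d0)// /K -addrA lerDl addr_ge0.
move=> chi Z k uZ HZ.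
have pR t : sg <= Re (psi chi (e +i* t) + w^*).
  have := @Re_symbol_ge R c0 c hpsi chi (e +i* t) e0; rewrite ReD Re_conj /= -/sg; lra.
have lip t t' : `|t - t'| <= d -> cn (psi chi (e +i* t) - psi chi (e +i* t')) <= sg.
  move=> tt; set h : R[i] := 0 +i* (t - t').
  have hE : (e +i* t) = (e +i* t') + h :> R[i] by apply/complex_eqP; rewrite /= ?addr0// addrC subrK.
  have ch : cn h <= d.
    by apply: le_trans (cn_le_ReIm _) _; rewrite /= normr0 add0r.
  have := HC chi (e +i* t') h (lexx _); rewrite -hE => /(_ (lexx _)).
  rewrite big_ord1 expr0 expr1 divr1 mulr1 dcoef0 => H.
  have -> : psi chi (e +i* t) - psi chi (e +i* t') = c0%:R * h +
     (dirichlet (twist c chi) (e +i* t) - dirichlet (twist c chi) (e +i* t')).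
    by rewrite /symbol_fun hE; ring.
  apply: (le_trans (cnD _ _)); rewrite cnM cn_nat -Kd.
  have h1 : c0%:R * cn h <= c0%:R * d by rewrite ler_wpM2l.
  have h2 : C * cn h <= `|C| * d.
    apply: (@le_trans _ _ (`|C| * cn h)); first by rewrite ler_wpM2r ?cn_ge0// ler_norm.
    by rewrite ler_wpM2l.
  by rewrite /K !mulrDl mul1r; lra.
pose Q : seq (R * R * R) := [seq (8 * d * (cn (psi chi (e +i* node d J i) + w^*) ^+ 2)^-1, d, node d J i)
  | i <- index_iota 0 (2 * J).+1] ++ [:: (8 / W, W, 0)].
have W0 : 0 < W by lra.
have a0 i : 0 <= 8 * d * (cn (psi chi (e +i* node d J i) + w^*) ^+ 2)^-1.
  by rewrite mulr_ge0 ?invr_ge0 ?sqr_ge0// mulr_ge0// ltW.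
have := @littlewood_inequality R (psi chi) w e Z k Q e0 sg0 (Re_symbol_ge hpsi chi) (jet3_symbol hpsi chi) uZ.
have -> : Re w ^+ 2 * \sum_(q <- Q) q.1.1 = majorant e w d J chi.
  by rewrite /Q big_cat big_map big_seq1 /= big_mkord /majorant mulr_sumr.
apply.
- move=> z /HZ[ez [kz Hz]]; split => //; split => //.
  by apply: (symbol_order hpsi) => //; exact: lt_trans ez.
- move=> q; rewrite mem_cat => /orP[/mapP[i _ ->]|].
    by split=> //=; exact: a0.
  by rewrite inE => /eqP -> /=; rewrite divr_ge0// ltW.
move=> t; rewrite /Q big_cat big_map big_seq1 /= subr0.
set p := psi chi (e +i* t) + w^*.
have kp (x y : R) : 0 < x -> 0 < x / (x ^+ 2 + y ^+ 2).
  by move=> x0; rewrite divr_gt0// ltr_pwDl ?exprn_gt0 ?sqr_ge0.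
have p0 : 0 < cn p by apply: lt_le_trans sg0 (le_trans (pR t) (Re_le_cn _)).
have [tW|tW] := lerP `|t| W.
  apply: (@le_trans _ _ (\sum_(0 <= i < (2 * J).+1) 8 * d * (cn (psi chi (e +i* node d J i) + w^*) ^+ 2)^-1 *
     (d / (d ^+ 2 + (t - node d J i) ^+ 2)))); last first.
    by rewrite lerDl mulr_ge0// ?ltW// ?kp// divr_gt0.
  have tJ : 0 <= t / d + J%:R.
    by move: tW; rewrite ler_norml => /andP[h _]; rewrite -lerBlDr sub0r ler_pdivlMr// mulNr.
  pose i := Num.truncn (t / d + J%:R).
  have /andP[i1 i2] := truncn_itv tJ; rewrite -/i in i1 i2.
  have iJ : (i < (2 * J).+1)%N.
    rewrite ltnS -(ler_nat R) (le_trans i1)// mul2n -addnn natrD lerD2r ler_pdivrMr//.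
    by move: tW; rewrite ler_norml => /andP[].
  rewrite big_mkord (bigD1 (Ordinal iJ)) //= -[leLHS]addr0; apply: lerD; last first.
    by apply: sumr_ge0 => j _; rewrite mulr_ge0// ltW// kp.
  have tE : t - node d J i = (t / d + J%:R - i%:R) * d by rewrite /node; field; rewrite gt_eqF.
  have td : `|t - node d J i| <= d.
    rewrite tE normrM (gtr0_norm d0) ler_piMl ?(ltW d0)// ger0_norm ?subr_ge0//.
    by rewrite lerBlDl natr1 ltW.
  set pj := psi chi (e +i* node d J i) + w^*.
  have pj0 : 0 < cn pj by apply: lt_le_trans sg0 (le_trans (pR _) (Re_le_cn _)).
  have pjp : cn pj <= 2 * cn p.
    have h1 : cn (pj - p) <= sg by rewrite /pj /p opprD addrACA subrr addr0 lip// distrC.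
    have h2 : sg <= cn p by apply: le_trans (pR t) (Re_le_cn _).
    by have := cnD (pj - p) p; rewrite subrK; lra.
  (* The kernel of this node is at least [1 / (2 d)] at [t], and the weight [8 d] leaves [4 = 2^2],
     which pays for the factor 2 in [pjp]. *)
  have q1 := kernel_ge d0 td.
  apply: (@le_trans _ _ (8 * d * (cn pj ^+ 2)^-1 * (2 * d)^-1)); last exact: (ler_wpM2l (a0 i) q1).
  have -> : 8 * d * (cn pj ^+ 2)^-1 * (2 * d)^-1 = ((cn pj / 2) ^+ 2)^-1.
    by field; rewrite !gt_eqF.
  by apply: inv_sqr_le; [exact: divr_gt0|rewrite ler_pdivrMr// mulrC].
apply: (@le_trans _ _ (8 / W * (W / (W ^+ 2 + t ^+ 2)))); last first.
  by rewrite lerDr sumr_ge0// => j _; rewrite mulr_ge0// ltW// kp.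
have tp : `|t| / 2 <= cn p.
  apply: le_trans (ler_Im _).
  rewrite /p ImD Im_conj /symbol_fun ImD ImM Re_nat Im_nat mul0r addr0 /=.
  have [_ hB] := HB0 chi (e +i* t) (lexx _).
  set D := Im _; have DB : `|D| <= `|B0| by apply: (le_trans (ler_Im _)); apply: (le_trans hB); exact: ler_norm.
  have h1 : `|t| <= `|c0%:R * t|.
    by rewrite normrM normr_nat ler_peMl// ler1n (G_ge1_c0 hpsi).
  have h2 := ler_normB (c0%:R * t + D - Im w) (D - Im w).
  have h3 := ler_normB D (Im w).
  have e1 : c0%:R * t + D - Im w - (D - Im w) = c0%:R * t by ring.
  rewrite e1 in h2; rewrite /B in WB; lra.
have -> : 8 / W * (W / (W ^+ 2 + t ^+ 2)) = 8 / (W ^+ 2 + t ^+ 2).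
  by field; rewrite !gt_eqF// ltr_pwDl ?exprn_gt0 ?sqr_ge0.
have t0 : 0 < `|t| by lra.
apply: (@le_trans _ _ ((`|t| / 2) ^+ 2)^-1).
  by apply: inv_sqr_le; first exact: divr_gt0.
rewrite expr_div_n real_normK ?num_real// invf_div ler_pdivlMr ?ltr_pwDl ?exprn_gt0 ?sqr_ge0//.
have t2 : 0 < t ^+ 2 by rewrite -real_normK ?num_real// exprn_gt0.
rewrite mulrAC ler_pdivrMr//.
have : W ^+ 2 <= t ^+ 2 by rewrite -[t ^+ 2]real_normK ?num_real// lerXn2r ?nnegrE// ltW.
lra.
Qed.

End majorant.

Section limits_inferior.
Variable R : realType.
Implicit Types u : nat -> \bar R.

Lemma limn_einfE u : limn_einf u = ereal_sup (range (einfs u)).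
Proof. by rewrite limn_einf_lim; apply: cvg_lim => //; exact: cvg_einfs_sup. Qed.

Lemma limn_einf_ge u (x : R) : (forall d : R, 0 < d -> exists N, forall n, (N <= n)%N -> ((x - d)%:E <= u n)%E) ->
  (x%:E <= limn_einf u)%E.
Proof.
move=> H; rewrite limn_einfE.
apply/lee_addgt0Pr => d /H[N HN]; rewrite -leeBlDr// -EFinB.
apply: (@le_trans _ _ (einfs u N)); last by apply: ereal_sup_ubound; exists N.
by apply: le_ereal_inf_tmp => _ [n /= Nn <-]; exact: HN.
Qed.

Lemma limn_einf_le u (x : \bar R) N : (forall n, (N <= n)%N -> (u n <= x)%E) -> (limn_einf u <= x)%E.
Proof.
move=> H; rewrite limn_einfE.
apply: ge_ereal_sup => _ [n _ <-]; apply: le_trans (H (maxn n N) (leq_maxr _ _)).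
by apply: ereal_inf_lbound; exists (maxn n N) => //=; rewrite leq_maxl.
Qed.

End limits_inferior.

Section counting.
Variable R : realType.
Implicit Types (f psi : R[i] -> R[i]) (z w : R[i]).

Definition vanish f z (k : nat) := forall j, (j < k)%N -> derive1n j f z = 0.

Lemma order_of_zero_cases f z : (forall n, exists2 k, (n <= k)%N & vanish f z k) \/
  exists2 k : nat, vanish f z k & order_of_zero f z = (k%:R)%:E.
Proof.
have [[n Hn]|H] := pselect (exists n, forall k, vanish f z k -> (k <= n)%N); last first.
  left=> n; apply: contrapT => Hk; apply: H; exists n => k vk; rewrite leqNgt; apply/negP => nk.
  by apply: Hk; exists k => //; exact: ltnW.
right; have ex : exists k, `[< vanish f z k >] by exists 0%N; apply/asboolP.
have bd k : `[< vanish f z k >] -> (k <= n)%N by move=> /asboolP; exact: Hn.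
exists (ex_maxn ex bd); first by case: ex_maxnP => k /asboolP.
case: ex_maxnP => k /asboolP vk km; apply/eqP; rewrite eq_le; apply/andP; split.
  by apply: ge_ereal_sup => _ [l /= vl <-]; rewrite lee_fin ler_nat km//; apply/asboolP.
by apply: ereal_sup_ubound; exists k.
Qed.

Lemma order_of_zero_ge0 f z : (0 <= order_of_zero f z)%E.
Proof. by apply: ereal_sup_ubound; exists 0%N. Qed.

(** The sum is a supremum over finite sets of preimages, and each order is itself a supremum. At a
    zero of infinite order the hypothesis, used with arbitrarily large [k], forces [L = +oo]. *)
Lemma counting_fun_le psi w (L : \bar R) :
  (forall (Z : seq R[i]) (k : R[i] -> nat), uniq Z ->
    (forall z, z \in Z -> 0 < Re z /\ (0 < k z)%N /\ vanish (fun s => psi s - w) z (k z)) ->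
    ((\sum_(z <- Z) (k z)%:R * Re z)%:E <= L)%E) ->
  (counting_fun psi w <= L)%E.
Proof.
move=> H; apply: ge_ereal_sup => _ [A [finA AS] <-].
have [Z0 uZ0 AZ] : exists2 Z0, uniq Z0 & A = [set` Z0].
  have /finite_seqP[Z0 ->] := finA; exists (undup Z0); first exact: undup_uniq.
  by apply/seteqP; split=> z /=; rewrite mem_undup.
rewrite {}AZ in AS *; rewrite -fsbig_seq//.
set f := fun s => psi s - w.
have Rz z : z \in Z0 -> 0 < Re z by move=> /AS[].
have [[z zZ0 Hz]|Hk] := pselect (exists2 z, z \in Z0 & forall n, exists2 k, (n <= k)%N & vanish f z k).
  suff -> : L = +oo%E by rewrite leey.
  apply/eqyP => B B0; have z0 := Rz z zZ0.
  have [k nk vk] := Hz (Num.truncn (B / Re z)).+1.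
  apply: (le_trans _ (H [:: z] (fun=> k) isT _)).
    by rewrite big_seq1 lee_fin -ler_pdivrMr// ltW// (lt_le_trans (truncnS_gt _))// ler_nat.
  by move=> z'; rewrite inE => /eqP ->; split => //; split => //; exact: leq_trans nk.
have /choice[k Hkk] : forall z, exists k : nat, z \in Z0 -> vanish f z k /\ order_of_zero f z = (k%:R)%:E.
  move=> z; have [zZ|zZ] := boolP (z \in Z0); last by exists 0%N.
  have [h|[k vk ok]] := order_of_zero_cases f z; last by exists k.
  by exfalso; apply: Hk; exists z.
have -> : (\sum_(z <- Z0) order_of_zero f z * (Re z)%:E = (\sum_(z <- [seq z <- Z0 | (0 < k z)%N]) (k z)%:R * Re z)%:E)%E.
  rewrite big_filter [in RHS]big_mkcond /= -sumEFin big_seq [RHS]big_seq; apply: eq_bigr => z /Hkk[_ ->].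
  by case: (posnP (k z)) => [->|//]; rewrite -EFinM mul0r.
apply: H; first exact: filter_uniq.
move=> z; rewrite mem_filter => /andP[kz zZ]; split; first exact: Rz.
by split=> //; have [] := Hkk z zZ.
Qed.

End counting.

(** * Averages over the torus *)

Section average.
Variables (R : realType) (c0 : nat) (c : nat -> R[i]).
Hypothesis hpsi : G_ge1 c0 c.
Variables (m : probability (Tinf R) R) (hm : is_torus_measure m).
Local Notation Tcyl := (g_sigma_algebraType (@cylinder R)).

(** The flow by [t] translates the argument of [phi_chi] but leaves the linear term alone; once it
    is undone, [t] remains only in [c0 (e + i t)]. *)
Definition flow_kernel (e : R) (w : R[i]) (t : R) (chi : Tinf R) : R :=
  (cn (c0%:R * (e +i* t) + dirichlet (twist c chi) e%:C + w^*) ^+ 2)^-1.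

Lemma flow_kernelE e w t chi : flow_kernel e w t (flow t chi) =
  (cn (symbol_fun c0 (twist c chi) (e +i* t) + w^*) ^+ 2)^-1.
Proof.
rewrite /flow_kernel dirichlet_flow /symbol_fun; have -> // : e%:C + (0 +i* t) = (e +i* t) :> R[i].
by apply/complex_eqP; rewrite /= ?addr0 ?add0r.
Qed.

Lemma flow_kernel_ge0 e w t chi : 0 <= flow_kernel e w t chi.
Proof. by rewrite invr_ge0 sqr_ge0. Qed.

Lemma measurable_flow_kernel e w t : 0 < e -> measurable_fun setT (flow_kernel e w t : Tcyl -> R).
Proof.
move=> e0; have -> : flow_kernel e w t =
    (fun chi => (cn (c0%:R * (e +i* t) + dirichlet (twist c chi) e%:C + w^*) ^+ 2) `^ (-1)).
  by apply/funext => chi; rewrite powR_inv1 ?sqr_ge0.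
apply: (measurableT_comp (measurable_powR (-1))); apply: measurable_cn_sqr.
apply: cmeasurableD; last exact: cmeasurable_cst.
apply: cmeasurableD; first exact: cmeasurable_cst.
exact: (cmeasurable_dirichlet hpsi).
Qed.

Lemma integral_flow_sum n (t : nat -> R) (a : nat -> Tcyl -> R) :
  (forall i, measurable_fun setT (a i)) -> (forall i x, 0 <= a i x) ->
  (\int[m]_(chi in setT) (\sum_(i < n) a i (flow (t i) chi))%:E =
   \int[m]_(chi in setT) (\sum_(i < n) a i chi)%:E)%E.
Proof.
move=> ma a0; have mE i : measurable_fun setT (fun chi : Tcyl => (a i chi)%:E) by exact/measurable_EFinP.
have mfl i : measurable_fun [set: Tinf R] (fun chi => (a i (flow (t i) chi))%:E).
  exact: (measurableT_comp (mE i) (measurable_flow (t i))).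
have mid i : measurable_fun [set: Tinf R] (fun chi => (a i chi)%:E).
  exact: (measurableT_comp (mE i) (@measurable_id_cylinder R)).
under eq_integral do rewrite -sumEFin.
rewrite (@ge0_integral_sum _ _ R m setT measurableT _ (fun (i : 'I_n) chi => (a i (flow (t i) chi))%:E)).
- under [RHS]eq_integral do rewrite -sumEFin.
  rewrite (@ge0_integral_sum _ _ R m setT measurableT _ (fun (i : 'I_n) chi => (a i chi)%:E)).
  + by apply: eq_bigr => i _; apply: (@integral_flow R m hm (t i) (fun chi => (a i chi)%:E) (mE i)) => x; rewrite lee_fin.
  + by move=> i; exact: mid.
  + by move=> i x _; rewrite lee_fin.
- by move=> i; exact: mfl.
- by move=> i x _; rewrite lee_fin.
Qed.

(* Split at [r = 1 / L], where [exp (- 2 L r) = exp (- 2)]. *)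
Lemma ratio_le_exp (s r L : R) : 0 < s -> 0 <= r -> 0 < L ->
  s / (s + r) <= s * L + expR 2 * expR (- (2 * L) * r).
Proof.
move=> s0 r0 L0; have sr : 0 < s + r by lra.
have [h|h] := leP 1 (r * L).
  apply: (@le_trans _ _ (s * L)); last by rewrite lerDl mulr_ge0 ?expR_ge0.
  rewrite ler_pdivrMr// -mulrA ler_peMr ?(ltW s0)// mulrDr; have : 0 < L * s by rewrite mulr_gt0.
  lra.
apply: (@le_trans _ _ 1); first by rewrite ler_pdivrMr// mul1r lerDl.
apply: (@le_trans _ _ (expR 2 * expR (- (2 * L) * r))); last by rewrite lerDr mulr_ge0 ?ltW.
rewrite -expRD -[leLHS]expR0 ler_expR; lra.
Qed.

(** With the same [phi_chi e] at all nodes, the real part is a constant [r] and the imaginary parts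
    form an arithmetic progression of step [c0 d <= r], to which [kernel_sum_le] applies;
    [128 = 8 * 16]. *)
Lemma kernel_average_le e w d J chi : 0 < e -> 0 < Re w -> 0 < d -> c0%:R * d <= Re w ->
  8 * d * \sum_(i < (2 * J).+1) flow_kernel e w (node d J i) chi <= 128 / (Re w + Re (dirichlet (twist c chi) e%:C)).
Proof.
move=> e0; set sg := Re w => sg0 d0 cd.
set D := dirichlet _ _; have D0 : 0 <= Re D by exact: (Re_twist_ge0 hpsi).
have c1 : 1 <= c0%:R :> R by rewrite ler1n (G_ge1_c0 hpsi).
pose h := c0%:R * d; have dh : d <= h by rewrite ler_peMl// ltW.
pose r := c0%:R * e + Re D + sg.
have ce : 0 < c0%:R * e by rewrite mulr_gt0//; lra.
have r0 : 0 < r by rewrite /r; lra.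
pose a := Im D - Im w - c0%:R * (J%:R * d).
have hr : h <= r by apply: (le_trans cd); rewrite /r; lra.
have term i : d * flow_kernel e w (node d J i) chi <= h / (r ^+ 2 + (a + i%:R * h) ^+ 2).
  rewrite /flow_kernel cn_sqr -/D; set x := Re _; set y := Im _.
  have -> : x = r by rewrite /x /r !ReD ReM Re_nat Im_nat Re_conj /=; ring.
  have -> : y = a + i%:R * h by rewrite /y /a /h /node !ImD ImM Re_nat Im_nat Im_conj /=; ring.
  by rewrite ler_wpM2r// invr_ge0 addr_ge0 ?sqr_ge0.
rewrite -mulrA mulr_sumr; apply: (@le_trans _ _ (8 * (16 / r))).
  apply: ler_wpM2l => //; apply: le_trans (kernel_sum_le a (2 * J).+1 r0 (lt_le_trans d0 dh) hr).
  by apply: ler_sum => i _; exact: term.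
have -> : 8 * (16 / r) = 128 / r by ring.
apply: ler_wpM2l => //; rewrite lef_pV2 ?posrE; rewrite /r; lra.
Qed.

Lemma integral_majorant_le e w d J (n : nat) (S : R) : 0 < e -> 0 < Re w -> 0 < d -> c0%:R * d <= Re w ->
  8 <= J%:R * d -> (0 < n)%N -> 0 <= S ->
  (\int[m]_(chi in setT) (expR (- (2 * ln n.+1%:R) * Re (dirichlet (twist c chi) e%:C)))%:E <= S%:E)%E ->
  (\int[m]_(chi in setT) ((Re w)^-1 * majorant c0 c e w d J chi)%:E <=
     (Re w + 128 * (Re w * ln n.+1%:R) + 128 * expR 2 * S)%:E)%E.
Proof.
move=> e0; set sg := Re w => sg0 d0 cd J8 n0 S0 HS.
set L : R := ln n.+1%:R in HS *; have L0 : 0 < L by rewrite ln_gt0// ltr1n.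
pose n' := (2 * J).+1; have n'0 : n'%:R != 0 :> R by rewrite pnatr_eq0.
have W0 : 0 < J%:R * d by lra.
pose b := 8 * sg / (J%:R * d); have b1 : b <= sg.
  by rewrite /b ler_pdivrMr// [8 * sg]mulrC; apply: ler_wpM2l => //; exact: ltW.
have b0 : 0 <= b by apply: divr_ge0; [rewrite mulr_ge0 ?ltW|exact: ltW].
(* The constant term of the majorant is spread evenly over the nodes, so that the whole is a sum of
   functions each composed with its own flow. *)
pose a i chi := sg * (8 * d) * flow_kernel e w (node d J i) chi + b / n'%:R.
have k0 : 0 <= sg * (8 * d) by rewrite !mulr_ge0 ?ltW.
have bn0 : 0 <= b / n'%:R by apply: divr_ge0.
have a0 i chi : 0 <= a i chi.
  by apply: addr_ge0 => //; apply: mulr_ge0 => //; exact: flow_kernel_ge0.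
have ma i : measurable_fun setT (a i : Tcyl -> R).
  apply: measurable_funD; last exact: measurable_cst.
  by apply: measurable_funM; [exact: measurable_cst|exact: measurable_flow_kernel].
have alg X : sg^-1 * (sg ^+ 2 * (8 * d * X + 8 / (J%:R * d))) = sg * (8 * d) * X + b.
  rewrite /b; move: (J%:R * d) (lt0r_neq0 W0) => W W0'; rewrite expr2 !mulrA mulVf ?gt_eqF// mul1r.
  by rewrite mulrDr !mulrA [sg * 8]mulrC.
have bsum : \sum_(i < n') b / n'%:R = b.
  by rewrite sumr_const card_ord -[LHS]mulr_natr divfK.
have -> : (\int[m]_(chi in setT) (sg^-1 * majorant c0 c e w d J chi)%:E =
   \int[m]_(chi in setT) (\sum_(i < n') a i (flow (node d J i) chi))%:E)%E.
  apply: eq_integral => chi _; congr (_%:E); rewrite /a big_split /= bsum -mulr_sumr.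
  under [in RHS]eq_bigr do rewrite flow_kernelE.
  exact: alg.
rewrite (integral_flow_sum _ (fun i => node d J i) ma a0).
pose f (chi : Tcyl) := expR (- (2 * L) * Re (dirichlet (twist c chi) e%:C)).
have mf : measurable_fun setT (fun chi : Tcyl => (f chi)%:E).
  by apply/measurable_EFinP; exact: (measurable_exp_Re hpsi).
have mfT : measurable_fun [set: Tinf R] (fun chi : Tinf R => (f chi)%:E).
  exact: (measurableT_comp mf (@measurable_id_cylinder R)).
apply: (@le_trans _ _ (\int[m]_(chi in setT) ((sg + 128 * (sg * L))%:E + (128 * expR 2)%:E * (f chi)%:E))%E).
  apply: le_integral_nonneg => chi; first by rewrite lee_fin sumr_ge0.
  rewrite -EFinM -EFinD lee_fin /a big_split /= bsum -mulr_sumr.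
  have h1 := kernel_average_le J chi e0 sg0 d0 cd; rewrite -/sg in h1.
  have D0 : 0 <= Re (dirichlet (twist c chi) e%:C) by exact: (Re_twist_ge0 hpsi).
  have h2 := ratio_le_exp sg0 D0 L0; rewrite -/(f chi) in h2.
  rewrite -mulrA; set X := 8 * d * _ in h1 *.
  have h3 : sg * X <= 128 * (sg / (sg + Re (dirichlet (twist c chi) e%:C))).
    by rewrite [leRHS]mulrCA; apply: ler_wpM2l h1; exact: ltW.
  lra.
rewrite ge0_integralD//=.
- rewrite ge0_integralZl_EFin//; last by move=> chi _; rewrite lee_fin expR_ge0.
  rewrite [in leRHS]EFinD; apply: leeD.
    apply: (@integral_le_cst R m (fun=> (sg + 128 * (sg * L))%:E)) => // _.
    by rewrite lee_fin addr_ge0 ?mulr_ge0 ?ltW.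
  by rewrite [(_ * S)%:E]EFinM lee_wpmul2l// lee_fin mulr_ge0 ?expR_ge0.
- by move=> _ _; rewrite lee_fin addr_ge0 ?mulr_ge0 ?ltW.
- by move=> chi _; rewrite -EFinM lee_fin mulr_ge0 ?expR_ge0// mulr_ge0 ?expR_ge0.
- exact: measurable_funeM.
Qed.

End average.

Section counting_average.
Variables (R : realType) (c0 : nat) (c : nat -> R[i]).
Hypothesis hpsi : G_ge1 c0 c.
Variables (m : probability (Tinf R) R) (hm : is_torus_measure m).
Local Notation Tcyl := (g_sigma_algebraType (@cylinder R)).

Lemma measurable_majorant e w d J : 0 < e ->
  measurable_fun [set: Tinf R] (fun chi => ((Re w)^-1 * majorant c0 c e w d J chi)%:E).
Proof.
move=> e0.
suff mf : measurable_fun setT (fun chi : Tcyl => ((Re w)^-1 * majorant c0 c e w d J chi)%:E).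
  exact: (measurableT_comp mf (@measurable_id_cylinder R)).
apply/measurable_EFinP; rewrite /majorant.
do 2 (apply: measurable_funM; first exact: measurable_cst).
apply: measurable_funD; last exact: measurable_cst.
apply: measurable_funM; first exact: measurable_cst.
apply: measurable_sum => i.
have -> : (fun chi : Tcyl => (cn (symbol_fun c0 (twist c chi) (e +i* node d J i) + w^*) ^+ 2)^-1) =
    (fun chi => (cn (symbol_fun c0 (twist c chi) (e +i* node d J i) + w^*) ^+ 2) `^ (-1)).
  by apply/funext => chi; rewrite powR_inv1 ?sqr_ge0.
apply: (measurableT_comp (measurable_powR (-1))); apply: measurable_cn_sqr.
apply: cmeasurableD; last exact: cmeasurable_cst.
apply: cmeasurableD; first exact: cmeasurable_cst.
exact: (cmeasurable_dirichlet hpsi).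
Qed.

Lemma majorant_ge0 e w d J chi : 0 <= d -> 0 <= majorant c0 c e w d J chi.
Proof.
move=> d0; rewrite mulr_ge0 ?sqr_ge0// addr_ge0 ?divr_ge0 ?mulr_ge0//.
by apply: sumr_ge0 => i _; rewrite invr_ge0 sqr_ge0.
Qed.

Lemma harmonic_small (k : R) : 0 < k -> exists N : nat, forall n, (N <= n)%N -> n.+1%:R^-1 < k.
Proof.
move=> k0; exists (Num.truncn k^-1) => n Nn.
rewrite -[ltRHS]invrK ltf_pV2 ?posrE ?invr_gt0//.
by apply: (lt_le_trans (truncnS_gt _)); rewrite ler_nat ltnS.
Qed.

(** Fatou's lemma along [e = 1 / (l + 1)]; being a lower limit, the right-hand side only sees the
    ranks from [N] on. *)
Lemma integral_counting_le w (n N : nat) (S : R) : 0 < Re w -> (0 < n)%N -> 0 <= S ->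
  (forall l, (N <= l)%N ->
    (\int[m]_(chi in setT) (expR (- (2 * ln n.+1%:R) * Re (dirichlet (twist c chi) (l.+1%:R^-1 : R)%:C)))%:E <= S%:E)%E) ->
  (\int[m]_(chi in setT) (counting_fun (symbol_fun c0 (twist c chi)) w * ((Re w)^-1)%:E) <=
    (Re w + 128 * (Re w * ln n.+1%:R) + 128 * expR 2 * S)%:E)%E.
Proof.
set sg := Re w => sg0 n0 S0 HS; pose e (l : nat) : R := l.+1%:R^-1.
have e0 l : 0 < e l by rewrite invr_gt0.
have /choice[dJ HdJ] : forall l, exists dJ : R * nat, [/\ 0 < dJ.1, c0%:R * dJ.1 <= Re w, 8 <= dJ.2%:R * dJ.1 &
    forall chi (Z : seq R[i]) (k : R[i] -> nat), uniq Z ->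
      (forall z, z \in Z -> e l < Re z /\ (0 < k z)%N /\
        forall j, (j < k z)%N -> derive1n j (fun s => symbol_fun c0 (twist c chi) s - w) z = 0) ->
      \sum_(z <- Z) (k z)%:R * (Re z - e l) <= majorant c0 c (e l) w dJ.1 dJ.2 chi].
  by move=> l; have [d [J H]] := majorantP hpsi (e0 l) sg0; exists (d, J).
pose Y l chi := (sg^-1 * majorant c0 c (e l) w (dJ l).1 (dJ l).2 chi)%:E.
have Y0 l chi : (0 <= Y l chi)%E.
  by have [d0 _ _ _] := HdJ l; rewrite lee_fin mulr_ge0 ?invr_ge0 ?majorant_ge0// ltW.
have ptw chi : (counting_fun (symbol_fun c0 (twist c chi)) w * (sg^-1)%:E <= limn_einf (Y ^~ chi))%E.
  rewrite lee_pdivrMr//; apply: counting_fun_le => Z k uZ HZ.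
  set x := \sum_(z <- Z) _.
  suff h : ((x / sg)%:E <= limn_einf (Y ^~ chi))%E.
    have -> : x%:E = ((x / sg)%:E * sg%:E)%E by rewrite -EFinM divfK// gt_eqF.
    by rewrite lee_wpmul2r// lee_fin ltW.
  pose K : R := \sum_(z <- Z) (k z)%:R; have K0 : 0 <= K by apply: sumr_ge0.
  (* A finite set of zeros stays at a positive distance from [Re s = 0], so it lies in [Re s > e l]
     from some rank on, and subtracting [e l] from each real part costs [K * e l]. *)
  have [r r0 rZ] : exists2 r : R, 0 < r & forall z, z \in Z -> r < Re z.
    elim: {uZ x K K0} Z HZ => [|z Z IH] HZ; first by exists 1.
    have [|r r0 rZ] := IH; first by move=> z' z'Z; apply: HZ; rewrite inE z'Z orbT.
    have [z0 _] := HZ z (mem_head _ _).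
    exists (Num.min r (Re z / 2)); first by rewrite lt_min r0 divr_gt0.
    move=> z'; rewrite inE => /orP[/eqP ->|/rZ h]; rewrite gt_min ?h//.
    by apply/orP; right; lra.
  apply: limn_einf_ge => d d0.
  have q0 : 0 < Num.min r (d * sg / (K + 1)) by rewrite lt_min r0 divr_gt0 ?mulr_gt0// ltr_wpDl.
  have [N0 HN0] := harmonic_small q0; exists N0 => l /HN0; rewrite -/(e l) lt_min => /andP[er eK].
  have [_ _ _ HM] := HdJ l; rewrite lee_fin.
  have := HM chi Z k uZ.
  have -> : \sum_(z <- Z) (k z)%:R * (Re z - e l) = x - K * e l.
    by rewrite /x /K mulr_suml -sumrB; apply: eq_bigr => z _; rewrite mulrBr.
  move=> /(_ _)/wrap[]; first by move=> z zZ; have [_ hz] := HZ z zZ; split => //; exact: lt_trans (rZ z zZ).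
  move=> h; rewrite ler_pdivlMl//; apply: le_trans h.
  rewrite mulrBr [sg * (x / sg)]mulrC divfK ?gt_eqF// lerB//.
  apply: (@le_trans _ _ ((K + 1) * e l)); first by rewrite ler_wpM2r ?(ltW (e0 l))// lerDl.
  by rewrite mulrC [sg * d]mulrC -ler_pdivlMr ?ltW// ltr_wpDl.
apply: (le_trans (le_integral_nonneg m _ ptw)).
  move=> chi; rewrite mule_ge0 ?lee_fin ?invr_ge0 ?(ltW sg0)//.
  by apply: esum_ge0 => z [z0 _]; rewrite mule_ge0 ?order_of_zero_ge0// lee_fin ltW.
have fat := @fatou _ _ R m setT measurableT Y (fun l => measurable_majorant w (dJ l).1 (dJ l).2 (e0 l)) (fun l x _ => Y0 l x).
apply: (le_trans fat); apply: (@limn_einf_le _ _ _ N) => l Nl.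
have [d0 cd J8 _] := HdJ l.
exact: (integral_majorant_le hpsi hm (e0 l) sg0 d0 cd J8 n0 S0 (HS l Nl)).
Qed.

End counting_average.

Theorem theorem1p3 (R : realType) (m : probability (Tinf R) R)
    (hm : is_torus_measure m)
    (c0 : nat) (c : nat -> R[i]) (hpsi : G_ge1 c0 c)
    (C_psi : {linear H2 R -> H2 R})
    (hC : is_composition_operator (symbol_fun c0 c) C_psi)
    (hcompact : compact_operator C_psi) :
  (\int[m]_(chi in [set: Tinf R])
     (counting_fun (symbol_fun c0 (twist c chi)) w * ((complex.Re w)^-1)%:E))%E
    @[w --> @Re_to_0plus R] --> 0%E.
Proof.
pose g w := (\int[m]_(chi in setT) (counting_fun (symbol_fun c0 (twist c chi)) w * ((Re w)^-1)%:E))%E.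
have g0 w : 0 < Re w -> (0 <= g w)%E.
  move=> w0; apply: integral_ge0 => chi _; rewrite mule_ge0 ?lee_fin ?invr_ge0 ?(ltW w0)//.
  by apply: esum_ge0 => z [z0 _]; rewrite mule_ge0 ?order_of_zero_ge0// lee_fin ltW.
have small (k : R) : 0 < k -> exists2 d : R, 0 < d & forall w, 0 < Re w < d -> (g w <= k%:E)%E.
  (* [40 = 6 + 34] comes from [integral_exp_symbol] with both quantities at most [h^2], [expR 1]
     bounds its exponential for small [e], and [128 * expR 2] is the factor in
     [integral_counting_le]. *)
  move=> k0; pose A : R := 128 * expR 2 * (expR 1 * 40).
  have A0 : 0 < A by rewrite !mulr_gt0 ?expR_gt0.
  pose h := Num.min 1 (k / 2 / A).
  have h0 : 0 < h by rewrite lt_min ltr01 !divr_gt0.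
  have h1 : h <= 1 by rewrite ge_min lexx.
  have hk : A * h ^+ 2 <= k / 2.
    apply: (@le_trans _ _ (A * h)); first by rewrite ler_wpM2l ?(ltW A0)// expr2 ler_piMl// ltW.
    by rewrite mulrC -ler_pdivlMr// ge_min lexx orbT.
  have [n n0 Tn] := exists_small_image hpsi hC hcompact h0.
  pose L : R := ln n.+1%:R; have L0 : 0 <= L by exact: ln_nat_ge0.
  pose S := expR 1 * (40 * h ^+ 2).
  have S0 : 0 <= S by rewrite mulr_ge0 ?expR_ge0// mulr_ge0 ?sqr_ge0.
  have B0 : 0 < 2 * L * c0%:R + 1 by rewrite ltr_wpDl// !mulr_ge0.
  have [N HN] : exists N, forall l, (N <= l)%N -> (l.+1%:R^-1 : R) < (2 * L * c0%:R + 1)^-1.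
    by apply: harmonic_small; rewrite invr_gt0.
  have HS l : (N <= l)%N -> (\int[m]_(chi in setT) (expR (- (2 * L) * Re (dirichlet (twist c chi) (l.+1%:R^-1 : R)%:C)))%:E <= S%:E)%E.
    move=> /HN lN; have l0 : 0 < (l.+1%:R^-1 : R) by rewrite invr_gt0.
    have l1 : (l.+1%:R^-1 : R) <= 1 by rewrite invf_le1// ler1n.
    apply: (le_trans (integral_exp_symbol hpsi hC hm n l0 l1 h0)); rewrite lee_fin.
    have T0 : 0 <= fine (sumsq (C_psi (basis_vector R n))).
      by apply: le_trans (H2_partial_le _ 0); rewrite big_ord0.
    apply: ler_pM; [exact: expR_ge0| | |lra].
      by apply: addr_ge0; apply: mulr_ge0 => //; exact: sqr_ge0.
    rewrite ler_expR mulrA; apply: (@le_trans _ _ ((2 * L * c0%:R + 1) * l.+1%:R^-1)).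
      by rewrite ler_wpM2r ?(ltW l0)// lerDl.
    by rewrite -ler_pdivlMl// mulr1 ltW.
  have D0 : 0 < 1 + 128 * L by rewrite ltr_wpDr// mulr_ge0.
  (* [n], hence [L], is fixed by now, so the terms proportional to [Re w] can be made at most
     [k / 2]. *)
  exists (k / 2 / (1 + 128 * L)); first by rewrite !divr_gt0.
  move=> w /andP[w0 wd]; apply: (le_trans (integral_counting_le hpsi hm w0 n0 S0 HS)).
  rewrite lee_fin -/L.
  have : Re w * (1 + 128 * L) <= k / 2 by rewrite -ler_pdivlMr// ltW.
  have -> : 128 * expR 2 * S = A * h ^+ 2 by rewrite /S /A; ring.
  lra.
have near1 (P : set R[i]) (d : R) : 0 < d -> (forall w, 0 < Re w < d -> P w) -> Re_to_0plus P.
  by move=> d0 H; exists d.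
apply/fine_cvgP; split.
  have [d d0 Hd] := small 1 ltr01; apply: (near1 _ d d0) => w wd.
  have w0 : 0 < Re w by case/andP: wd.
  by rewrite ge0_fin_numE ?g0// (le_lt_trans (Hd w wd))// ltry.
apply/cvgrPdist_le => k k0; have [d d0 Hd] := small k k0; apply: (near1 _ d d0) => w wd /=.
have w0 : 0 < Re w by case/andP: wd.
rewrite sub0r normrN ger0_norm ?fine_ge0 ?g0//.
have fg : g w \is a fin_num by rewrite ge0_fin_numE ?g0// (le_lt_trans (Hd w wd))// ltry.
by rewrite -lee_fin fineK// Hd.
Qed.
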